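(* Let $\Omega\subset\mathbb{R}^n$ ($n\ge1$) be a smooth bounded (open, connected) domain and let $s\in(0,1)$. Then $$\lim_{p\to\infty}\lambda_1(s,p)^{1/p}=\frac{2}{\mathrm{diam}(\Omega)^s}=\lambda_1(s,\infty),\qquad \lambda_1(s,\infty):=\inf\left\{\frac{[u]_{W^{s,\infty}(\Omega)}}{\|u\|_{L^\infty(\Omega)}}: u\in\mathcal{A}\right\},$$ where $\mathcal{A}=\{u\in W^{s,\infty}(\Omega): u\ne0,\ \sup_\Omega u+\inf_\Omega u=0\}$. Moreover, for $p\in(1,\infty)$ let $u_p$ be a normalized minimizer of $\lambda_1(s,p)$, i.e. $u_p\in W^{s,p}(\Omega)$, $\|u_p\|_{L^p(\Omega)}=1$, $\int_\Omega|u_p|^{p-2}u_p\,dx=0$ and $[u_p]^p_{W^{s,p}(\Omega)}=\lambda_1(s,p)$. Then, up to a subsequence as $p\to\infty$ (that is, every sequence $p_j\to\infty$ has a subsequence along which this holds), $u_p$ converges in $C(\overline\Omega)$ to some $u_\infty\in W^{s,\infty}(\Omega)$ which is a minimizer of $\lambda_1(s,\infty)$ (that is, $u_\infty\in\mathcal{A}$ and $[u_\infty]_{W^{s,\infty}(\Omega)}=\lambda_1(s,\infty)\|u_\infty\|_{L^\infty(\Omega)}$) and which is a viscosity solution in $\Omega$ of $$\begin{cases}\max\{\mathscr{L}_{s,\infty}u(x),\ \mathscr{L}^-_{s,\infty}u(x)+\lambda_1(s,\infty)u(x)\}=0 & \text{when } u(x)>0,\\ \mathscr{L}_{s,\infty}u(x)=0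 & \text{when } u(x)=0,\\ \min\{\mathscr{L}_{s,\infty}u(x),\ \mathscr{L}^+_{s,\infty}u(x)+\lambda_1(s,\infty)u(x)\}=0 & \text{when } u(x)<0.\end{cases}$$
   Context: Notation. $\mathrm{diam}(\Omega)=\sup_{x,y\in\Omega}|x-y|$ (Euclidean diameter). For $s\in(0,1)$ and $1<p<\infty$, $$[u]_{W^{s,p}(\Omega)}=\left(\int_\Omega\int_\Omega\frac{|u(x)-u(y)|^p}{|x-y|^{n+sp}}\,dx\,dy\right)^{1/p},\qquad [u]_{W^{s,\infty}(\Omega)}=\left\|\frac{u(x)-u(y)}{|x-y|^s}\right\|_{L^\infty(\Omega\times\Omega)},$$ and for $p\in(1,\infty]$, $W^{s,p}(\Omega)=\{u\in L^p(\Omega):[u]_{W^{s,p}(\Omega)}<\infty\}$. Functions in $W^{s,\infty}(\Omega)$, and functions in $W^{s,p}(\Omega)$ with $sp>n$, are identified with their continuous representatives on $\overline\Omega$. For $p\in(1,\infty)$, $$\lambda_1(s,p)=\inf\left\{\frac{[u]_{W^{s,p}(\Omega)}^p}{\|u\|_{L^p(\Omega)}^p}: u\in W^{s,p}(\Omega),\ u\ne0,\ \int_\Omega|u|^{p-2}u\,dx=0\right\}.$$ Hölder $\infty$-Laplacian: $$\mathscr{L}^+_{s,\infty}u(x)=\sup_{y\in\overline\Omega,\,y\ne x}\frac{u(y)-u(x)}{|y-x|^s},\quad \mathscr{L}^-_{s,\infty}u(x)=\inf_{y\in\overline\Omega,\,y\ne x}\frac{u(y)-u(x)}{|y-x|^s},\quad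 \mathscr{L}_{s,\infty}u=\mathscr{L}^+_{s,\infty}u+\mathscr{L}^-_{s,\infty}u.$$ Viscosity solutions. A function $u\in C(\overline\Omega)$ is a viscosity super-solution (resp. sub-solution) in $\Omega$ of the equation in the claim if, whenever $x_0\in\Omega$ and $\varphi\in C^1(\overline\Omega)$ satisfy $\varphi(x_0)=u(x_0)$ and $\varphi\le u$ (resp. $\varphi\ge u$) on $\overline\Omega$, one has: if $\varphi(x_0)>0$, $\max\{\mathscr{L}_{s,\infty}\varphi(x_0),\ \mathscr{L}^-_{s,\infty}\varphi(x_0)+\lambda_1(s,\infty)\varphi(x_0)\}\le0$ (resp. $\ge0$); if $\varphi(x_0)=0$, $\mathscr{L}_{s,\infty}\varphi(x_0)\le0$ (resp. $\ge0$); if $\varphi(x_0)<0$, $\min\{\mathscr{L}_{s,\infty}\varphi(x_0),\ \mathscr{L}^+_{s,\infty}\varphi(x_0)+\lambda_1(s,\infty)\varphi(x_0)\}\le0$ (resp. $\ge0$). A viscosity solution is a function that is both a viscosity super-solution and a viscosity sub-solution. *)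

(* Defs.v *)
From HB Require Import structures.
From mathcomp Require Import all_boot all_order all_algebra.
From mathcomp Require Import all_classical all_reals all_analysis.

Set Implicit Arguments.
Unset Strict Implicit.
Unset Printing Implicit Defensive.

Import Order.TTheory GRing.Theory Num.Theory.
Import numFieldNormedType.Exports.

Local Open Scope classical_set_scope.
Local Open Scope ring_scope.

Definition rV_display : measure_display.
Proof. exact: default_measure_display. Qed.

(* Row vectors carry the sigma-algebra generated by the coordinates, i.e. the
   Borel sigma-algebra of R^n. *)
Section measurable_rV.
Context (R : realType) (n : nat).

Let coord : 'I_n -> 'rV[R]_n -> measurableTypeR R := fun i x => x 0 i.

Let rV_set0 : g_sigma_preimage coord set0.
Proof. exact: sigma_algebra0. Qed.

Let rV_setC A : g_sigma_preimage coord A -> g_sigma_preimage coord (~` A).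
Proof. exact: sigma_algebraC. Qed.

Let rV_bigcup (F : _^nat) : (forall i, g_sigma_preimage coord (F i)) ->
  g_sigma_preimage coord (\bigcup_i (F i)).
Proof. exact: sigma_algebra_bigcup. Qed.

HB.instance Definition _ := @isMeasurable.Build rV_display
  'rV[R]_n (g_sigma_preimage coord) rV_set0 rV_setC rV_bigcup.

Lemma measurable_coord_rV (i : 'I_n) :
  measurable_fun [set: 'rV[R]_n] (fun x => x 0 i : measurableTypeR R).
Proof.
move=> _ Y mY; rewrite setTI; apply: sub_sigma_algebra => /=.
rewrite -bigcup_seq/=; exists i => /=; first by rewrite mem_index_enum.
by exists Y => //; rewrite setTI.
Qed.

Lemma measurable_fun_rV d (T : measurableType d) (f : T -> 'rV[R]_n) :
  (forall i, measurable_fun [set: T] (fun t => f t 0 i : measurableTypeR R)) ->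
  measurable_fun [set: T] f.
Proof.
move=> mf; apply: (@measurability _ _ _ _ _ _ (\big[setU/set0]_(i < n)
  preimage_set_system setT (coord i) measurable)) => //.
move=> _ [B + <-]; rewrite -bigcup_seq => -[i _ [Y mY <-]].
by rewrite !setTI; rewrite -[X in measurable X]setTI; exact: mf.
Qed.

End measurable_rV.

Section lebesgue_measure_rV.
Context (R : realType).
Local Open Scope ereal_scope.

Definition row_cons n (z : measurableTypeR R * 'rV[R]_n) : 'rV[R]_n.+1 :=
  \row_(i < n.+1) oapp (z.2 0%R) z.1 (unlift ord0 i).

Lemma row_cons0 n z : @row_cons n z 0%R ord0 = z.1.
Proof. by rewrite mxE unlift_none. Qed.

Lemma row_consS n z i : @row_cons n z 0%R (lift ord0 i) = z.2 0%R i.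
Proof. by rewrite mxE liftK. Qed.

Lemma measurable_row_cons n : measurable_fun setT (@row_cons n).
Proof.
apply: measurable_fun_rV => i; case: (unliftP ord0 i) => [j|] ->.
- rewrite (_ : (fun _ => _) = (fun x : 'rV[R]_n => x 0%R j : measurableTypeR R) \o snd).
    by apply: measurableT_comp => //; exact: measurable_coord_rV.
  by apply/funext => z /=; rewrite row_consS.
- rewrite (_ : (fun _ => _) = fst) //.
  by apply/funext => z /=; rewrite row_cons0.
Qed.

Definition box n (A : 'I_n -> set (measurableTypeR R)) : set 'rV[R]_n :=
  [set x | forall i, A i (x 0%R i)].

Lemma measurable_box n (A : 'I_n -> set (measurableTypeR R)) :
  (forall i, measurable (A i)) -> measurable (box A).
Proof.
move=> mA; rewrite (_ : box A = \bigcap_(i in [set: 'I_n])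
   ((fun x : 'rV[R]_n => x 0%R i : measurableTypeR R) @^-1` A i)).
  apply: fin_bigcap_measurable => // i _.
  by rewrite -[X in measurable X]setTI; exact: measurable_coord_rV.
by apply/seteqP; split => x /= h i; [move=> _|]; exact: h.
Qed.

Lemma row_cons_box n (A : 'I_n.+1 -> set (measurableTypeR R)) :
  @row_cons n @^-1` box A = A ord0 `*` box (fun i => A (lift ord0 i)).
Proof.
apply/seteqP; split => [z /= h|z [/= h0 hS] i].
- split => [|i] /=; first by move: (h ord0); rewrite row_cons0.
  by move: (h (lift ord0 i)); rewrite row_consS.
- by case: (unliftP ord0 i) => [j|] ->; rewrite ?row_consS ?row_cons0//; exact: hS.
Qed.

Section cons_measure.
Context n (mu : {sigma_finite_measure set 'rV[R]_n -> \bar R}).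

Definition cons_measure : set 'rV[R]_n.+1 -> \bar R :=
  pushforward (@lebesgue_measure R \x mu) (@row_cons n).

Let cons_measure0 : cons_measure set0 = 0.
Proof. by rewrite /cons_measure /pushforward preimage_set0 measure0. Qed.

Let cons_measure_ge0 A : 0 <= cons_measure A.
Proof. by rewrite /cons_measure /pushforward. Qed.

Let cons_measure_sigma_additive : semi_sigma_additive cons_measure.
Proof.
move=> F mF tF mUF; rewrite /cons_measure /pushforward preimage_bigcup.
apply: measure_semi_sigma_additive.
- by move=> k; rewrite -[X in measurable X]setTI; exact: measurable_row_cons.
- apply/trivIsetP => /= i j _ _ ij; rewrite -preimage_setI.
  by move/trivIsetP : tF => /(_ _ _ _ _ ij) ->//; rewrite preimage_set0.
- by rewrite -preimage_bigcup -[X in measurable X]setTI; exact: measurable_row_cons.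
Qed.

HB.instance Definition _ := isMeasure.Build _ _ _ cons_measure
  cons_measure0 cons_measure_ge0 cons_measure_sigma_additive.

Let row_uncons (x : 'rV[R]_n.+1) : measurableTypeR R * 'rV[R]_n :=
  (x 0%R ord0, \row_i x 0%R (lift ord0 i)).

Let row_unconsK : cancel (@row_cons n) row_uncons.
Proof.
move=> [a v]; rewrite /row_uncons row_cons0; congr pair.
by apply/rowP => i; rewrite mxE row_consS.
Qed.

Let row_consK : cancel row_uncons (@row_cons n).
Proof.
move=> x; apply/rowP => i; case: (unliftP ord0 i) => [j|] ->.
  by rewrite row_consS mxE.
by rewrite row_cons0.
Qed.

Let measurable_row_uncons : measurable_fun setT row_uncons.
Proof.
apply/measurable_fun_pairP; split; first exact: (measurable_coord_rV ord0).
apply: measurable_fun_rV => i; rewrite (_ : (fun _ => _) =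
  (fun x : 'rV[R]_n.+1 => x 0%R (lift ord0 i) : measurableTypeR R)).
  exact: measurable_coord_rV.
by apply/funext => x /=; rewrite mxE.
Qed.

Let cons_measure_sigma_finite : sigma_finite setT cons_measure.
Proof.
have /sigma_finiteP[F [FT ndF F_oo]] := sigma_finiteT (@lebesgue_measure R).
have /sigma_finiteP[G [GT ndG G_oo]] := sigma_finiteT mu.
exists (fun k => row_uncons @^-1` (F k `*` G k)).
  apply/esym; rewrite -subTset => x _.
  have : [set: measurableTypeR R] (row_uncons x).1 by [].
  rewrite FT => -[i _ Fi].
  have : [set: 'rV[R]_n] (row_uncons x).2 by [].
  rewrite GT => -[j _ Gj].
  exists (maxn i j) => //; split => /=.
    by have /subsetPset := ndF _ _ (leq_maxl i j); apply.
  by have /subsetPset := ndG _ _ (leq_maxr i j); apply.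
move=> k; have [mF Foo] := F_oo k; have [mG Goo] := G_oo k; split.
  rewrite -[X in measurable X]setTI; apply: measurable_row_uncons => //.
  exact: measurableX.
rewrite /cons_measure /pushforward -comp_preimage.
rewrite (_ : row_uncons \o _ = id); last first.
  by apply/funext => z; exact: row_unconsK.
by rewrite preimage_id product_measure1E// lte_mul_pinfty// ge0_fin_numE.
Qed.

HB.instance Definition _ :=
  @Measure_isSigmaFinite.Build _ _ _ cons_measure cons_measure_sigma_finite.

End cons_measure.

(* n-dimensional Lebesgue measure on Borel sets, as an iterated product;
   [lebesgue_rV_box] gives its values on boxes. *)
Fixpoint lebesgue_rV n : {sigma_finite_measure set 'rV[R]_n -> \bar R} :=
  match n with
  | 0 => @dirac _ 'rV[R]_0 0%R R
  | n'.+1 => cons_measure (lebesgue_rV n')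
  end.

Lemma lebesgue_rV_box n (A : 'I_n -> set (measurableTypeR R)) :
  (forall i, measurable (A i)) ->
  lebesgue_rV n (box A) = \prod_(i < n) lebesgue_measure (A i).
Proof.
elim: n A => [|n ih] A mA /=.
  by rewrite big_ord0 diracE mem_set// => -[].
rewrite /cons_measure /pushforward row_cons_box.
by rewrite product_measure1E ?ih ?big_ord_recl//; exact: measurable_box.
Qed.

End lebesgue_measure_rV.

Section euclidean.
Context (R : realType) (n : nat).
Implicit Types (Omega : set 'rV[R]_n) (x : 'rV[R]_n) (u : 'rV[R]_n -> R).

(* The library norm `|x| on row vectors is the sup norm. *)
Definition enorm x : R := Num.sqrt (\sum_(i < n) x 0 i ^+ 2).

Definition diam Omega : R := sup [set enorm (x - y) | x in Omega & y in Omega].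

Definition C0_closure Omega u := {within closure Omega, continuous u}.

(* u is continuously differentiable in Omega, and u and its first-order partial
   derivatives extend continuously to the closure. *)
Definition C1_closure Omega u :=
  C0_closure Omega u /\
  forall i : 'I_n,
    (forall x, Omega x -> derivable u x (delta_mx 0 i)) /\
    exists2 g : 'rV[R]_n -> R, C0_closure Omega g &
      forall x, Omega x -> g x = 'D_(delta_mx 0 i) u x.

End euclidean.

Section smooth_domain.
Context (R : realType).

Fixpoint Ck n (k : nat) (f : 'rV[R]_n -> R) : Prop :=
  continuous f /\
  if k is k'.+1 then
    forall i : 'I_n, (forall x, derivable f x (delta_mx 0 i)) /\
      Ck k' (fun x => 'D_(delta_mx 0 i) f x)
  else True.

Definition smooth n (f : 'rV[R]_n -> R) := forall k, Ck k f.

(* Near each boundary point, Omega is one side of the graph of a smooth function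
   gamma of the n - 1 remaining coordinates [col' k x]; the sign (-1) ^+ b
   selects the side. *)
Definition smooth_boundary n (Omega : set 'rV[R]_n) :=
  forall x0, (closure Omega `\` Omega) x0 ->
  exists (r : R) (k : 'I_n) (b : bool) (gamma : 'rV[R]_n.-1 -> R),
    [/\ 0 < r, smooth gamma &
        forall x, enorm (x - x0) < r ->
          (Omega x <-> gamma (col' k x) < (-1) ^+ b * x 0 k)].

Definition smooth_bounded_domain n (Omega : set 'rV[R]_n) :=
  [/\ Omega !=set0, open Omega, connected Omega, bounded_set Omega &
      smooth_boundary Omega].

End smooth_domain.

Section fractional_sobolev.
Context (R : realType) (n : nat).
Implicit Types (Omega : set 'rV[R]_n) (s p : R) (u : 'rV[R]_n -> R).

Local Notation mu := (@lebesgue_rV R n).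
Local Open Scope ereal_scope.

Definition Lp_norm Omega (p : \bar R) u : \bar R :=
  'N[mu]_p [(EFin \o u) \_ Omega].

(* On the diagonal the quotients below are 0 / 0 = 0. *)
Definition gagliardo Omega s p u : \bar R :=
  (\int[mu]_(x in Omega) \int[mu]_(y in Omega)
     (`|u x - u y| `^ p / enorm (x - y) `^ (n%:R + s * p))%:E) `^ p^-1.

Definition holder_seminorm Omega s u : \bar R :=
  'N[mu \x mu]_+oo [(fun z : 'rV[R]_n * 'rV[R]_n =>
    ((u z.1 - u z.2) / enorm (z.1 - z.2) `^ s)%:E) \_ (Omega `*` Omega)].

Definition Wsp Omega s p u :=
  [/\ measurable_fun Omega u, Lp_norm Omega p%:E u < +oo &
      gagliardo Omega s p u < +oo].

(* Elements of W^{s,oo} are represented by their continuous representatives. *)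
Definition Winfty Omega s u :=
  [/\ C0_closure Omega u, measurable_fun Omega u, Lp_norm Omega +oo u < +oo &
      holder_seminorm Omega s u < +oo].

Definition nonzero Omega u := ~ {ae mu, forall x, Omega x -> u x = 0%R}.

Definition mean_p Omega p u : \bar R :=
  \int[mu]_(x in Omega) (`|u x| `^ (p - 2) * u x)%:E.

Definition lambda1 Omega s p : \bar R :=
  ereal_inf [set gagliardo Omega s p u `^ p / Lp_norm Omega p%:E u `^ p | u in
    [set u | [/\ Wsp Omega s p u, nonzero Omega u & mean_p Omega p u = 0]]].

Definition admissible Omega s : set ('rV[R]_n -> R) :=
  [set u | [/\ Winfty Omega s u, nonzero Omega u &
               (sup (u @` Omega) + inf (u @` Omega) = 0)%R]].

Definition lambda1_infty Omega s : \bar R :=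
  ereal_inf [set holder_seminorm Omega s u / Lp_norm Omega +oo u |
             u in admissible Omega s].

(* For s * p > n the continuous representative is chosen. *)
Definition normalized_minimizer Omega s p u :=
  [/\ Wsp Omega s p u, Lp_norm Omega p%:E u = 1, mean_p Omega p u = 0,
      gagliardo Omega s p u `^ p = lambda1 Omega s p &
      (n%:R < s * p)%R -> C0_closure Omega u].

Definition minimizer_infty Omega s u :=
  admissible Omega s u /\
  holder_seminorm Omega s u = lambda1_infty Omega s * Lp_norm Omega +oo u.

End fractional_sobolev.

Section holder_infinity_laplacian.
Context (R : realType) (n : nat).
Implicit Types (Omega : set 'rV[R]_n) (s : R) (x : 'rV[R]_n).
Implicit Types (u phi : 'rV[R]_n -> R).
Local Open Scope ereal_scope.

Definition holder_quotients Omega s u x : set (\bar R) :=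
  [set ((u y - u x) / enorm (y - x) `^ s)%:E | y in closure Omega `\ x].

Definition Lplus Omega s u x : \bar R := ereal_sup (holder_quotients Omega s u x).

Definition Lminus Omega s u x : \bar R := ereal_inf (holder_quotients Omega s u x).

(* Both terms are finite when u is C^1 up to the boundary and x is in Omega. *)
Definition Linfty Omega s u x : \bar R := Lplus Omega s u x + Lminus Omega s u x.

(* The left-hand side of the equation, evaluated on the function u at x. *)
Definition eigen_op Omega s u x : \bar R :=
  let lam := lambda1_infty Omega s in
  if (0 < u x)%R then
    maxe (Linfty Omega s u x) (Lminus Omega s u x + lam * (u x)%:E)
  else if u x == 0%R then Linfty Omega s u x
  else mine (Linfty Omega s u x) (Lplus Omega s u x + lam * (u x)%:E).

Definition viscosity_supersolution Omega s u :=
  C0_closure Omega u /\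
  forall x0 phi, Omega x0 -> C1_closure Omega phi -> phi x0 = u x0 ->
    (forall y, closure Omega y -> (phi y <= u y)%R) ->
    eigen_op Omega s phi x0 <= 0.

Definition viscosity_subsolution Omega s u :=
  C0_closure Omega u /\
  forall x0 phi, Omega x0 -> C1_closure Omega phi -> phi x0 = u x0 ->
    (forall y, closure Omega y -> (u y <= phi y)%R) ->
    0 <= eigen_op Omega s phi x0.

Definition viscosity_solution Omega s u :=
  viscosity_supersolution Omega s u /\ viscosity_subsolution Omega s u.

End holder_infinity_laplacian.

(* Main.v *)
(* Write Lam = 2 / diam^s. The smooth boundary gives a corkscrew condition, and
   telescoping over shrinking balls then yields a Morrey estimate whose constant
   does not depend on p: functions of energy at most M^p, p large, are
   equi-Hoelder. A sequence of normalized functions with energies at most M^p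
   for every M > L therefore has a uniformly convergent subsequence; its limit v
   satisfies |v x - v y| <= L |x - y|^s, and the normalization and the
   (p-1)-mean condition force sup v = 1 and inf v = -1. Such a v exists only if
   L >= Lam, which bounds lambda_1(s,p)^(1/p) from below; the distance to one end
   of a diameter, rescaled and shifted to have vanishing (p-1)-mean, bounds it
   from above. Applied to the minimizers u_p, with L = Lam, this gives the
   limiting minimizer.

   The viscosity inequalities are obtained without an Euler-Lagrange equation.
   If a test function phi touching the limit from below violates them at x0,
   u_p is compared with w = max(u_p, phi - eta |x - x0|^2 + delta). Convexity of
   t -> |t|^p and minimality of u_p give an inequality between lambda_1(s,p) and
   integrals of (w - u_p) against (p-1)-th powers of difference quotients of phi,
   and comparing exponential rates as p -> oo gives a contradiction.
   Subsolutions follow by changing signs. *)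
Require Import Defs.
From mathcomp Require Import all_boot all_order all_algebra.
From mathcomp Require Import all_classical all_reals all_analysis.
From mathcomp Require Import measurable_realfun ess_sup_inf.
From mathcomp Require Import ring lra.
Import Order.TTheory GRing.Theory Num.Theory.
Import numFieldNormedType.Exports.

Set Implicit Arguments.
Unset Strict Implicit.
Unset Printing Implicit Defensive.

Local Open Scope classical_set_scope.
Local Open Scope ring_scope.

(** * Signed powers *)

(** The obstacle is uniformity in p. In the Morrey estimate averages over balls are replaced by
    single points found by pigeonhole, so that every p-dependent loss has the form K^(1/p) <= K + 1.
    Half of the Hoelder exponent is given up: once n <= s p / 2, the surplus power of the radius
    outweighs its n-th power. In the comparison of u_p with w = u_p + psi the vanishing mean is
    lost. Subtracting a constant restores it, leaves the energy unchanged, and drops out of the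
    convexity inequality because u_p itself has vanishing (p-1)-mean. All remaining terms are
    proportional to the integral of psi, about which nothing quantitative is known, and it cancels.
    What is left compares exponentials in p, with bases Lam phi(x0), the largest forward quotient A
    of phi at x0 and the largest backward quotient B. It yields A <= max(B, - Lam phi(x0)) and Lam
    phi(x0) <= B, and these two inequalities contain the supersolution condition for all three signs
    of phi(x0). Since phi is C^1 and s < 1, short distances are harmless: there |phi x - phi y| is
    small against |x - y|^s. *)

Section powR_complements.
Context (R : realType).
Implicit Types a b m p q t x y C : R.

(** Each fraction z / (x + y) lies in [0, 1], where t <= t^a, and the two fractions add up to 1. *)
Lemma powR_addl_le a x y : 0 < a -> a <= 1 -> 0 <= x -> 0 <= y ->
  (x + y) `^ a <= x `^ a + y `^ a.
Proof.
move=> a0 a1 x0 y0.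
have [xy0|xy0] := eqVneq (x + y) 0.
  by rewrite xy0 powR0 ?gt_eqF// addr_ge0 ?powR_ge0.
have s0 : 0 < x + y by rewrite lt_neqAle eq_sym xy0 addr_ge0.
have frac z : 0 <= z -> z <= x + y -> z / (x + y) * (x + y) `^ a <= z `^ a.
  move=> z0 zs; have [->|zn0] := eqVneq z 0.
    by rewrite !mul0r powR_ge0.
  have zp : 0 < z by rewrite lt_neqAle eq_sym zn0.
  have -> : z `^ a = (z / (x + y)) `^ a * (x + y) `^ a.
    by rewrite -powRM ?divr_ge0 ?(ltW s0)// divfK.
  rewrite ler_wpM2r ?powR_ge0// ger1_powR// divr_gt0//=.
  by rewrite ler_pdivrMr// mul1r.
apply: le_trans (lerD (frac _ x0 _) (frac _ y0 _)); rewrite ?lerDl ?lerDr//.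
by rewrite -mulrDl -mulrDl divff// mul1r.
Qed.

(** The comparison of exponential rates behind the passages to the limit p -> oo: the ratio (a /
    b)^p is an exponential and beats the affine function [1 + p * L]. *)
Lemma near_powR_dominated a b m C : 0 <= b -> b < a -> 0 < m ->
  \forall p \near +oo, C * b `^ p < m * a `^ p.
Proof.
move=> b0 ba m0; have a0 : 0 < a by exact: le_lt_trans ba.
have [bz|bn0] := eqVneq b 0.
  near=> p; have p0 : 0 < p by near: p; exact: nbhs_pinfty_gt.
  by rewrite bz powR0 ?gt_eqF// mulr0 mulr_gt0// powR_gt0.
have bp : 0 < b by rewrite lt_neqAle eq_sym bn0.
pose L := ln (a / b).
have L0 : 0 < L by rewrite ln_gt0// ltr_pdivlMr// mul1r.
near=> p; have p0 : 0 < p by near: p; exact: nbhs_pinfty_gt.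
have -> : a `^ p = (a / b) `^ p * b `^ p.
  by rewrite -powRM ?divr_ge0 ?ltW// divfK.
rewrite mulrA ltr_pM2r ?powR_gt0// -ltr_pdivrMl// mulrC.
apply: lt_le_trans (_ : 1 + p * L <= _); last first.
  by rewrite /powR gt_eqF ?divr_gt0// -/L expR_ge1Dx.
rewrite -ltrBlDl -ltr_pdivrMr//.
by near: p; apply: nbhs_pinfty_gt; exact: num_real.
Unshelve. all: by end_near. Qed.

(* [spow p t] is |t|^(p-2) t, the derivative of |t|^p / p. *)
Definition spow p t := `|t| `^ (p - 2) * t.

Lemma spow0 p : spow p 0 = 0. Proof. by rewrite /spow mulr0. Qed.

Lemma spowN p t : spow p (- t) = - spow p t.
Proof. by rewrite /spow normrN mulrN. Qed.

Lemma spow_ge0E p t : 1 < p -> 0 <= t -> spow p t = t `^ (p - 1).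
Proof.
move=> p1 t0; rewrite /spow ger0_norm//.
have [->|tn0] := eqVneq t 0.
  by rewrite mulr0 powR0// subr_eq0 gt_eqF.
rewrite -{2}(powRr1 t0) -powRD; first by congr powR; lra.
by apply/implyP => _.
Qed.

Lemma spow_ge0 p t : 0 <= t -> 0 <= spow p t.
Proof. by move=> t0; rewrite /spow mulr_ge0 ?powR_ge0. Qed.

Lemma spow_le p : 1 < p -> {homo spow p : x y / x <= y}.
Proof.
move=> p1; have pos x y : 0 <= x -> x <= y -> spow p x <= spow p y.
  move=> x0 xy; rewrite !spow_ge0E// ?(le_trans x0)//.
  by apply: ge0_ler_powR; rewrite ?nnegrE ?subr_ge0 ?(ltW p1)// (le_trans x0).
move=> x y xy; have [x0|x0] := leP 0 x; first exact: pos.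
have [y0|y0] := leP 0 y.
  rewrite (@le_trans _ _ 0) ?spow_ge0//.
  by rewrite -[x]opprK spowN oppr_le0 spow_ge0// oppr_ge0 ltW.
rewrite -[x]opprK -[y]opprK !(spowN _ (- _)) lerN2 pos// ?oppr_ge0 ?lerN2//.
exact: ltW.
Qed.

Lemma spow_mul p t : 1 < p -> spow p t * t = `|t| `^ p.
Proof.
move=> p1; rewrite /spow -mulrA -expr2 -real_normK ?num_real//.
have [->|t0] := eqVneq t 0.
  by rewrite normr0 expr0n/= mulr0 powR0// gt_eqF// (lt_trans _ p1).
rewrite -powR_mulrn// -powRD; last by rewrite normr_eq0 t0 implybT.
by congr powR; lra.
Qed.

Lemma normr_spow p t : 1 < p -> `|spow p t| = `|t| `^ (p - 1).
Proof.
move=> p1; have [t0|t0] := leP 0 t.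
  by rewrite spow_ge0E// !ger0_norm// powR_ge0.
rewrite -normrN -spowN spow_ge0E ?oppr_ge0 ?(ltW t0)//.
by rewrite ger0_norm ?powR_ge0// ltr0_norm.
Qed.

(** Young's inequality for |b| and |a|^(p-1) with exponents p and p / (p - 1). It serves twice: for
    the values of a function in the p-norm and for its differences in the energy. *)
Lemma powR_convex_tangent p a b : 1 < p ->
  `|a| `^ p + p * spow p a * (b - a) <= `|b| `^ p.
Proof.
move=> p1; have p0 : 0 < p by lra.
have q0 : 0 < p / (p - 1) by rewrite divr_gt0// subr_gt0.
have := @conjugate_powR R `|b| (`|a| `^ (p - 1)) p (p / (p - 1))
  (normr_ge0 _) (powR_ge0 _ _) p0 q0.
have p1n : p - 1 != 0 by rewrite gt_eqF// subr_gt0.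
have pn : p != 0 by rewrite gt_eqF.
rewrite -powRrM mulrCA divff ?mulr1//.
have -> : p^-1 + (p / (p - 1))^-1 = 1 by field; apply/andP.
move=> /(_ erefl) young.
have le1 : spow p a * b <= `|b| * `|a| `^ (p - 1).
  by apply: le_trans (ler_norm _) _; rewrite normrM normr_spow// mulrC.
have := le_trans le1 young.
rewrite -(ler_pM2l p0) [X in _ <= X -> _](_ : _ = `|b| `^ p + (p - 1) * `|a| `^ p); last first.
  by field; apply/andP.
rewrite -(spow_mul a p1); lra.
Qed.

Lemma continuous_normr_powR q : 0 < q -> continuous (fun t => `|t| `^ q).
Proof.
move=> q0 t; have [->|t0] := eqVneq t 0.
  rewrite /continuous_at normr0 powR0 ?gt_eqF//.
  apply/cvgrPdist_lt => e e0.
  have d0 : 0 < e `^ q^-1 by exact: powR_gt0.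
  exists (e `^ q^-1) => //= x; rewrite /= sub0r normrN => xd.
  rewrite sub0r normrN ger0_norm ?powR_ge0//.
  rewrite [ltRHS](_ : e = (e `^ q^-1) `^ q); last first.
    by rewrite -powRrM mulVf ?gt_eqF// powRr1// ltW.
  by apply: gt0_ltr_powR; rewrite ?nnegrE ?powR_ge0.
have e (u : R) : u != 0 -> `|u| `^ q = expR (q * ln `|u|).
  by move=> u0; rewrite /powR normr_eq0 (negbTE u0).
have cl : {for t, continuous (fun u : R => expR (q * ln `|u|))}.
  apply: continuous_comp; last exact: continuous_expR.
  apply: cvgMr; apply: continuous_comp; first exact: norm_continuous.
  by apply: continuous_ln; rewrite normr_gt0.
rewrite /continuous_at e//; apply: cvg_trans cl; apply: near_eq_cvg.
have : \forall u \near t, u != 0 by exact: (@cvgr_neq0 _ _ _ _ _ id t (@cvg_id _ (nbhs t))).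
by apply: filterS => u u0; rewrite e.
Qed.

Lemma continuous_spow p : 2 < p -> continuous (spow p).
Proof.
move=> p2 t; apply: cvgM; last exact: cvg_id.
by apply: continuous_normr_powR; rewrite subr_gt0.
Qed.

End powR_complements.

(** * The Euclidean norm on row vectors *)

Section euclidean_norm.
Context (R : realType) (n : nat).
Implicit Types x y z : 'rV[R]_n.

Lemma normr_coord_le x i : `|x 0 i| <= `|x|.
Proof.
by rewrite [leRHS]mx_normrE; apply: (le_bigmax _ (fun ij => `|x ij.1 ij.2|) (0, i)).
Qed.

Lemma normr_coordB_le x y i : `|x 0 i - y 0 i| <= `|x - y|.
Proof. by have := normr_coord_le (x - y) i; rewrite !mxE. Qed.

Lemma normr_rV_le x M : 0 <= M -> (forall i, `|x 0 i| <= M) -> `|x| <= M.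
Proof.
move=> M0 h; rewrite [leLHS]mx_normrE; apply/bigmax_leP; split=> // -[i j] _ /=.
by rewrite (ord1 i).
Qed.

Lemma normr_rV_lt x M : 0 < M -> (forall i, `|x 0 i| < M) -> `|x| < M.
Proof.
move=> M0 h; rewrite [ltLHS]mx_normrE; apply/bigmax_ltP; split=> // -[i j] _ /=.
by rewrite (ord1 i).
Qed.

Lemma ball_rVE x r y : ball x r y = (`|x - y| < r) :> Prop.
Proof. by rewrite -ball_normE. Qed.

Lemma enorm_ge0 x : 0 <= enorm x. Proof. exact: sqrtr_ge0. Qed.

Lemma sqr_enorm x : enorm x ^+ 2 = \sum_(i < n) x 0 i ^+ 2.
Proof. by rewrite sqr_sqrtr// sumr_ge0// => i _; rewrite sqr_ge0. Qed.

Lemma enorm0 : enorm (0 : 'rV[R]_n) = 0.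
Proof. by rewrite /enorm big1 ?sqrtr0// => i _; rewrite mxE expr0n. Qed.

Lemma enormN x : enorm (- x) = enorm x.
Proof. by congr Num.sqrt; apply: eq_bigr => i _; rewrite mxE sqrrN. Qed.

Lemma enorm_subC x y : enorm (x - y) = enorm (y - x).
Proof. by rewrite -enormN opprB. Qed.

Lemma coord_le_enorm x i : `|x 0 i| <= enorm x.
Proof.
rewrite -ler_sqr ?nnegrE ?enorm_ge0// sqr_enorm real_normK ?num_real//.
by rewrite (bigD1 i)//= lerDl sumr_ge0// => j _; rewrite sqr_ge0.
Qed.

Lemma norm_le_enorm x : `|x| <= enorm x.
Proof. by apply: normr_rV_le; [exact: enorm_ge0|exact: coord_le_enorm]. Qed.

Lemma enorm_le_norm x : enorm x <= n%:R * `|x|.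
Proof.
have [n0|n0] := posnP n.
  rewrite /enorm big1 ?sqrtr0 ?mulr_ge0// => i _.
  by have := ltn_ord i; rewrite [X in (_ < X)%N]n0.
rewrite -ler_sqr ?nnegrE ?enorm_ge0 ?mulr_ge0// sqr_enorm.
apply: (@le_trans _ _ (\sum_(i < n) `|x| ^+ 2)).
  apply: ler_sum => i _; rewrite -real_normK ?num_real//.
  by rewrite ler_sqr ?nnegrE// normr_coord_le.
rewrite sumr_const card_ord -[leLHS]mulr_natl exprMn ler_wpM2r ?sqr_ge0//.
by rewrite -natrX ler_nat -[leqLHS]expn1 leq_pexp2l.
Qed.

Lemma enorm_eq0 x : (enorm x == 0) = (x == 0).
Proof.
apply/eqP/eqP => [x0|->]; last exact: enorm0.
by apply/eqP; rewrite -normr_le0 -x0 norm_le_enorm.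
Qed.

Lemma enorm_gt0 x : (0 < enorm x) = (x != 0).
Proof. by rewrite lt_neqAle enorm_ge0 andbT eq_sym enorm_eq0. Qed.

(** Cauchy-Schwarz by summing a b <= (Y/X) a^2 / 2 + (X/Y) b^2 / 2 over the coordinates; the weights
    make each of the two sums X Y / 2. *)
Lemma enorm_dot_le x y : \sum_(i < n) x 0 i * y 0 i <= enorm x * enorm y.
Proof.
have [->|x0] := eqVneq x 0.
  by rewrite enorm0 mul0r big1// => i _; rewrite mxE mul0r.
have [->|y0] := eqVneq y 0.
  by rewrite enorm0 mulr0 big1// => i _; rewrite mxE mulr0.
have X0 : 0 < enorm x by rewrite enorm_gt0.
have Y0 : 0 < enorm y by rewrite enorm_gt0.
set X := enorm x in X0 *; set Y := enorm y in Y0 *.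
have step (a b : R) : a * b <= (Y / X) / 2 * a ^+ 2 + (X / Y) / 2 * b ^+ 2.
  rewrite -subr_ge0.
  have -> : Y / X / 2 * a ^+ 2 + X / Y / 2 * b ^+ 2 - a * b =
    (Y * a - X * b) ^+ 2 / (2 * X * Y) by field; rewrite !gt_eqF.
  by rewrite divr_ge0 ?sqr_ge0// !mulr_ge0 ?ltW.
apply: (@le_trans _ _ (\sum_(i < n)
    ((Y / X) / 2 * x 0 i ^+ 2 + (X / Y) / 2 * y 0 i ^+ 2))).
  exact: ler_sum.
rewrite big_split/= -!mulr_sumr -!sqr_enorm -/X -/Y.
by rewrite [leLHS](_ : _ = X * Y)//; field; rewrite !gt_eqF.
Qed.

Lemma enorm_triangle x y : enorm (x + y) <= enorm x + enorm y.
Proof.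
rewrite -ler_sqr ?nnegrE ?addr_ge0 ?enorm_ge0// sqrrD !sqr_enorm.
under eq_bigr do rewrite mxE sqrrD.
rewrite !big_split/= lerD2r lerD2l.
by rewrite mulr2n lerD ?enorm_dot_le.
Qed.

Lemma enorm_dist x y : `|enorm x - enorm y| <= enorm (x - y).
Proof.
have h (a b : 'rV[R]_n) : enorm a - enorm b <= enorm (a - b).
  by have := enorm_triangle (a - b) b; rewrite subrK; lra.
by rewrite ler_norml h andbT lerNl opprB enorm_subC h.
Qed.

Lemma continuous_enorm : continuous (@enorm R n).
Proof.
move=> x; rewrite /continuous_at; apply/(@cvgrPdist_lt _ R^o _ (nbhs x)) => e e0.
have d0 : 0 < e / (n%:R + 1) by rewrite divr_gt0// ltr_wpDl.
near=> y; have xy : `|x - y| < e / (n%:R + 1).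
  by rewrite -ball_rVE; near: y; exact: nbhsx_ballx.
apply: le_lt_trans (enorm_dist _ _) _; apply: le_lt_trans (enorm_le_norm _) _.
move: xy; rewrite ltr_pdivlMr ?ltr_wpDl// => h; apply: le_lt_trans h.
by rewrite mulrC ler_wpM2l// lerDl.
Unshelve. all: by end_near. Qed.

Lemma continuous_enorm_sub x0 : continuous (fun x => enorm (x - x0)).
Proof.
move=> x; apply: (@cvg_comp _ _ _ (fun z : 'rV[R]_n => z - x0) (@enorm R n) _ (nbhs (x - x0)));
  last exact: continuous_enorm.
by apply: (@cvgB R 'rV[R]_n _ (nbhs x) _ (fun z => z) (fun=> x0)); [exact: cvg_id|exact: cvg_cst].
Qed.

Lemma cvg_enormB x y : enorm (z.1 - z.2) @[z --> (x, y)] --> enorm (x - y).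
Proof.
apply: (@cvg_comp _ _ _ (fun z : 'rV[R]_n * 'rV[R]_n => z.1 - z.2)
    (@enorm R n) _ (nbhs (x - y))).
  by apply: cvgB; [exact: cvg_fst|exact: cvg_snd].
exact: continuous_enorm.
Qed.

End euclidean_norm.

(** * Lipschitz bounds from partial derivatives *)

Section partial_derivatives.
Context (R : realType) (m : nat).
Implicit Types (f : 'rV[R]_m -> R) (x y z a : 'rV[R]_m).

Lemma is_derive_line f a v t : derivable f (a + t *: v) v ->
  is_derive (t : R) (1 : R) (fun u : R => f (a + u *: v)) ('D_v f (a + t *: v)).
Proof.
move=> df.
have E : (fun h : R => h^-1 *: (((fun u : R => f (a + u *: v)) \o shift t) (h *: (1 : R))
    - f (a + t *: v))) =
  (fun h : R => h^-1 *: ((f \o shift (a + t *: v)) (h *: v) - f (a + t *: v))).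
  apply/funext => h /=; congr (_ *: (f _ - _)).
  by rewrite [h *: 1]mulr1 scalerDl addrCA.
by split; [move: df; rewrite /derivable E|rewrite /derive E].
Qed.

(** Mean value theorem along a coordinate segment, which stays in the ball because balls of the sup
    norm are boxes. A negative increment is treated by exchanging the endpoints. *)
Lemma partial_increment_le f z r M i x h :
  (forall y, ball z r y -> derivable f y (delta_mx 0 i) /\
     `|'D_(delta_mx 0 i) f y| <= M) ->
  ball z r x -> ball z r (x + h *: delta_mx 0 i) ->
  `|f (x + h *: delta_mx 0 i) - f x| <= M * `|h|.
Proof.
move=> H; wlog h0 : x h / 0 <= h.
  move=> W bx bxh; have [|h0] := leP 0 h; first by move=> h0; exact: W.
  have E : x = (x + h *: delta_mx 0 i) + (- h) *: delta_mx 0 i.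
    by rewrite -addrA -scalerDl subrr scale0r addr0.
  rewrite distrC -[`|h|]normrN {1}E; apply: W; rewrite -?E//.
  by rewrite oppr_ge0 ltW.
move=> bx bxh.
have bt t : t \in `[0, h] -> ball z r (x + t *: delta_mx 0 i).
  rewrite in_itv/= => /andP[t0 th]; move: bx bxh; rewrite !ball_rVE => bx bxh.
  have r0 : 0 < r by exact: le_lt_trans bx.
  apply: normr_rV_lt => // j; move: (normr_coord_le (z - x) j)
    (normr_coord_le (z - (x + h *: delta_mx 0 i)) j).
  rewrite !mxE => /le_lt_trans/(_ bx) + /le_lt_trans/(_ bxh).
  rewrite eqxx/=; case: eqP => _; rewrite ?mulr0 ?mulr1 ?addr0//=.
  rewrite !ltr_norml; lra.
have [||c cI E] := @MVT_segment R (fun t => f (x + t *: delta_mx 0 i))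
    (fun t => 'D_(delta_mx 0 i) f (x + t *: delta_mx 0 i)) 0 h h0.
- move=> t tI; apply: is_derive_line; apply: (H _ _).1; apply: bt.
  by move: tI; rewrite !in_itv/= => /andP[/ltW -> /ltW ->].
- apply: derivable_within_continuous => t tI.
  by have [] := is_derive_line (H _ (bt _ tI)).1.
move: E; rewrite scale0r addr0 subr0 => ->.
by rewrite normrM ler_wpM2r//; exact: (H _ (bt _ cI)).2.
Qed.

(** The points [P k], with the first k coordinates of y and the others of x, lead from x to y by
    moves along the axes; a sup-norm ball contains all of them. *)
Lemma lipschitz_of_partials f z r M :
  (forall i y, ball z r y -> derivable f y (delta_mx 0 i) /\
     `|'D_(delta_mx 0 i) f y| <= M) ->
  forall x y, ball z r x -> ball z r y -> `|f y - f x| <= m%:R * M * `|y - x|.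
Proof.
move=> H x y; rewrite !ball_rVE => bx by_.
have r0 : 0 < r by exact: le_lt_trans bx.
pose P k : 'rV[R]_m := \row_(i < m) (if (i < k)%N then y 0 i else x 0 i).
have bP k : ball z r (P k).
  rewrite ball_rVE; apply: normr_rV_lt => // j; rewrite !mxE.
  move: (normr_coord_le (z - x) j) (normr_coord_le (z - y) j).
  rewrite !mxE => /le_lt_trans/(_ bx) + /le_lt_trans/(_ by_).
  by case: ifP.
have PS (k : 'I_m) : P k.+1 = P k + (y 0 k - x 0 k) *: delta_mx 0 k.
  apply/rowP => j; rewrite !mxE ltnS/= leq_eqVlt.
  have [->|jk] := eqVneq j k; rewrite ?eqxx/= ?ltnn ?mulr1 ?subrKC//.
  by rewrite -[_ == _ :> nat]/(j == k) (negbTE jk)/= mulr0 addr0.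
have -> : f y - f x = \sum_(k < m) (f (P k.+1) - f (P k)).
  rewrite -(big_mkord xpredT (fun k => f (P k.+1) - f (P k))) telescope_sumr//.
  congr (f _ - f _); apply/rowP => j; rewrite !mxE ?ltn_ord//.
apply: le_trans (ler_norm_sum _ _ _) _.
rewrite -mulrA mulr_natl -[X in _ *+ X]card_ord -sumr_const.
apply: ler_sum => k _; rewrite PS.
apply: le_trans (partial_increment_le (H k) _ _) _ => //.
  by rewrite -PS.
have M0 : 0 <= M by apply: le_trans (H k _ (bP k)).2.
rewrite ler_wpM2l//; have := normr_coord_le (y - x) k.
by rewrite !mxE.
Qed.

End partial_derivatives.

(** * Lebesgue measure of open sets *)

Section borel_rV.
Context (R : realType) (n : nat).
Implicit Types (x y z : 'rV[R]_n) (r : R).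

Local Notation mu := (@lebesgue_rV R n).

Lemma ball_rV_box z r : 0 < r ->
  ball z r = box (fun i => ball (z 0 i) r : set (measurableTypeR R)).
Proof.
move=> r0; apply/seteqP; split => y; rewrite ball_rVE => h.
  move=> i /=; rewrite -ball_normE/=; apply: le_lt_trans h.
  by have := normr_coord_le (z - y) i; rewrite !mxE.
by apply: normr_rV_lt => // i; have := h i; rewrite -ball_normE/= !mxE.
Qed.

Lemma measurable_ball_rV z r : measurable (ball z r).
Proof.
have [r0|r0] := ltP 0 r.
  by rewrite ball_rV_box//; apply: measurable_box => i; exact: measurable_ball.
rewrite (_ : ball z r = set0)//; apply/seteqP; split => // y; rewrite ball_rVE.
by move=> /lt_le_trans/(_ r0); rewrite normr_lt0.
Qed.

Lemma lebesgue_rV_ball z r : 0 < r -> mu (ball z r) = ((r *+ 2) ^+ n)%:E.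
Proof.
move=> r0; rewrite ball_rV_box// lebesgue_rV_box; last first.
  by move=> i; exact: measurable_ball.
under eq_bigr do rewrite lebesgue_measure_ball ?ltW//.
by rewrite prodEFin prodr_const card_ord.
Qed.

(** The sigma-algebra is generated by the coordinates, so an open set is written as the countable
    union of the balls of rational centre and radius 1 / (k + 1) that it contains. *)
Lemma measurable_open_rV (U : set 'rV[R]_n) : open U -> measurable U.
Proof.
move=> oU; pose c (k : 'rV[rat]_n * nat) : 'rV[R]_n := map_mx ratr k.1.
pose F k := if `[< ball (c k) (k.2.+1%:R^-1) `<=` U >]
            then ball (c k) (k.2.+1%:R^-1) else set0.
rewrite (_ : U = \bigcup_k F k).
  apply: countable_bigcupT_measurable => [|k]; first exact: countableP.
  by rewrite /F; case: ifP => // _; exact: measurable_ball_rV.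
apply/seteqP; split => [x Ux|x [k _]]; last first.
  by rewrite /F; case: asboolP => // kU; exact: kU.
have /nbhs_ballP[e /= e0 eU] : nbhs x U by exact: open_nbhs_nbhs.
have [N Ne] : exists N : nat, N.+1%:R^-1 < e / 2.
  have [N _ /(_ N (leqnn N))] := near_infty_natSinv_lt (PosNum (divr_gt0 e0 (ltr0n R 2))).
  by exists N.
have N0 : 0 < N.+1%:R^-1 :> R by rewrite invr_gt0.
have ex i : exists q : rat, `|ratr q - x 0 i| < N.+1%:R^-1.
  have [|q qI] := @rat_in_itvoo R (x 0 i - N.+1%:R^-1) (x 0 i + N.+1%:R^-1).
    by rewrite ltrD2l gtrN.
  by exists q; rewrite ltr_distl; move: qI; rewrite in_itv.
pose q : 'rV[rat]_n := \row_i projT1 (cid (ex i)).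
have xq : `|c (q, N) - x| < N.+1%:R^-1.
  by apply: normr_rV_lt => // i; rewrite !mxE; case: cid.
exists (q, N) => //; rewrite /F asboolT ?ball_rVE//= => y; rewrite ball_rVE => yq.
apply: eU; rewrite ball_rVE; apply: (@le_lt_trans _ _ (`|c (q, N) - x| + `|c (q, N) - y|)).
  by rewrite -(distrC x) (le_trans _ (ler_normD _ _))// addrA subrK.
by apply: lt_trans (ltrD xq yq) _; rewrite [ltRHS]splitr ltrD.
Qed.

Lemma lebesgue_rV_open_gt0 (U : set 'rV[R]_n) :
  open U -> U !=set0 -> (0 < mu U)%E.
Proof.
move=> oU [x Ux]; have /nbhs_ballP[e /= e0 eU] : nbhs x U by exact: open_nbhs_nbhs.
apply: (@lt_le_trans _ _ (mu (ball x e))).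
  by rewrite lebesgue_rV_ball// lte_fin exprn_gt0// pmulrn_lgt0.
by apply: le_measure => //; rewrite inE; [exact: measurable_ball_rV|exact: measurable_open_rV].
Qed.

Lemma lebesgue_rV_bounded_lty (A : set 'rV[R]_n) :
  measurable A -> bounded_set A -> (mu A < +oo)%E.
Proof.
move=> mA /ex_strict_bound_gt0[M M0 AM].
apply: (@le_lt_trans _ _ (mu (ball 0 M))).
  apply: le_measure; rewrite ?inE//; first exact: measurable_ball_rV.
  by move=> x /AM /= ; rewrite ball_rVE sub0r normrN.
by rewrite lebesgue_rV_ball// ltry.
Qed.

Lemma open_within_continuous_measurable (A : set 'rV[R]_n) (f : 'rV[R]_n -> R) :
  open A -> {within A, continuous f} -> measurable_fun A f.
Proof.
move=> oA cf; apply: (measurability _ (RGenOpens.measurableE R)).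
move=> _ [_ [a [b ->] <-]].
apply: measurable_open_rV; rewrite openE => x [Ax fx]; apply: filterI.
  exact: open_nbhs_nbhs.
move: cf; rewrite continuous_open_subspace// => /(_ x (mem_set Ax)); apply.
by apply: open_nbhs_nbhs; split => //; exact: interval_open.
Qed.

Lemma continuous_measurable_rV (f : 'rV[R]_n -> R) :
  continuous f -> measurable_fun setT f.
Proof.
move=> cf; apply: open_within_continuous_measurable; first exact: openT.
exact: continuous_subspaceT.
Qed.

End borel_rV.

(** * The corkscrew condition *)

Section bounded_sets.
Context (R : realType) (n : nat) (Omega : set 'rV[R]_n).
Implicit Types (x y z : 'rV[R]_n).

Lemma closure_approx x e : closure Omega x -> 0 < e ->
  exists2 y, Omega y & `|x - y| < e.
Proof.
move=> cx e0; have [y [Oy]] := cx _ (nbhsx_ballx x e e0).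
by rewrite ball_rVE; exists y.
Qed.

Hypothesis Omega_bounded : bounded_set Omega.

Lemma bounded_closure : exists2 M : R, 0 < M & forall x, closure Omega x -> `|x| <= M.
Proof.
have [M M0 OM] := ex_strict_bound_gt0 Omega_bounded; exists M => // x cx.
apply/ler_addgt0Pr => e e0; have [y Oy xy] := closure_approx cx e0.
rewrite -[x](subrK y) addrC (le_trans (ler_normD _ _))// lerD ?(ltW xy)//.
exact/ltW/OM.
Qed.

Lemma compact_closure_bounded : compact (closure Omega).
Proof.
apply: bounded_closed_compact; last exact: closed_closure.
have [M M0 OM] := bounded_closure; exists M; split; first exact: num_real.
by move=> m Mm x cx; apply: le_trans (OM x cx) (ltW Mm).
Qed.

Lemma diam_has_ubound :
  has_ubound [set enorm (x - y) | x in Omega & y in Omega].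
Proof.
have [M M0 OM] := bounded_closure; exists (n%:R * (M + M)) => _ [x Ox [y Oy <-]].
apply: le_trans (enorm_le_norm _) _; rewrite ler_wpM2l//.
by apply: le_trans (ler_normB _ _) _; rewrite lerD ?OM//; exact: subset_closure.
Qed.

Lemma enorm_le_diam x y : closure Omega x -> closure Omega y ->
  enorm (x - y) <= diam Omega.
Proof.
move=> cx cy; apply/ler_addgt0Pr => e e0.
(* The approximation is in the sup norm; the factor n + 1 pays for the passage to the Euclidean norm
   and stays positive when n = 0. *)
have d0 : 0 < e / (2 * (n%:R + 1)).
  by rewrite divr_gt0// mulr_gt0// ltr_wpDl.
have [x' Ox xx'] := closure_approx cx d0.
have [y' Oy yy'] := closure_approx cy d0.
have small a : `|a : 'rV[R]_n| < e / (2 * (n%:R + 1)) -> enorm a <= e / 2.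
  move=> ad; apply: le_trans (enorm_le_norm _) _.
  apply: (@le_trans _ _ ((n%:R + 1) * (e / (2 * (n%:R + 1))))).
    by apply: ler_pM => //; [rewrite lerDl|exact: ltW].
  rewrite [leLHS](_ : _ = e / 2)//; field.
  by rewrite gt_eqF// ltr_wpDl.
have := enorm_triangle (x - x') ((x' - y') + (y' - y)).
have := enorm_triangle (x' - y') (y' - y).
have -> : x - x' + (x' - y' + (y' - y)) = x - y by rewrite !addrA !subrK.
have := small _ xx'; have := small _ yy'; rewrite (enorm_subC y').
have : enorm (x' - y') <= diam Omega.
  by apply: ub_le_sup; [exact: diam_has_ubound|exists x' => //; exists y'].
lra.
Qed.

Hypothesis Omega_nonempty : Omega !=set0.

Lemma diam_attained : exists x y,
  [/\ closure Omega x, closure Omega y & enorm (x - y) = diam Omega].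
Proof.
have [x0 Ox0] := Omega_nonempty.
have cx0 : closure Omega x0 by exact: subset_closure.
have [|||[x y]] := @compact_EVT_max _ R (fun z : 'rV[R]_n * 'rV[R]_n => enorm (z.1 - z.2))
    (closure Omega `*` closure Omega).
- by exists (x0, x0).
- by apply: compact_setX; exact: compact_closure_bounded.
- by apply: continuous_subspaceT => -[a b]; exact: cvg_enormB.
rewrite inE => -[/= cx cy] m; exists x, y; split => //.
apply/eqP; rewrite eq_le enorm_le_diam//=; apply: ge_sup.
  by exists (enorm (x0 - x0)), x0 => //; exists x0.
move=> _ [a Oa [b Ob <-]]; apply: (m (a, b)); rewrite inE; split => /=; exact: subset_closure.
Qed.

Hypothesis n_gt0 : (0 < n)%N.
Hypothesis Omega_open : open Omega.

Lemma diam_gt0 : 0 < diam Omega.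
Proof.
have [x Ox] := Omega_nonempty.
have /nbhs_ballP[e /= e0 eU] : nbhs x Omega by exact: open_nbhs_nbhs.
pose y := x + (e / 2) *: delta_mx 0 (Ordinal n_gt0).
have e2 : 0 < e / 2 by rewrite divr_gt0.
have Oy : Omega y.
  apply: eU; rewrite ball_rVE opprD addNKr normrN.
  apply: normr_rV_lt => // i; rewrite !mxE; case: eqP => _ /=.
    case: eqP => _ /=; rewrite ?mulr1 ?mulr0 ?normr0// gtr0_norm//.
    by rewrite ltr_pdivrMr// ltr_pMr// ltr1n.
  by rewrite mulr0 normr0.
apply: (@lt_le_trans _ _ (enorm (y - x))); last first.
  by apply: enorm_le_diam; exact: subset_closure.
rewrite enorm_gt0 /y addrAC subrr add0r.
apply/eqP => /rowP/(_ (Ordinal n_gt0)); rewrite !mxE !eqxx mulr1 => /eqP.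
by rewrite gt_eqF.
Qed.

End bounded_sets.

Section corkscrew.
Context (R : realType).

(** Every small ball centred in the closure contains a ball of proportional size lying in Omega, all
    in the sup norm. The selections of the Morrey estimate take place in these inner balls, which
    makes it valid up to the boundary without extending functions. *)
Definition corkscrew n (Omega : set 'rV[R]_n) (c r0 : R) :=
  forall x r, closure Omega x -> 0 < r -> r <= r0 ->
  exists z, ball z (c * r) `<=` Omega `&` ball x r.

Lemma smooth_local_lipschitz m (f : 'rV[R]_m -> R) x : smooth f ->
  exists r L, [/\ 0 < r, 0 <= L & forall y z, ball x r y -> ball x r z ->
    `|f z - f y| <= L * `|z - y|].
Proof.
move=> /(_ 1%N)[_ /= df].
pose M := \sum_i `|'D_(delta_mx 0 i) f x| + 1.
have M0 : 0 <= M by rewrite addr_ge0// sumr_ge0.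
have : \forall y \near x, forall i, `|'D_(delta_mx 0 i) f y| <= M.
  apply: (@filter_forall _ _ (fun i y => `|'D_(delta_mx 0 i) f y| <= M) (nbhs x)) => i; have [cD _] := (df i).2.
  near=> y; have : `|'D_(delta_mx 0 i) f x - 'D_(delta_mx 0 i) f y| < 1.
    by near: y; exact: (@cvgr_dist_lt _ R^o _ _ _ _ _ (cD x)).
  have : `|'D_(delta_mx 0 i) f x| <= \sum_i `|'D_(delta_mx 0 i) f x|.
    by rewrite (bigD1 i)//= lerDl sumr_ge0.
  rewrite distrC; have := ler_distD ('D_(delta_mx 0 i) f x) ('D_(delta_mx 0 i) f y) 0.
  rewrite !subr0 /M; lra.
move=> /nbhs_ballP[r /= r0 rP].
exists r, (m%:R * M); split => // [|y z yr zr]; first by rewrite mulr_ge0.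
apply: (@lipschitz_of_partials _ _ f x r) => // i w xw; split; first exact: (df i).1.
exact: rP.
Unshelve. all: by end_near. Qed.

Lemma normr_col'_le n (k : 'I_n) (x y : 'rV[R]_n) :
  `|col' k x - col' k y| <= `|x - y|.
Proof.
apply: normr_rV_le => // i; have := normr_coord_le (x - y) (lift k i).
by rewrite !mxE.
Qed.

(** Moving x by t / 2 along the k-th axis, into the domain, lifts it at least t / 2 above the graph.
    In the ball of radius c t around the new point, height and graph together vary by at most (1 +
    L) c t = t / 4. *)
Lemma graph_corkscrew n (Omega : set 'rV[R]_n) x0 r (k : 'I_n) (b : bool)
    (gamma : 'rV[R]_n.-1 -> R) : 0 < r -> smooth gamma ->
  (forall x, enorm (x - x0) < r ->
     (Omega x <-> gamma (col' k x) < (-1) ^+ b * x 0 k)) ->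
  exists c d, [/\ 0 < c, 0 < d & forall x t, closure Omega x -> `|x - x0| < d ->
    0 < t -> t <= d -> exists z, ball z (c * t) `<=` Omega `&` ball x t].
Proof.
move=> r0 sg H; have [rho [L [rho0 L0 lip]]] := smooth_local_lipschitz (col' k x0) sg.
set sg1 := (-1) ^+ b : R in H *.
have sg2 : sg1 * sg1 = 1 by rewrite /sg1 -signr_addb addbb.
have sgn : `|sg1| = 1 by rewrite normr_sign.
(* Within sup distance D of x0 both the Lipschitz bound for [gamma] and the description of Omega by
   the graph are available. *)
pose D := Num.min rho (r / (n%:R + 1)).
have n1 : 0 < n%:R + 1 :> R by rewrite ltr_wpDl.
have D0 : 0 < D by rewrite lt_min rho0 divr_gt0.
have near_dom y : `|y - x0| < D ->
    ball (col' k x0) rho (col' k y) /\ (Omega y <-> gamma (col' k y) < sg1 * y 0 k).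
  rewrite lt_min => /andP[y1 y2]; split.
    by rewrite ball_rVE; apply: le_lt_trans (normr_col'_le _ _ _) _; rewrite distrC.
  apply: H; apply: le_lt_trans (enorm_le_norm _) _.
  apply: (@le_lt_trans _ _ ((n%:R + 1) * `|y - x0|)); first by rewrite ler_wpM2r// lerDl.
  by rewrite mulrC -ltr_pdivlMr.
have sgy a : sg1 * a <= `|a|.
  by apply: le_trans (ler_norm _) _; rewrite normrM sgn mul1r.
have c1 : 0 < 1 + L by rewrite ltr_wpDr.
(* Points of the closure satisfy the graph inequality in the weak sense: compare with a point of
   Omega so close that height and graph vary by less than e. *)
have graph_le x : closure Omega x -> `|x - x0| < D / 2 -> gamma (col' k x) <= sg1 * x 0 k.
  move=> cx xD; apply/ler_addgt0Pr => e e0.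
  have [|y Oy xy] := @closure_approx _ _ Omega x (Num.min (D / 2) (e / (1 + L))) cx.
    by rewrite lt_min !divr_gt0.
  move: xy; rewrite lt_min => /andP[xy1]; rewrite ltr_pdivlMr// => xy2.
  have yD : `|y - x0| < D.
    have := ler_distD x y x0; rewrite (distrC y x); lra.
  have [yb /iffLR/(_ Oy) yg] := near_dom _ yD.
  have /near_dom[xb _] : `|x - x0| < D by lra.
  have := le_trans (ler_norm _) (lip _ _ yb xb).
  have := ler_wpM2l L0 (normr_col'_le k x y).
  have := sgy (y 0 k - x 0 k).
  have := normr_coordB_le y x k; rewrite (distrC y x) mulrBr.
  move: xy2; rewrite mulrDr mulr1 (mulrC _ L); lra.
pose c := (4 * (1 + L))^-1.
have c0 : 0 < c by rewrite invr_gt0 mulr_gt0.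
have cE : c + L * c = 4^-1 by rewrite /c; field; rewrite gt_eqF.
have Lc0 : 0 <= L * c by rewrite mulr_ge0// ltW.
exists c, (D / 2); split; rewrite ?divr_gt0// => x t cx xD t0 tD.
pose z := x + (sg1 * (t / 2)) *: delta_mx 0 k.
have zx : `|z - x| <= t / 2.
  rewrite /z addrAC subrr add0r; apply: normr_rV_le => [|i]; first by rewrite divr_ge0// ltW.
  rewrite !mxE eqxx/=; case: eqP => _; rewrite ?mulr0 ?normr0 ?divr_ge0 ?(ltW t0)//.
  by rewrite mulr1 normrM sgn mul1r ger0_norm// divr_ge0// ltW.
have zk : z 0 k = x 0 k + sg1 * (t / 2) by rewrite !mxE !eqxx/= mulr1.
have colz : col' k z = col' k x.
  by apply/rowP => i; rewrite !mxE eqxx/= eq_sym (negbTE (neq_lift _ _)) mulr0 addr0.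
have ct : c * t <= t / 4 by rewrite mulrC ler_wpM2l ?(ltW t0)//; lra.
have Lct : L * (c * t) = t / 4 - c * t.
  by rewrite mulrA (_ : L * c = 4^-1 - c) ?mulrBl ?[_^-1 * _]mulrC//; lra.
exists z => y; rewrite ball_rVE => zy.
have yx : `|x - y| < t.
  have := ler_distD z x y; rewrite (distrC x z); lra.
split; last by rewrite ball_rVE.
have yD : `|y - x0| < D.
  have := ler_distD x y x0; rewrite (distrC y x); lra.
have [yb /iffRL] := near_dom _ yD; apply.
have /near_dom[xb _] : `|x - x0| < D by lra.
have := graph_le x cx xD.
have := le_trans (ler_norm _) (lip _ _ xb yb); rewrite -colz.
have := ler_wpM2l L0 (le_trans (normr_col'_le k y z) (ltW (_ : _ < c * t))).
rewrite distrC => /(_ zy); rewrite Lct.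
have := sgy (z 0 k - y 0 k).
have := normr_coordB_le z y k.
by rewrite zk mulrBr mulrDr [sg1 * (sg1 * _)]mulrA sg2 mul1r; lra.
Qed.

(** Compactness of the closure makes the local constants uniform, for small radii. Radii up to r0
    are reached by first shrinking them by the factor k, at the price of a smaller corkscrew
    constant. *)
Lemma smooth_domain_corkscrew n (Omega : set 'rV[R]_n) r0 :
  smooth_bounded_domain Omega -> 0 < r0 ->
  exists2 c, 0 < c & corkscrew Omega c r0.
Proof.
move=> [_ oO _ bO sb] r0_gt0.
have cov := (compact_near_coveringP _).1 (compact_closure_bounded bO).
pose P (c : R) x := forall t, closure Omega x -> 0 < t -> t <= c ->
  exists z, ball z (c * t) `<=` Omega `&` ball x t.
have : \forall c \near 0^'+, closure Omega `<=` P c.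
  apply: cov => x cx.
  suff [c [d [c0 d0 cd]]] : exists c d, [/\ 0 < c, 0 < d & forall y t,
      closure Omega y -> `|y - x| < d -> 0 < t -> t <= d ->
      exists z, ball z (c * t) `<=` Omega `&` ball y t].
    near=> y c' => t cy t0 tc.
    have c'c : c' <= c by near: c'; apply: nbhs_right_le.
    have c'd : c' <= d by near: c'; apply: nbhs_right_le.
    have [|z zP] := cd y t cy _ t0 (le_trans tc c'd).
      by rewrite distrC -ball_rVE; near: y; exact: nbhsx_ballx.
    by exists z; apply: subset_trans zP; apply: le_ball; rewrite ler_wpM2r// ltW.
  have [Ox|nOx] := pselect (Omega x); last first.
    have [r [k [b [gamma [r_gt0 sg H]]]]] := sb x (conj cx nOx).
    exact: (graph_corkscrew r_gt0 sg H).
  have /nbhs_ballP[e /= e0 eU] : nbhs x Omega by exact: open_nbhs_nbhs.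
  exists 1, (e / 2); split; rewrite ?divr_gt0// => y t _ yx t0 te; exists y.
  rewrite mul1r => z yz; split => //; apply: eU; rewrite ball_rVE.
  move: yz; rewrite ball_rVE => yz; have := ler_distD y x z; rewrite (distrC x y); lra.
move=> H; have [c c0 Pc] : exists2 c : R, 0 < c & closure Omega `<=` P c.
  near (0 : R)^'+ => c; exists c => //; near: c => //.
pose k := Num.min 1 (c / r0).
have k0 : 0 < k by rewrite lt_min ltr01 divr_gt0.
exists (c * k); first by rewrite mulr_gt0.
move=> x r cx r_gt0 rr0.
have [||z zP] := Pc x cx (k * r) cx.
- by rewrite mulr_gt0.
- apply: (@le_trans _ _ (c / r0 * r)); first by rewrite ler_wpM2r ?(ltW r_gt0)// ge_min lexx orbT.
  by rewrite mulrAC ler_pdivrMr// ler_wpM2l// ltW.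
exists z; rewrite -mulrA; apply: subset_trans zP _; apply: setIS; apply: le_ball.
by rewrite -[leRHS]mul1r ler_wpM2r ?(ltW r_gt0)// ge_min lexx.
Unshelve. all: by end_near. Qed.

End corkscrew.

(** * Energies as iterated integrals *)

Section pigeonhole.
Context d (T : measurableType d) (R : realType) (mu : {measure set T -> \bar R}).
Local Open Scope ereal_scope.

(** If at every point of B some [h_i] exceeded [4 * q_i / v], the sum of the [h_i / q_i] would be at
    least 4 / v on B and its integral at least 4, whereas that integral is at most 3. *)
Lemma ge0_integral_pigeonhole3 (B : set T) (v q1 q2 q3 : R) (h1 h2 h3 : T -> \bar R) :
  measurable B -> (0 < v)%R -> mu B = v%:E ->
  measurable_fun B h1 -> measurable_fun B h2 -> measurable_fun B h3 ->
  (forall x, 0 <= h1 x) -> (forall x, 0 <= h2 x) -> (forall x, 0 <= h3 x) ->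
  (0 < q1)%R -> (0 < q2)%R -> (0 < q3)%R ->
  \int[mu]_(x in B) h1 x <= q1%:E -> \int[mu]_(x in B) h2 x <= q2%:E ->
  \int[mu]_(x in B) h3 x <= q3%:E ->
  exists a, [/\ B a, h1 a <= (4 * q1 / v)%:E, h2 a <= (4 * q2 / v)%:E &
    h3 a <= (4 * q3 / v)%:E].
Proof.
move=> mB v0 Bv m1 m2 m3 h10 h20 h30 q10 q20 q30 i1 i2 i3.
apply: contrapT => no.
have big a : B a -> (4 / v)%:E <=
    (q1^-1)%:E * h1 a + (q2^-1)%:E * h2 a + (q3^-1)%:E * h3 a.
  have sc q (h : \bar R) : (0 < q)%R -> (4 * q / v)%:E < h ->
      (4 / v)%:E <= (q^-1)%:E * h.
    move=> q0 /ltW hq; rewrite (_ : 4 / v = q^-1 * (4 * q / v))%R; last first.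
      by field; rewrite !gt_eqF.
    by rewrite EFinM lee_pmul2l// lte_fin invr_gt0.
  have nn q (h : \bar R) : (0 < q)%R -> 0 <= h -> 0 <= (q^-1)%:E * h.
    by move=> q0 h0; rewrite mule_ge0// lee_fin invr_ge0 ltW.
  move=> Ba; have [l1|l1] := leP (h1 a) (4 * q1 / v)%:E; last first.
    rewrite -addeA (le_trans (sc _ _ q10 l1))// leeDl//.
    by rewrite adde_ge0 ?nn.
  have [l2|l2] := leP (h2 a) (4 * q2 / v)%:E; last first.
    rewrite -addeA addeCA (le_trans (sc _ _ q20 l2))// leeDl//.
    by rewrite adde_ge0 ?nn.
  have [l3|l3] := leP (h3 a) (4 * q3 / v)%:E; last first.
    by rewrite (le_trans (sc _ _ q30 l3))// leeDr// adde_ge0 ?nn.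
  by exfalso; apply: no; exists a.
have mq q (h : T -> \bar R) : measurable_fun B h -> measurable_fun B (fun x => (q^-1)%:E * h x).
  by move=> mh; exact: measurable_funeM.
have nn q (h : T -> \bar R) x : (0 < q)%R -> (forall x, 0 <= h x) -> 0 <= (q^-1)%:E * h x.
  by move=> q0 h0; rewrite mule_ge0// lee_fin invr_ge0 ltW.
have : \int[mu]_(x in B) (4 / v)%:E <= \int[mu]_(x in B)
    ((q1^-1)%:E * h1 x + (q2^-1)%:E * h2 x + (q3^-1)%:E * h3 x).
  apply: ge0_le_integral => //.
  - by move=> x _; rewrite lee_fin divr_ge0// ltW.
  - by apply: emeasurable_funD; [apply: emeasurable_funD|]; exact: mq.
have iq q (h : T -> \bar R) : (0 < q)%R -> measurable_fun B h -> (forall x, 0 <= h x) ->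
    \int[mu]_(x in B) h x <= q%:E -> \int[mu]_(x in B) ((q^-1)%:E * h x) <= 1.
  move=> q0 mh h0 hq; rewrite ge0_integralZl//; last by rewrite lee_fin invr_ge0 ltW.
  apply: (@le_trans _ _ ((q^-1)%:E * q%:E)).
    by rewrite lee_pmul2l// lte_fin invr_gt0.
  by rewrite -EFinM mulVf// gt_eqF.
rewrite integral_cst// Bv -EFinM divfK ?gt_eqF// ge0_integralD//; last 4 first.
- by move=> x _; rewrite adde_ge0// nn.
- by apply: emeasurable_funD; exact: mq.
- by move=> x _; rewrite nn.
- exact: mq.
rewrite ge0_integralD//; last 4 first.
- by move=> x _; rewrite nn.
- exact: mq.
- by move=> x _; rewrite nn.
- exact: mq.
have := leeD (leeD (iq _ _ q10 m1 h10 i1) (iq _ _ q20 m2 h20 i2)) (iq _ _ q30 m3 h30 i3).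
move=> /[swap] /le_trans /[apply]; rewrite -!EFinD lee_fin.
lra.
Qed.

End pigeonhole.

Section energy.
Context (R : realType) (n : nat).
Implicit Types (Omega : set 'rV[R]_n) (s p : R) (u v : 'rV[R]_n -> R).

Local Notation T := 'rV[R]_n.
Local Notation mu := (@lebesgue_rV R n).

Definition dquot s p u (z : T * T) : R :=
  `|u z.1 - u z.2| `^ p / enorm (z.1 - z.2) `^ (n%:R + s * p).

Lemma dquot_ge0 s p u z : 0 <= dquot s p u z.
Proof. by rewrite /dquot divr_ge0 ?powR_ge0. Qed.

Lemma measurable_powR_comp d (S : measurableType d) (f : S -> R) (q : R) :
  measurable_fun setT f -> measurable_fun setT (fun x => f x `^ q).
Proof. by move=> mf; apply: (measurableT_comp (measurable_powR q)). Qed.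

Lemma measurable_enormB : measurable_fun setT (fun z : T * T => enorm (z.1 - z.2)).
Proof.
apply: (@measurableT_comp _ _ _ _ _ _ (@enorm R n) _ (fun z : T * T => z.1 - z.2)).
  by apply: continuous_measurable_rV; exact: continuous_enorm.
apply: measurable_fun_rV => i.
rewrite (_ : (fun _ => _) = (fun z : T * T => z.1 0 i - z.2 0 i)); last first.
  by apply/funext => z; rewrite !mxE.
apply: measurable_funB.
- by apply: (measurableT_comp (measurable_coord_rV i)); exact: measurable_fst.
- by apply: (measurableT_comp (measurable_coord_rV i)); exact: measurable_snd.
Qed.

Lemma measurable_kernel q : measurable_fun setT (fun z : T * T => (enorm (z.1 - z.2) `^ q)^-1).
Proof.
under eq_fun do rewrite -powRN.
by apply: measurable_powR_comp; exact: measurable_enormB.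
Qed.

Lemma measurable_dquot s p u : measurable_fun setT u -> measurable_fun setT (dquot s p u).
Proof.
move=> mu_; apply: measurable_funM; last exact: measurable_kernel.
apply: measurable_powR_comp; apply: measurableT_comp => //.
apply: measurable_funB.
- by apply: measurableT_comp => //; exact: measurable_fst.
- by apply: measurableT_comp => //; exact: measurable_snd.
Qed.

Local Open Scope ereal_scope.

Lemma gagliardo_powE Omega s p u : p != 0%R -> gagliardo Omega s p u `^ p =
  \int[mu]_(x in Omega) \int[mu]_(y in Omega) (dquot s p u (x, y))%:E.
Proof.
move=> p0; rewrite /gagliardo -poweRrM mulVf// poweRe1// integral_ge0// => x _.
by apply: integral_ge0 => y _; rewrite lee_fin divr_ge0 ?powR_ge0.
Qed.

Lemma Lp_norm_powE Omega p u : p != 0%R ->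
  Lp_norm Omega p%:E u `^ p = \int[mu]_(x in Omega) (`|u x| `^ p)%:E.
Proof.
move=> p0; rewrite /Lp_norm poweR_Lnorm// [RHS]integral_mkcond.
apply: eq_integral => x _; rewrite !patchE; case: ifP => //= _.
by rewrite normr0 powR0.
Qed.

Lemma mean_pE Omega p u : mean_p Omega p u = \int[mu]_(x in Omega) (spow p (u x))%:E.
Proof. by []. Qed.

Section eq_on.
Variables (Omega : set T) (u v : T -> R).
Hypothesis uv : forall x, Omega x -> u x = v x.

Lemma eq_gagliardo s p : gagliardo Omega s p u = gagliardo Omega s p v.
Proof.
rewrite /gagliardo.
apply: (f_equal (fun t : \bar R => poweR t (GRing.inv p))).

apply: eq_integral => x.
move=> /set_mem Ox.
by apply: eq_integral => y /set_mem Oy; rewrite !uv.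
Qed.

Lemma eq_Lp_norm (p : \bar R) : Lp_norm Omega p u = Lp_norm Omega p v.
Proof.
by apply: eq_Lnorm => x; rewrite !patchE; case: ifP => //= /set_mem Ox; rewrite uv.
Qed.

Lemma eq_mean_p p : mean_p Omega p u = mean_p Omega p v.
Proof. by apply: eq_integral => x /set_mem Ox; rewrite uv. Qed.

End eq_on.

Section product.
Variables (Omega : set T) (mO : measurable Omega).
Local Notation mu2 := (mu \x mu).

Lemma iterated_integralE (F : T * T -> R) :
  measurable_fun setT F -> (forall z, (0 <= F z)%R) ->
  \int[mu]_(x in Omega) \int[mu]_(y in Omega) (F (x, y))%:E =
  \int[mu2]_(z in Omega `*` Omega) (F z)%:E.
Proof.
move=> mF F0; rewrite [RHS]integral_mkcond fubini_tonelli1; last 2 first.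
- apply/(measurable_restrictT _ (measurableX mO mO)).
  by apply: measurable_funTS; apply/measurable_EFinP.
- by move=> z; rewrite patchE; case: ifP => // _; rewrite lee_fin.
rewrite [LHS]integral_mkcond; apply: eq_integral => x _.
rewrite /fubini_F patchE; case: ifPn => [Ox|nOx].
  rewrite [LHS]integral_mkcond; apply: eq_integral => y _.
  by rewrite !patchE in_setX/= Ox.
by rewrite integral0_eq// => y _; rewrite patchE in_setX/= (negbTE nOx).
Qed.

Lemma measurable_inner_integral (F : T * T -> R) :
  measurable_fun setT F -> (forall z, (0 <= F z)%R) ->
  measurable_fun setT (fun x => \int[mu]_(y in Omega) (F (x, y))%:E).
Proof.
move=> mF F0.
pose G (z : T * T) : \bar R := ((EFin \o F) \_ (setT `*` Omega)) z.
have := @measurable_fun_fubini_tonelli_F _ _ _ _ R mu G.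
have -> : fubini_F mu G = (fun x => \int[mu]_(y in Omega) (F (x, y))%:E).
  apply/funext => x; rewrite /fubini_F [RHS]integral_mkcond.
  by apply: eq_integral => y _; rewrite /G !patchE in_setX/= in_setT.
apply.
- apply/(measurable_restrictT _ (measurableX measurableT mO)).
  by apply: measurable_funTS; apply/measurable_EFinP.
- by move=> z; rewrite /G patchE; case: ifP => // _; rewrite lee_fin.
Qed.

Lemma measurable_section (F : T * T -> R) x : measurable_fun setT F ->
  measurable_fun setT (fun y => F (x, y)).
Proof. by move=> mF; exact: (measurableT_comp mF (pair1_measurable x)). Qed.

Lemma iterated_integral_ge_rect (F : T * T -> R) (A B : set T) c :
  measurable_fun setT F -> (forall z, (0 <= F z)%R) -> (0 <= c)%R ->
  measurable A -> measurable B -> A `<=` Omega -> B `<=` Omega ->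
  (forall x y, A x -> B y -> (c <= F (x, y))%R) ->
  c%:E * (mu A * mu B) <=
  \int[mu]_(x in Omega) \int[mu]_(y in Omega) (F (x, y))%:E.
Proof.
move=> mF F0 c0 mA mB AO BO cF; rewrite iterated_integralE//.
rewrite -product_measure1E// -integral_cst; last exact: measurableX.
have mE : measurable_fun setT (EFin \o F) by apply/measurable_EFinP.
apply: (@le_trans _ _ (\int[mu2]_(z in A `*` B) (F z)%:E)).
  apply: ge0_le_integral => //; first exact: measurableX.
  - exact: measurable_funTS.
  - by move=> [x y] [/= Ax By]; rewrite lee_fin cF.
apply: ge0_subset_integral => //.
- exact: measurableX.
- exact: measurableX.
- exact: measurable_funTS.
- by move=> z _; rewrite lee_fin.
- by move=> [x y] [/= Ax By]; split => /=; [exact: AO|exact: BO].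
Qed.

End product.

Lemma integral_ge_sub (Omega A : set T) (f : T -> R) c :
  measurable Omega -> measurable A -> A `<=` Omega -> measurable_fun Omega f ->
  (forall x, Omega x -> (0 <= f x)%R) -> (0 <= c)%R ->
  (forall x, A x -> (c <= f x)%R) ->
  c%:E * mu A <= \int[mu]_(x in Omega) (f x)%:E.
Proof.
move=> mO mA AO mf f0 c0 cf; rewrite -integral_cst//.
have mE : measurable_fun Omega (EFin \o f) by apply/measurable_EFinP.
apply: (@le_trans _ _ (\int[mu]_(x in A) (f x)%:E)).
  by apply: ge0_le_integral => //; exact: measurable_funS mE.
apply: ge0_subset_integral => //.
Qed.

Lemma integral_le_cst (Omega : set T) (f : T -> R) c :
  measurable Omega -> measurable_fun Omega f ->
  (forall x, Omega x -> (0 <= f x)%R) ->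
  (forall x, Omega x -> (f x <= c)%R) ->
  \int[mu]_(x in Omega) (f x)%:E <= c%:E * mu Omega.
Proof.
move=> mO mf f0 fc; rewrite -integral_cst//.
by apply: ge0_le_integral => //; apply/measurable_EFinP.
Qed.

End energy.

(** * Morrey estimate *)

Section sequences.
Context (R : realType).

Lemma ler_dist_chain (W : normedZmodType R) (a b x y : W) :
  `|b - a| <= `|y - b| + `|x - y| + `|x - a|.
Proof.
apply: le_trans (ler_distD y _ _) _; rewrite -addrA (distrC b y) lerD2l (distrC x y).
exact: ler_distD.
Qed.

Lemma thrice_le_mul4 (r : R) : 0 < r -> r + r + r <= 4 * r.
Proof. lra. Qed.

Lemma powR_le_cancel (a b p : R) : 0 < p -> 0 <= b -> a `^ p <= b `^ p -> a <= b.
Proof.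
move=> p0 b0; apply: contraTT; rewrite -!ltNge => ba.
by apply: gt0_ltr_powR; rewrite ?nnegrE// (le_trans b0)// ltW.
Qed.

Lemma geometric_small (K q e : R) : 0 <= q -> q < 1 -> 0 < e ->
  exists k, K * q ^+ k < e.
Proof.
move=> q0 q1 e0; have : (fun k => K * q ^+ k) @ \oo --> K * 0.
  by apply: cvgMr; apply: cvg_expr; rewrite ger0_norm.
rewrite mulr0 => /cvgrPdist_lt/(_ e e0)[k _ /(_ k (leqnn k))] /=.
rewrite sub0r normrN => h; exists k; apply: le_lt_trans h; exact: ler_norm.
Qed.

(** The hypothesis with K and q' only ensures that [e k] tends to l; neither number enters the
    bound. This matters because in the Morrey estimate K depends on the point and on p. *)
Lemma geometric_telescope (e : nat -> R) (l K A q q' : R) :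
  0 <= q -> q < 1 -> 0 <= q' -> q' < 1 ->
  (forall k, `|e k - e k.+1| <= A * q ^+ k) ->
  (forall k, `|l - e k| <= K * q' ^+ k) ->
  `|l - e 0%N| <= A / (1 - q).
Proof.
move=> q0 q1 q'0 q'1 step lim.
have A0 : 0 <= A by have := step 0%N; rewrite expr0 mulr1; exact: le_trans.
have sum N : `|e 0%N - e N| <= A * (1 - q ^+ N) / (1 - q).
  elim: N => [|N IH]; first by rewrite subrr normr0 expr0 subrr mulr0 mul0r.
  apply: le_trans (ler_distD (e N) _ _) _; apply: le_trans (lerD IH (step N)) _.
  rewrite [leLHS](_ : _ = A * (1 - q ^+ N.+1) / (1 - q))// exprS; field.
  by rewrite gt_eqF// subr_gt0.
apply/ler_addgt0Pr => d d0; have [k kd] := geometric_small K q'0 q'1 d0.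
apply: le_trans (ler_distD (e k) _ _) _; rewrite addrC lerD//; last first.
  exact/(le_trans (lim k))/ltW.
rewrite distrC (le_trans (sum k))// ler_pM2r ?invr_gt0 ?subr_gt0//.
by rewrite ler_piMr// gerBl exprn_ge0.
Qed.

End sequences.

Section morrey.
Context (R : realType) (n : nat) (Omega : set 'rV[R]_n).
Local Notation mu := (@lebesgue_rV R n).
Hypotheses (mO : measurable Omega).
Variables (c r0 s : R).
Hypotheses (c0 : 0 < c) (r0_ge1 : 1 <= r0) (cs : corkscrew Omega c r0).
Hypotheses (s0 : 0 < s).

(** Factor by factor: 16 comes from two pigeonhole selections; n times 4 from |a - b| <= 4 rho and
    the passage to the Euclidean norm; the denominator from the volumes of inner balls of radii c
    rho and c rho / 2, each divided by rho^n; the + 1 allows K <= (K + 1)^p; the power of r0 absorbs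
    the surplus power of rho. *)
Definition morrey_const : R :=
  (16 * (n%:R * 4) ^+ n / ((c *+ 2) ^+ n * c ^+ n) + 1) * (n%:R * 4) `^ s * r0 `^ (s / 2).

Let C := morrey_const.

Lemma morrey_const_ge0 : 0 <= C.
Proof.
rewrite /C/morrey_const mulr_ge0 ?powR_ge0// mulr_ge0 ?powR_ge0// addr_ge0//.
by rewrite divr_ge0 ?mulr_ge0 ?exprn_ge0 ?mulr_ge0 ?mulrn_wge0 ?(ltW c0).
Qed.

Variables (p M : R) (u : 'rV[R]_n -> R).
Hypotheses (p1 : 1 < p) (pn : n%:R <= s / 2 * p) (M0 : 0 < M).
Hypotheses (mu_ : measurable_fun setT u).

Let p0 : 0 < p. Proof. exact: lt_trans p1. Qed.

Let vol r : R := (c * r *+ 2) ^+ n.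

Let vol_gt0 r : 0 < r -> 0 < vol r.
Proof. by move=> r_gt0; rewrite exprn_gt0// pmulrn_lgt0// mulr_gt0. Qed.

Let inner x := (\int[mu]_(y in Omega) (dquot s p u (x, y))%:E)%E.

Hypothesis energy_le : (\int[mu]_(x in Omega) inner x <= (M `^ p)%:E)%E.

Lemma dquot_increment a b Q rho : 0 <= Q -> 0 <= rho -> dquot s p u (a, b) <= Q ->
  `|a - b| <= rho -> `|u a - u b| `^ p <= Q * (n%:R * rho) `^ (n%:R + s * p).
Proof.
move=> Q0 rho0; rewrite /dquot/= => dQ ab.
have [->|anb] := eqVneq a b.
  by rewrite subrr normr0 powR0 ?gt_eqF// mulr_ge0// powR_ge0.
have e0 : 0 < enorm (a - b) by rewrite enorm_gt0 subr_eq0.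
move: dQ; rewrite ler_pdivrMr ?powR_gt0// => /le_trans; apply.
rewrite ler_wpM2l//; apply: ge0_ler_powR.
- by rewrite addr_ge0// mulr_ge0 ?ltW.
- by rewrite nnegrE ltW.
- by rewrite nnegrE mulr_ge0.
- by apply: le_trans (enorm_le_norm _) _; rewrite ler_wpM2l.
Qed.

(** Up to fixed p-th powers the hypothesis says |u a - u b|^p <= K M^p rho^(s p - n). Of the two
    equal factors of rho^(s p), one yields the modulus rho^(s/2) and the other outweighs rho^n
    because n <= s p / 2. *)
Lemma morrey_increment a b rho : 0 < rho -> rho <= r0 -> `|a - b| <= 4 * rho ->
  dquot s p u (a, b) <= 16 * M `^ p / (vol rho * vol (rho / 2)) ->
  `|u a - u b| <= C * M * rho `^ (s / 2).
Proof.
move=> rho0 rhor ab dab.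
have r0_gt0 : 0 < r0 by rewrite (lt_le_trans _ r0_ge1).
have Mp : 0 < M `^ p by exact: powR_gt0.
have rr4 : 0 <= 4 * rho by rewrite mulr_ge0// ltW.
have r2 : 0 < rho / 2 by rewrite divr_gt0.
have Q0 : 0 <= 16 * M `^ p / (vol rho * vol (rho / 2)).
  by rewrite divr_ge0 ?mulr_ge0 ?(ltW (vol_gt0 _)) ?(ltW Mp).
apply: (@powR_le_cancel _ _ _ p) => //.
  by rewrite mulr_ge0 ?powR_ge0// mulr_ge0 ?morrey_const_ge0 ?ltW.
apply: le_trans (dquot_increment Q0 rr4 dab ab) _.
set K := 16 * (n%:R * 4) ^+ n / ((c *+ 2) ^+ n * c ^+ n) : R.
have K0 : 0 <= K.
  by rewrite divr_ge0 ?mulr_ge0 ?exprn_ge0 ?mulr_ge0 ?mulrn_wge0 ?(ltW c0).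
have n4 : 0 <= n%:R * 4 :> R by rewrite mulr_ge0.
have E1 : (n%:R * (4 * rho)) `^ (n%:R + s * p) =
    ((n%:R * 4) ^+ n * rho ^+ n) * ((n%:R * 4) `^ s * rho `^ (s / 2) * rho `^ (s / 2)) `^ p.
  have sp0 : n%:R + s * p != 0 by rewrite gt_eqF// ltr_wpDl// mulr_gt0.
  rewrite mulrA powRD ?(negbTE sp0)// powR_mulrn ?mulr_ge0 ?(ltW rho0)// exprMn.
  congr (_ * _); rewrite powRrM; congr (_ `^ _).
  rewrite (powRM s n4 (ltW rho0)) -[RHS]mulrA; congr (_ * _).
  rewrite -powRD; last by apply/implyP => _; rewrite gt_eqF.
  by rewrite -splitr.
rewrite E1.
have c2 : (c *+ 2) ^+ n != 0 by rewrite gt_eqF// exprn_gt0// pmulrn_lgt0.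
have cn : c ^+ n != 0 by rewrite gt_eqF// exprn_gt0.
have rn : rho ^+ n != 0 by rewrite gt_eqF// exprn_gt0.
have V1 : vol rho = (c *+ 2) ^+ n * rho ^+ n by rewrite /vol -exprMn mulrnAl.
have V2 : vol (rho / 2) = c ^+ n * rho ^+ n.
  by rewrite /vol -exprMn; congr (_ ^+ _); field.
set X := (n%:R * 4) `^ s * rho `^ (s / 2).
have X0 : 0 <= X by rewrite mulr_ge0 ?powR_ge0.
rewrite (powRM _ X0 (powR_ge0 _ _)) V1 V2.
have -> : 16 * M `^ p / ((c *+ 2) ^+ n * rho ^+ n * (c ^+ n * rho ^+ n)) *
  ((n%:R * 4) ^+ n * rho ^+ n * (X `^ p * (rho `^ (s / 2)) `^ p)) =
  M `^ p * K * X `^ p * ((rho `^ (s / 2)) `^ p / rho ^+ n).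
  by rewrite /K; field; rewrite c2 cn rn.
(* With t = rho / r0 <= 1, the power t^(s p / 2) is at most t^n, and the factor [r0 ^+ n] on the
   right is at least 1. *)
have scale : (rho `^ (s / 2)) `^ p / rho ^+ n <= (r0 `^ (s / 2)) `^ p.
  rewrite ler_pdivrMr ?exprn_gt0// -!powRrM.
  have -> : rho = r0 * (rho / r0) by rewrite mulrCA divff ?mulr1// gt_eqF.
  have q0 : 0 <= rho / r0 by rewrite divr_ge0 ?ltW.
  rewrite powRM ?(ltW r0_gt0)// exprMn ler_wpM2l ?powR_ge0//.
  rewrite -(powR_mulrn n q0); apply: (@le_trans _ _ ((rho / r0) `^ n%:R)).
    apply: ger_powR => //; rewrite divr_gt0//= ler_pdivrMr// mul1r//.
  by rewrite ler_peMl ?powR_ge0// exprn_ege1.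
apply: (@le_trans _ _ (M `^ p * K * X `^ p * (r0 `^ (s / 2)) `^ p)).
  by rewrite ler_wpM2l// mulr_ge0 ?powR_ge0// mulr_ge0 ?(ltW Mp).
have -> : C * M * rho `^ (s / 2) = M * (K + 1) * X * r0 `^ (s / 2).
  by rewrite /C/morrey_const -/K /X; ring.
have K1 : 0 <= K + 1 by rewrite addr_ge0.
have A1 : 0 <= M * (K + 1) by rewrite mulr_ge0 ?(ltW M0).
have A2 : 0 <= M * (K + 1) * X by rewrite mulr_ge0.
rewrite (powRM p A2 (powR_ge0 _ _)) (powRM p A1 X0) (powRM p (ltW M0) K1).
rewrite !ler_wpM2r ?powR_ge0// ler_wpM2l ?(ltW Mp)//.
apply: (@le_trans _ _ (K + 1)); first by rewrite lerDl.
by apply: le1r_powR; rewrite ?(ltW p1)// lerDr.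
Qed.

Let measurable_inner : measurable_fun setT inner.
Proof.
by apply: measurable_inner_integral => //; [exact: measurable_dquot|move=> z; exact: dquot_ge0].
Qed.

Let inner_ge0 x : (0 <= inner x)%E.
Proof. by apply: integral_ge0 => y _; rewrite lee_fin dquot_ge0. Qed.

(** One point b has to serve three purposes: its own energy density is bounded, so that the
    selection can be repeated from b, and so are its quotients with the previous point a and with
    the limit point x. *)
Lemma morrey_select x a gx qa r : closure Omega x -> 0 < r -> r <= r0 ->
  0 < gx -> 0 < qa -> (inner x <= gx%:E)%E -> (inner a <= qa%:E)%E ->
  exists b, [/\ Omega b, `|x - b| < r, (inner b <= (4 * M `^ p / vol r)%:E)%E,
    dquot s p u (a, b) <= 4 * qa / vol r & dquot s p u (x, b) <= 4 * gx / vol r].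
Proof.
move=> cx r_gt0 rr gx0 qa0 ix ia; have [z zP] := cs cx r_gt0 rr.
have zO : ball z (c * r) `<=` Omega by move=> y /zP[].
have mB := measurable_ball_rV z (c * r).
have cr : 0 < c * r by rewrite mulr_gt0.
have md b : measurable_fun setT (fun y => (dquot s p u (b, y))%:E).
  by apply/measurable_EFinP; apply: measurable_section; exact: measurable_dquot.
have sub (h : 'rV[R]_n -> \bar R) : measurable_fun setT h -> (forall y, 0 <= h y)%E ->
    (\int[mu]_(y in ball z (c * r)) h y <= \int[mu]_(y in Omega) h y)%E.
  move=> mh h0; apply: ge0_subset_integral => //; exact: measurable_funTS.
have [|||||||||b [zb h1 h2 h3]] := @ge0_integral_pigeonhole3 _ _ R mu (ball z (c * r)) (vol r)
   (M `^ p) qa gx inner (fun y => (dquot s p u (a, y))%:E) (fun y => (dquot s p u (x, y))%:E)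
   mB (vol_gt0 r_gt0) _ _ _ _ inner_ge0 _ _ (powR_gt0 p M0) qa0 gx0.
- exact: lebesgue_rV_ball.
- exact: measurable_funTS.
- exact: measurable_funTS.
- exact: measurable_funTS.
- by move=> y; rewrite lee_fin dquot_ge0.
- by move=> y; rewrite lee_fin dquot_ge0.
- exact: le_trans (sub _ measurable_inner inner_ge0) energy_le.
- by apply: le_trans (sub _ (md a) _) ia => y; rewrite lee_fin dquot_ge0.
- by apply: le_trans (sub _ (md x) _) ix => y; rewrite lee_fin dquot_ge0.
by exists b; have [Ob +] := zP _ zb; rewrite ball_rVE.
Qed.

(* Telescoping along points a_k at distance r 2^-k of x, chosen so that both
   the energy density of a_k and the quotients at (x, a_k), (a_k, a_k+1) are
   at most a fixed multiple of their averages. *)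
Lemma morrey_chain x a gx r : closure Omega x -> 0 < r -> r <= r0 ->
  0 < gx -> (inner x <= gx%:E)%E -> Omega a -> `|x - a| < r ->
  (inner a <= (4 * M `^ p / vol r)%:E)%E -> dquot s p u (x, a) <= 4 * gx / vol r ->
  `|u x - u a| <= C * M * r `^ (s / 2) / (1 - 2^-1 `^ (s / 2)).
Proof.
move=> cx r_gt0 rr gx0 ix Oa xa ia dxa.
pose rk k := r * (2^-1) ^+ k.
have rk0 k : 0 < rk k by rewrite mulr_gt0// exprn_gt0.
have rkS k : rk k.+1 = rk k / 2 by rewrite /rk exprSr mulrA.
have rkr k : rk k <= r.
  by rewrite ler_piMr ?(ltW r_gt0)// exprn_ile1 ?invr_ge0// invf_le1// ler1n.
have rkr0 k : rk k <= r0 by exact: le_trans rr.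
pose good k b := [/\ Omega b, `|x - b| < rk k, (inner b <= (4 * M `^ p / vol (rk k))%:E)%E
  & dquot s p u (x, b) <= 4 * gx / vol (rk k)].
pose rel k b b' := dquot s p u (b, b') <= 4 * (4 * M `^ p / vol (rk k)) / vol (rk k.+1).
(* Dependent choice asks for a successor of every pair, so the requirement is imposed on good pairs
   only; the index travels with the point. *)
have next (kb : nat * 'rV[R]_n) : exists kb' : nat * 'rV[R]_n,
    good kb.1 kb.2 -> [/\ kb'.1 = kb.1.+1, good kb'.1 kb'.2 & rel kb.1 kb.2 kb'.2].
  have [g|ng] := pselect (good kb.1 kb.2); last by exists kb.
  have [Ob xb ib db] := g.
  have q0 : 0 < 4 * M `^ p / vol (rk kb.1) by rewrite divr_gt0 ?vol_gt0 ?mulr_gt0 ?powR_gt0.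
  have [b' [Ob' xb' ib' bb' xdb']] :=
    morrey_select cx (rk0 kb.1.+1) (rkr0 _) gx0 q0 ix ib.
  by exists (kb.1.+1, b') => _.
have [F [F0 FS]] := @dependent_choice _ (fun kb kb' : nat * 'rV[R]_n =>
  good kb.1 kb.2 -> [/\ kb'.1 = kb.1.+1, good kb'.1 kb'.2 & rel kb.1 kb.2 kb'.2])
  (fun kb => cid (next kb)) (0%N, a).
have g0 : good 0%N a by rewrite /good /rk expr0 mulr1.
have FG k : (F k).1 = k /\ good (F k).1 (F k).2.
  elim: k => [|k [E G]]; first by rewrite F0.
  by have [E' G' _] := FS k G; rewrite E' E; split => //; rewrite -{1}E -E'.
have Frel k : rel k (F k).2 (F k.+1).2.
  by have [E G] := FG k; have [_ _] := FS k G; rewrite E.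
have Fgood k : good k (F k).2 by have [E] := FG k; rewrite E.
pose q := 2^-1 `^ (s / 2) : R.
have s2 : 0 < s / 2 by rewrite divr_gt0.
have pow2_lt1 t : 0 < t -> (2^-1 : R) `^ t < 1.
  move=> t0; have := @gt0_ltr_powR R t t0 2^-1 1.
  rewrite powR1; apply; rewrite ?nnegrE ?invr_ge0//.
  by rewrite invf_lt1// ltr1n.
have rkpow t k : rk k `^ t = r `^ t * (2^-1 `^ t) ^+ k.
  rewrite /rk powRM ?exprn_ge0 ?(ltW r_gt0) ?invr_ge0//; congr (_ * _).
  by rewrite -[in LHS]powR_mulrn ?invr_ge0// powRAC powR_mulrn ?powR_ge0.
have r1 : 0 <= n%:R * r by rewrite mulr_ge0// ltW.
(* A crude constant, depending on x and p, that only serves to show that the values of u at the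
   selected points tend to u x. *)
pose Kx := 4 * gx * n%:R ^+ n / (c *+ 2) ^+ n * ((n%:R * r) `^ s) `^ p.
have Kx0 : 0 <= Kx.
  rewrite mulr_ge0 ?powR_ge0// divr_ge0 ?exprn_ge0 ?mulrn_wge0 ?(ltW c0)//.
  by rewrite !mulr_ge0 ?exprn_ge0// ltW.
have -> : u a = u (F 0%N).2 by rewrite F0.
apply: (@geometric_telescope _ (fun k => u (F k).2) _ (Kx + 1) _ q (2^-1 `^ s)).
- exact: powR_ge0.
- exact: pow2_lt1.
- exact: powR_ge0.
- exact: pow2_lt1.
- move=> k; rewrite -mulrA -rkpow; apply: morrey_increment => //.
    have [_ xk _ _] := Fgood k; have [_ xk' _ _] := Fgood k.+1.
    have := ler_distD x (F k).2 (F k.+1).2; rewrite (distrC (F k).2 x).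
    by move: xk'; rewrite rkS; have := rk0 k; lra.
  have := Frel k; rewrite /rel rkS => /le_trans; apply.
  have v1 := vol_gt0 (rk0 k); have v2 := vol_gt0 (rk0 k.+1); rewrite rkS in v2.
  rewrite [leLHS](_ : _ = 16 * M `^ p / (vol (rk k) * vol (rk k / 2)))//.
  by field; rewrite !gt_eqF.
- move=> k; apply: (@powR_le_cancel _ _ _ p) => //.
    by rewrite mulr_ge0 ?exprn_ge0 ?powR_ge0// addr_ge0.
  have [_ xk _ dk] := Fgood k.
  have Q0 : 0 <= 4 * gx / vol (rk k) by rewrite divr_ge0 ?mulr_ge0 ?(ltW gx0) ?(ltW (vol_gt0 _)).
  apply: le_trans (dquot_increment Q0 (ltW (rk0 k)) dk (ltW xk)) _.
  have sp0 : n%:R + s * p != 0 by rewrite gt_eqF// ltr_wpDl// mulr_gt0.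
  rewrite powRD ?(negbTE sp0)// powR_mulrn ?(mulr_ge0 (ler0n _ _) (ltW (rk0 _)))//.
  rewrite powRrM.
  have -> : (n%:R * rk k) `^ s = (n%:R * r) `^ s * (2^-1 `^ s) ^+ k.
    by rewrite (powRM _ (ler0n _ _) (ltW (rk0 _))) (powRM _ (ler0n _ _) (ltW r_gt0)) rkpow mulrA.
  rewrite (powRM _ (powR_ge0 _ _)) ?exprn_ge0 ?powR_ge0//.
  have cn : (c *+ 2) ^+ n != 0 by rewrite gt_eqF// exprn_gt0// pmulrn_lgt0.
  have rn : rk k ^+ n != 0 by rewrite gt_eqF// exprn_gt0.
  have -> : vol (rk k) = (c *+ 2) ^+ n * rk k ^+ n by rewrite /vol -exprMn mulrnAl.
  rewrite (exprMn n _ (rk k)); set Y := ((2^-1 `^ s) ^+ k) `^ p.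
  have -> : 4 * gx / ((c *+ 2) ^+ n * rk k ^+ n) *
     (n%:R ^+ n * rk k ^+ n * (((n%:R * r) `^ s) `^ p * Y)) = Kx * Y.
    by rewrite /Kx; field; rewrite cn rn.
  rewrite powRM ?addr_ge0 ?exprn_ge0 ?powR_ge0// ler_wpM2r ?powR_ge0//.
  apply: (@le_trans _ _ (Kx + 1)); first by rewrite lerDl.
  by apply: le1r_powR; rewrite ?(ltW p1)// lerDr.
Qed.

(** Two chains, one converging to x and one to y, are joined by a single increment between their
    starting points, all at the scale |x - y|. The factor 1 + 2 / (1 - 2^(-s/2)) counts these three
    pieces. *)
Lemma morrey_holder x y : closure Omega x -> closure Omega y -> `|x - y| <= r0 ->
  (inner x < +oo)%E -> (inner y < +oo)%E ->
  `|u x - u y| <= C * (1 + 2 / (1 - 2^-1 `^ (s / 2))) * M * `|x - y| `^ (s / 2).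
Proof.
move=> cx cy xyr ix iy; have [->|xny] := eqVneq x y.
  by rewrite !subrr !normr0 powR0 ?mulr0// gt_eqF// divr_gt0.
have r_gt0 : 0 < `|x - y| by rewrite normr_gt0 subr_eq0.
set r := `|x - y| in xyr r_gt0 *.
have fin z : (inner z < +oo)%E -> exists2 g, 0 < g & (inner z <= g%:E)%E.
  move=> iz; exists (fine (inner z) + 1).
    by rewrite ltr_wpDl// fine_ge0.
  rewrite -(@fineK _ (inner z)) ?ge0_fin_numE// lee_fin fineK ?ge0_fin_numE//.
  by rewrite lerDl.
have [gx gx0 ixg] := fin x ix; have [gy gy0 iyg] := fin y iy.
(* There is no previous point yet, so y itself takes that place. The point a is then selected near x
   with b as its predecessor, which provides the joining quotient. *)
have [b [Ob yb ib dyb _]] := morrey_select cy r_gt0 xyr gy0 gy0 iyg iyg.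
have q0 : 0 < 4 * M `^ p / vol r by rewrite divr_gt0 ?vol_gt0 ?mulr_gt0 ?powR_gt0.
have [a [Oa xa ia dba dxa]] := morrey_select cx r_gt0 xyr gx0 q0 ixg ib.
have h1 := morrey_chain cx r_gt0 xyr gx0 ixg Oa xa ia dxa.
have h2 := morrey_chain cy r_gt0 xyr gy0 iyg Ob yb ib dyb.
have h3 : `|u b - u a| <= C * M * r `^ (s / 2).
  apply: morrey_increment => //.
    apply: le_trans (ler_dist_chain a b x y) _; apply: le_trans (thrice_le_mul4 r_gt0).
    by apply: lerD; [apply: lerD; [exact: ltW|by []]|exact: ltW].
  apply: le_trans dba _.
  have v1 := vol_gt0 r_gt0; have v2 : 0 < vol (r / 2) by rewrite vol_gt0 ?divr_gt0.
  have -> : 4 * (4 * M `^ p / vol r) / vol r = 16 * M `^ p / (vol r * vol r).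
    by field; rewrite gt_eqF.
  rewrite ler_wpM2l ?mulr_ge0 ?powR_ge0// lef_pV2 ?posrE ?mulr_gt0// ler_wpM2l ?(ltW v1)//.
  apply: lerXn2r; rewrite ?nnegrE ?mulrn_wge0 ?mulr_ge0 ?(ltW c0) ?(ltW r_gt0)//.
  rewrite lerMn2r ler_wpM2l ?(ltW c0)// ler_pdivrMr// ler_peMr ?(ltW r_gt0)//.
  by rewrite ler1n.

set A := C * M * _ in h1 h2 h3; set q := _ `^ (s / 2) in h1 h2 *.
have -> : C * (1 + 2 / (1 - q)) * M * r `^ (s / 2) = A + A / (1 - q) + A / (1 - q).
  by rewrite /A; ring.
apply: le_trans (ler_dist_chain (u y) (u x) (u b) (u a)) _.
rewrite (distrC (u a)) (distrC (u b) (u y)) [A + _]addrC.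
by apply: lerD => //; apply: lerD.
Qed.

End morrey.

(** * Hoelder extension *)

Section holder_extension.
Context (R : realType) (n : nat).
Implicit Types (x y z : 'rV[R]_n) (E : set 'rV[R]_n).

Lemma powR_dist_triangle (a : R) x y z : 0 < a -> a <= 1 ->
  `|x - z| `^ a <= `|x - y| `^ a + `|y - z| `^ a.
Proof.
move=> a0 a1; apply: le_trans (powR_addl_le a0 a1 (normr_ge0 _) (normr_ge0 _)).
by apply: ge0_ler_powR; rewrite ?nnegrE ?(ltW a0)//; exact: ler_distD.
Qed.

(** McShane's formula: the infimum over z in E of u z + L |x - z|^a. As a <= 1, |x - z|^a satisfies
    the triangle inequality, so the constant L is preserved. *)
Lemma holder_extension E (u : 'rV[R]_n -> R) (L a : R) :
  0 < a -> a <= 1 -> 0 <= L -> E !=set0 ->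
  (forall x y, E x -> E y -> `|u x - u y| <= L * `|x - y| `^ a) ->
  exists w, (forall x, E x -> w x = u x) /\
    forall x y, `|w x - w y| <= L * `|x - y| `^ a.
Proof.
move=> a0 a1 L0 E0 hu.
pose S x := [set u z + L * `|x - z| `^ a | z in E].
have S0 x : S x !=set0 by have [z Ez] := E0; exists (u z + L * `|x - z| `^ a), z.
have tri x y z : L * `|x - z| `^ a <= L * `|x - y| `^ a + L * `|y - z| `^ a.
  by rewrite -mulrDr ler_wpM2l// powR_dist_triangle.
have lbS x z0 : E z0 -> lbound (S x) (u z0 - L * `|x - z0| `^ a).
  move=> Ez0 _ [z Ez <-]; have h1 := le_trans (ler_norm _) (hu z0 z Ez0 Ez).
  have h2 := tri z0 x z; rewrite (distrC z0 x) in h2.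
  by rewrite lerBlDr -addrA -lerBlDl addrC (le_trans _ h2)// addrC.
have hlb x : has_lbound (S x).
  by have [z0 Ez0] := E0; exists (u z0 - L * `|x - z0| `^ a); exact: lbS.
exists (fun x => inf (S x)); split.
  move=> x Ex; apply/eqP; rewrite eq_le; apply/andP; split.
    apply: (ge_inf (hlb x)); exists x => //.
    by rewrite subrr normr0 powR0 ?gt_eqF// mulr0 addr0.
  apply: lb_le_inf => // y Sy; have := lbS x x Ex y Sy.
  by rewrite subrr normr0 powR0 ?gt_eqF// mulr0 subr0.
have half x y : inf (S x) - inf (S y) <= L * `|x - y| `^ a.
  rewrite lerBlDr -lerBlDl; apply: lb_le_inf => // _ [z Ez <-].
  rewrite lerBlDl; apply: le_trans (_ : u z + L * `|x - z| `^ a <= _).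
    by apply: (ge_inf (hlb x)); exists z.
  by rewrite addrCA lerD2l tri.
move=> x y; rewrite ler_norml half andbT lerNl opprB.
by rewrite (distrC x y) half.
Qed.

Lemma holder_continuous (w : 'rV[R]_n -> R) (L a : R) : 0 < a -> 0 <= L ->
  (forall x y, `|w x - w y| <= L * `|x - y| `^ a) -> continuous w.
Proof.
move=> a0 L0 hw x; rewrite /continuous_at; apply/(@cvgrPdist_lt _ R^o _ (nbhs x)) => e e0.
have L1 : 0 < L + 1 by rewrite ltr_wpDl.
have d0 : 0 < (e / (L + 1)) `^ a^-1 by rewrite powR_gt0// divr_gt0.
near=> y; have xy : `|x - y| < (e / (L + 1)) `^ a^-1.
  by rewrite -ball_rVE; near: y; exact: nbhsx_ballx.
apply: le_lt_trans (hw x y) _.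
apply: (@le_lt_trans _ _ ((L + 1) * `|x - y| `^ a)).
  by rewrite ler_wpM2r ?powR_ge0// lerDl.
rewrite mulrC -ltr_pdivlMr//.
rewrite [ltRHS](_ : _ = ((e / (L + 1)) `^ a^-1) `^ a); last first.
  by rewrite -powRrM mulVf ?gt_eqF// powRr1// divr_ge0 ?ltW.
by apply: gt0_ltr_powR; rewrite ?nnegrE ?powR_ge0.
Unshelve. all: by end_near. Qed.

End holder_extension.

(** * Almost everywhere equality and Hoelder representatives *)

Section almost_everywhere.
Context (R : realType) (n : nat).
Local Notation mu := (@lebesgue_rV R n).
Variable Omega : set 'rV[R]_n.
Hypothesis mO : measurable Omega.

Lemma ae_exists (P : 'rV[R]_n -> Prop) (A : set 'rV[R]_n) :
  {ae mu, forall x, Omega x -> P x} -> measurable A -> A `<=` Omega ->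
  (0 < mu A)%E -> exists2 x, A x & P x.
Proof.
move=> [N [mN N0 NP]] mA AO A0; apply: contrapT => no.
have AN : A `<=` N.
  move=> x Ax; apply: NP => /(_ (AO x Ax)) Px; apply: no; by exists x.
have : (mu A <= mu N)%E by apply: le_measure; rewrite ?inE.
by rewrite N0 leNgt A0.
Qed.

Lemma measurable_fun_patch (u : 'rV[R]_n -> R) : measurable_fun Omega u ->
  measurable_fun setT (u \_ Omega).
Proof. by move=> mu_; apply/(measurable_restrictT _ mO). Qed.

Section ae_eq.
Variables (u v : 'rV[R]_n -> R).
Hypotheses (mu_ : measurable_fun Omega u) (mv : measurable_fun Omega v).
Hypothesis uv : {ae mu, forall x, Omega x -> u x = v x}.
Local Open Scope ereal_scope.

(** The exceptional null set is used once in each variable of the iterated integral. Both functions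
    are first set to zero outside Omega, which makes them measurable on the whole space. *)
Lemma ae_eq_gagliardo s (p : R) : gagliardo Omega s p u = gagliardo Omega s p v.
Proof.
have patchu (w : 'rV[R]_n -> R) x : Omega x -> w x = (w \_ Omega) x.
  by move=> Ox; rewrite patchE mem_set.
rewrite (eq_gagliardo (patchu u)) (eq_gagliardo (patchu v)).
set u' := u \_ Omega; set v' := v \_ Omega.
have mu' := measurable_fun_patch mu_; have mv' := measurable_fun_patch mv.
have uv' : {ae mu, forall x, Omega x -> u' x = v' x}.
  by apply: filterS uv => x + Ox => /(_ Ox) E; rewrite /u' /v' !patchE mem_set.
have md w : measurable_fun setT w -> forall x, measurable_fun Omega (fun y => (dquot s p w (x, y))%:E).
  move=> mw x; apply: measurable_funTS; apply/measurable_EFinP; apply: measurable_section.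
  exact: measurable_dquot.
apply: (f_equal (fun t : \bar R => poweR t (GRing.inv p))).
apply: (@ge0_ae_eq_integral _ _ R mu Omega
  (fun x => \int[mu]_(y in Omega) (dquot s p u' (x, y))%:E)
  (fun x => \int[mu]_(y in Omega) (dquot s p v' (x, y))%:E)) => //.
- apply: measurable_funTS; apply: measurable_inner_integral => //; first exact: measurable_dquot.
  by move=> z; rewrite dquot_ge0.
- apply: measurable_funTS; apply: measurable_inner_integral => //; first exact: measurable_dquot.
  by move=> z; rewrite dquot_ge0.
- by move=> x _; apply: integral_ge0 => y _; rewrite lee_fin dquot_ge0.
- by move=> x _; apply: integral_ge0 => y _; rewrite lee_fin dquot_ge0.
apply: filterS (uv') => x + Ox => /(_ Ox) xE.
apply: ge0_ae_eq_integral => //; try exact: md.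
- by move=> y _; rewrite lee_fin dquot_ge0.
- by move=> y _; rewrite lee_fin dquot_ge0.
by apply: filterS uv' => y + Oy => /(_ Oy) yE; rewrite /dquot/= xE yE.
Qed.

Lemma ae_eq_Lp_norm (p : R) : p != 0%R -> Lp_norm Omega p%:E u = Lp_norm Omega p%:E v.
Proof.
move=> p0.
have E w : Lp_norm Omega p%:E w = (\int[mu]_(x in Omega) (`|w x| `^ p)%:E) `^ (GRing.inv p).
  by rewrite -Lp_norm_powE// -poweRrM divff// poweRe1// Lnorm_ge0.
have mw (w : 'rV[R]_n -> R) : measurable_fun Omega w -> measurable_fun Omega (fun x => (`|w x| `^ p)%:E).
  move=> mw; apply/measurable_EFinP; apply: (measurableT_comp (measurable_powR p)).
  exact: measurableT_comp.
rewrite !E; congr (_ `^ _); apply: ge0_ae_eq_integral => //; try exact: mw.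
by apply: filterS uv => x + Ox => /(_ Ox) ->.
Qed.

Lemma measurable_spow (p : R) (w : 'rV[R]_n -> R) (A : set 'rV[R]_n) :
  measurable_fun A w -> measurable_fun A (fun x => spow p (w x)).
Proof.
move=> mw; apply: measurable_funM => //; apply: (measurableT_comp (measurable_powR _)).
exact: measurableT_comp.
Qed.

Lemma ae_eq_mean_p (p : R) : mean_p Omega p u = mean_p Omega p v.
Proof.
rewrite !mean_pE; apply: ae_eq_integral => //.
- by apply/measurable_EFinP; exact: measurable_spow.
- by apply/measurable_EFinP; exact: measurable_spow.
by apply: filterS uv => x + Ox => /(_ Ox) ->.
Qed.

End ae_eq.

Hypothesis Omega_gt0 : (0 < mu Omega)%E.
Variables (c r0 s : R).
Hypotheses (c0 : 0 < c) (r0_ge1 : 1 <= r0) (cs : corkscrew Omega c r0).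
Hypothesis dist_le : forall x y, Omega x -> Omega y -> `|x - y| <= r0.
Hypotheses (s0 : 0 < s) (s1 : s < 1).

Definition fractional_morrey_const : R :=
  morrey_const n c r0 s * (1 + 2 / (1 - 2^-1 `^ (s / 2))).

Lemma fractional_morrey_const_ge0 : 0 <= fractional_morrey_const.
Proof.
rewrite mulr_ge0 ?morrey_const_ge0// addr_ge0// divr_ge0// subr_ge0.
apply: (@le_trans _ _ (2^-1 `^ 0)); last by rewrite powRr0.
apply: ger_powR; last by rewrite divr_ge0 ?ltW.
by rewrite invr_gt0 ltr0n invf_le1 ?ler1n.
Qed.

(** The pointwise estimate applies where the inner integral of the energy is finite, hence almost
    everywhere in Omega; the extension from that set is the required representative. *)
Lemma fractional_morrey (p M : R) (u : 'rV[R]_n -> R) :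
  1 < p -> n%:R <= s / 2 * p -> 0 < M -> measurable_fun Omega u ->
  (gagliardo Omega s p u `^ p <= (M `^ p)%:E)%E ->
  exists w, (forall x y, `|w x - w y| <= fractional_morrey_const * M * `|x - y| `^ (s / 2)) /\
    {ae mu, forall x, Omega x -> u x = w x}.
Proof.
move=> p1 pn M0 mu_ gM.
have patchu x : Omega x -> u x = (u \_ Omega) x by move=> Ox; rewrite patchE mem_set.
have mu' := measurable_fun_patch mu_.
move: gM; rewrite (eq_gagliardo patchu) gagliardo_powE ?gt_eqF ?(lt_trans _ p1)// => gM.
set u' := u \_ Omega in patchu mu' gM.
pose inner x := (\int[mu]_(y in Omega) (dquot s p u' (x, y))%:E)%E.
have inner_ge0 x : (0 <= inner x)%E.
  by apply: integral_ge0 => y _; rewrite lee_fin dquot_ge0.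
have fin : {ae mu, forall x, Omega x -> (inner x < +oo)%E}.
  suff : {ae mu, forall x, Omega x -> inner x \is a fin_num}.
    by apply: filterS => x + Ox => /(_ Ox); rewrite ge0_fin_numE.
  apply: (@integrable_ae _ _ _ mu Omega mO inner); apply/integrableP; split.
    apply: measurable_funTS; apply: measurable_inner_integral => //; first exact: measurable_dquot.
    by move=> z; rewrite dquot_ge0.
  under eq_integral do rewrite gee0_abs//.
  exact: le_lt_trans gM (ltry _).
have [x0 Ox0 fx0] := ae_exists fin mO (@subset_refl _ _) Omega_gt0.
have s20 : 0 < s / 2 by rewrite divr_gt0.
have s21 : s / 2 <= 1 by rewrite ler_pdivrMr// mul1r (le_trans (ltW s1))// ler1n.
have [|||w [wE wH]] := @holder_extension R n [set x | Omega x /\ (inner x < +oo)%E] u'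
    (fractional_morrey_const * M) (s / 2) s20 s21.
- by rewrite mulr_ge0 ?fractional_morrey_const_ge0 ?ltW.
- by exists x0.
- move=> x y [Ox ix] [Oy iy].
  have H := morrey_holder mO c0 r0_ge1 cs s0 p1 pn M0 mu' gM
    (subset_closure Ox) (subset_closure Oy) (dist_le Ox Oy) ix iy.
  by rewrite /fractional_morrey_const.
exists w; split => //.
by apply: filterS fin => x + Ox => /(_ Ox) ix; rewrite patchu// wE.
Qed.

End almost_everywhere.

(** * Limits as p tends to infinity *)

Lemma normB_perturb (R : realDomainType) (x y x' y' e : R) :
  `|x' - x| <= e -> `|y' - y| <= e -> `|x - y| - 2 * e <= `|x' - y'|.
Proof.
move=> xe ye; have := ler_distD x' x y; have := ler_distD y' x' y.
by rewrite (distrC x x'); move: xe ye; lra.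
Qed.

Section equicontinuous_extraction.
Context (R : realType) (n : nat).

Lemma ultra_bounded_cvg (U : set_system nat) (a : nat -> R) (B : R) : UltraFilter U ->
  (forall j, `|a j| <= B) -> exists l : R, a @ U --> l.
Proof.
move=> UU aB; have FU : ProperFilter (a @ U) by exact: fmap_proper_filter.
have [|l [_ cl]] := @segment_compact R (- B) B (a @ U) FU.
  apply: (@filterS _ U _ setT); last exact: filterT.
  by move=> j _ /=; rewrite in_itv/= -ler_norml; exact: aB.
exists l => V Vl; have [//|nV] := in_ultra_setVsetC (a @^-1` V) UU.
have [t [/= nVt Vt]] := cl (~` V) V nV Vl; by [].
Qed.

(** Arzela-Ascoli by an ultrafilter refining the tail filter, in place of a diagonal extraction:
    bounded values converge along it at every point, equicontinuity makes the convergence uniform on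
    K, and since its members meet every tail a subsequence can be read off. *)
Lemma holder_extraction (K : set 'rV[R]_n) (f : nat -> 'rV[R]_n -> R) (L a : R)
    (B : 'rV[R]_n -> R) : compact K -> 0 < a -> 0 <= L ->
  (forall j x, `|f j x| <= B x) ->
  (forall j x y, `|f j x - f j y| <= L * `|x - y| `^ a) ->
  exists k : nat -> nat, {homo k : i j / (i < j)%N} /\ exists v,
    (forall x y, `|v x - v y| <= L * `|x - y| `^ a) /\
    forall e, 0 < e -> exists N, forall j, (N <= j)%N ->
      forall x, K x -> `|f (k j) x - v x| <= e.
Proof.
move=> cK a0 L0 fB fH.
have [U [UU ooU]] := ultraFilterLemma (@eventually_filter : ProperFilter \oo).
have UF : ProperFilter U by exact: ultra_proper.
have lim x : exists l : R, (fun j => f j x) @ U --> l by exact: ultra_bounded_cvg.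
pose v x := projT1 (cid (lim x)).
have vlim x e : 0 < e -> U [set j | `|f j x - v x| < e].
  move=> e0; have fv : (fun j => f j x) @ U --> v x by rewrite /v; case: cid.
  have : \forall j \near U, `|v x - f j x| < e by exact: (@cvgr_dist_lt _ R^o _ _ _ _ _ fv).
  by apply: filterS => j /=; rewrite distrC.
have vH x y : `|v x - v y| <= L * `|x - y| `^ a.
  apply/ler_addgt0Pr => e e0; have e2 : 0 < e / 2 by rewrite divr_gt0.
  have [j [/= h1 h2]] := filter_ex (filterI (vlim x _ e2) (vlim y _ e2)).
  have := fH j x y; have := ler_distD (f j x) (v x) (v y).
  have := ler_distD (f j y) (f j x) (v y); rewrite (distrC (v x) (f j x)).
  rewrite [X in _ <= _ + X]splitr; move: h1 h2; lra.
have unif e : 0 < e -> U [set j | forall x, K x -> `|f j x - v x| <= e].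
  move=> e0; apply: ((compact_near_coveringP K).1 cK nat U (fun j x => `|f j x - v x| <= e)) => x Kx.
  have e3 : 0 < e / 3 by rewrite divr_gt0.
  have L1 : 0 < L + 1 by rewrite ltr_wpDl.
  have d0 : 0 < (e / 3 / (L + 1)) `^ a^-1 by rewrite powR_gt0// divr_gt0.
  have small y : `|x - y| < (e / 3 / (L + 1)) `^ a^-1 -> L * `|x - y| `^ a <= e / 3.
    move=> xy; apply: (@le_trans _ _ ((L + 1) * `|x - y| `^ a)).
      by rewrite ler_wpM2r ?powR_ge0// lerDl.
    rewrite mulrC -ler_pdivlMr//.
    rewrite [leRHS](_ : _ = ((e / 3 / (L + 1)) `^ a^-1) `^ a); last first.
      by rewrite -powRrM mulVf ?gt_eqF// powRr1// !divr_ge0 ?ltW.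
    by apply: ge0_ler_powR; rewrite ?nnegrE ?powR_ge0// ?(ltW a0)// ltW.
  near=> y j.
  have xy : `|x - y| < (e / 3 / (L + 1)) `^ a^-1.
    by rewrite -ball_rVE; near: y; exact: nbhsx_ballx.
  have h : `|f j x - v x| < e / 3 by near: j; exact: vlim.
  have := small _ xy; have := fH j x y; have := vH x y.
  have := ler_distD (f j x) (f j y) (v y); have := ler_distD (v x) (f j x) (v y).
  rewrite (distrC (f j y) (f j x)) => *; move: h; lra.
have pick m N : exists j, (N < j)%N /\ forall x, K x -> `|f j x - v x| <= m.+1%:R^-1.
  have mp : 0 < m.+1%:R^-1 :> R by rewrite invr_gt0.
  have tail : U [set j | (N < j)%N] by apply: ooU; exact: nbhs_infty_gt.
  by have [j [h1 h2]] := filter_ex (filterI tail (unif _ mp)); exists j.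
pose g m N := projT1 (cid (pick m N)).
have gP m N : (N < g m N)%N /\ forall x, K x -> `|f (g m N) x - v x| <= m.+1%:R^-1.
  by rewrite /g; case: cid.
pose k := fix k m := if m is m'.+1 then g m (k m') else g 0%N 0%N.
exists k; split.
  by apply: (homo_ltn (@ltn_trans)) => m /=; exact: (gP m.+1 (k m)).1.
exists v; split => // e e0.
have [N _ NP] := near_infty_natSinv_lt (PosNum e0).
exists N => j Nj x Kx; apply: le_trans (ltW (NP j Nj)).
by case: j {Nj} => [|j] /=; exact: (gP _ _).2.
Unshelve. all: by end_near. Qed.

End equicontinuous_extraction.

Section mean_zero.
Context (R : realType) (n : nat) (Omega : set 'rV[R]_n).
Local Notation mu := (@lebesgue_rV R n).
Hypotheses (mO : measurable Omega) (Ofin : (mu Omega < +oo)%E).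

Lemma bounded_integrable (f : 'rV[R]_n -> R) B : measurable_fun Omega f ->
  (forall x, Omega x -> `|f x| <= B) -> mu.-integrable Omega (EFin \o f).
Proof.
move=> mf fB; apply: measurable_bounded_integrable => //.
exists B; split; first exact: num_real.
by move=> y By x Ox; apply: le_trans (fB x Ox) (ltW By).
Qed.

(** As f integrates to zero, C - f integrates to C times the volume of Omega, while C - f >= a on A
    because C >= 0. *)
Lemma integral_zero_compare (f : 'rV[R]_n -> R) (A : set 'rV[R]_n) B C a :
  measurable_fun Omega f -> (forall x, Omega x -> `|f x| <= B) ->
  (\int[mu]_(x in Omega) (f x)%:E = 0)%E ->
  measurable A -> A `<=` Omega -> 0 <= a -> 0 <= C ->
  (forall x, Omega x -> f x <= C) -> (forall x, A x -> f x <= - a) ->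
  (a%:E * mu A <= C%:E * mu Omega)%E.
Proof.
move=> mf fB f0 mA AO a0 C0 fC fA.
have mE : measurable_fun Omega (fun x => C - f x) by exact: measurable_funB.
apply: (@le_trans _ _ (\int[mu]_(x in Omega) (C - f x)%:E)%E).
  apply: integral_ge_sub => // x; first by move=> /fC; rewrite subr_ge0.
  by move=> /fA; lra.
have -> : (\int[mu]_(x in Omega) (C - f x)%:E =
    \int[mu]_(x in Omega) (C%:E - (f x)%:E))%E by [].
rewrite integralB//=; last 2 first.
- by apply: (@bounded_integrable (cst C) C) => // x _; rewrite /cst ger0_norm.
- exact: bounded_integrable fB.
by rewrite f0 sube0 integral_cst.
Qed.

End mean_zero.

(** * Properties of uniform limits as p tends to infinity *)

Section limit_function.
Context (R : realType) (n : nat) (Omega : set 'rV[R]_n).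
Local Notation mu := (@lebesgue_rV R n).
Hypotheses (oO : open Omega) (bO : bounded_set Omega) (neO : Omega !=set0).
Variables (s M : R) (p_ : nat -> R) (w : nat -> 'rV[R]_n -> R) (v : 'rV[R]_n -> R).
Hypotheses (s0 : 0 < s) (M0 : 0 <= M).
Hypotheses (pj : p_ @ \oo --> +oo) (cw : forall j, continuous (w j)) (cv : continuous v).
Hypothesis wv : forall e, 0 < e -> \forall j \near \oo, forall x, Omega x -> `|w j x - v x| <= e.

Let mO : measurable Omega. Proof. exact: measurable_open_rV. Qed.
Let Ofin : (mu Omega < +oo)%E. Proof. exact: lebesgue_rV_bounded_lty. Qed.

Lemma volE (A : set 'rV[R]_n) : measurable A -> A `<=` Omega ->
  (mu A = (fine (mu A))%:E)%E.
Proof.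
move=> mA AO; rewrite fineK// ge0_fin_numE//; apply: le_lt_trans Ofin.
by apply: le_measure; rewrite ?inE.
Qed.

Lemma vol_gt0 (A : set 'rV[R]_n) : measurable A -> A `<=` Omega ->
  (0 < mu A)%E -> 0 < fine (mu A).
Proof. by move=> mA AO A0; rewrite -lte_fin -volE. Qed.

Lemma continuous_bounded (f : 'rV[R]_n -> R) : continuous f ->
  exists2 B, 0 <= B & forall x, closure Omega x -> `|f x| <= B.
Proof.
move=> cf; have [x0 Ox0] := neO.
have [||x /set_mem _ xm] := @compact_EVT_max _ R (fun x => `|f x|) (closure Omega) _
    (compact_closure_bounded bO).
- by exists x0; exact: subset_closure.
- apply: continuous_subspaceT => y; apply: (@continuous_comp _ _ _ f (@Num.norm R R^o)); first exact: cf.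
  exact: norm_continuous.
by exists `|f x| => // y cy; apply: xm; rewrite inE.
Qed.

Lemma near_ball_sub x (P : 'rV[R]_n -> Prop) : Omega x -> (\forall y \near x, P y) ->
  exists A, [/\ measurable A, A `<=` Omega, A x, (0 < mu A)%E & forall y, A y -> P y].
Proof.
move=> Ox Px.
have : \forall y \near x, Omega y /\ P y.
  by apply: filterI => //; exact: open_nbhs_nbhs.
move=> /nbhs_ballP[r /= r0 rP]; exists (ball x r); split.
- exact: measurable_ball_rV.
- by move=> y /rP[].
- exact: ballxx.
- by apply: lebesgue_rV_open_gt0; [exact: ball_open|exists x; exact: ballxx].
- by move=> y /rP[].
Qed.

Lemma near_seq (P : R -> Prop) : (\forall p \near +oo, P p) -> \forall j \near \oo, P (p_ j).
Proof. exact: pj. Qed.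

Section holder_bound.
Hypothesis wM : \forall j \near \oo,
  (\int[mu]_(x in Omega) \int[mu]_(y in Omega) (dquot s (p_ j) (w j) (x, y))%:E <= (M `^ p_ j)%:E)%E.

(** If the quotient of v at (x, y) exceeded M, those of the [w j] would exceed some a > M on a
    product of two sets of positive measure, and the energy would be at least a fixed multiple of
    a^p, more than M^p for large p. *)
Lemma limit_holder x y : Omega x -> Omega y -> `|v x - v y| <= M * enorm (x - y) `^ s.
Proof.
move=> Ox Oy; rewrite leNgt; apply/negP => big.
have xny : x != y.
  apply/eqP => xy; move: big; rewrite xy !subrr normr0 enorm0 powR0 ?gt_eqF//.
  by rewrite mulr0 ltxx.
have e0 : 0 < enorm (x - y) by rewrite enorm_gt0 subr_eq0.
pose a := (M + `|v x - v y| / enorm (x - y) `^ s) / 2.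
have Q : M < `|v x - v y| / enorm (x - y) `^ s by rewrite ltr_pdivlMr// powR_gt0.
have Ma : M < a by rewrite /a; lra.
have a0 : 0 < a by exact: le_lt_trans Ma.
have ae : a * enorm (x - y) `^ s < `|v x - v y|.
  by rewrite -ltr_pdivlMr ?powR_gt0// /a; lra.
(* A third of the surplus: one part is lost when x and y move, two when v is replaced by [w j] at
   both points. *)
pose eta := (`|v x - v y| - a * enorm (x - y) `^ s) / 3.
have eta0 : 0 < eta by rewrite /eta divr_gt0// subr_gt0.
have cd : (fun z : 'rV[R]_n * 'rV[R]_n => `|v z.1 - v z.2| - a * `|enorm (z.1 - z.2)| `^ s) z
    @[z --> (x, y)] --> `|v x - v y| - a * `|enorm (x - y)| `^ s.
  apply: cvgB.
    apply: (@cvg_norm R R^o); apply: (@cvgB _ R^o).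
      apply: (@cvg_comp _ _ _ (fun z : 'rV[R]_n * 'rV[R]_n => z.1) v _ (nbhs x)).
        exact: cvg_fst.
      exact: cv.
    apply: (@cvg_comp _ _ _ (fun z : 'rV[R]_n * 'rV[R]_n => z.2) v _ (nbhs y)).
      exact: cvg_snd.
    exact: cv.
  apply: cvgMr; apply: (@cvg_comp _ _ _ (fun z : 'rV[R]_n * 'rV[R]_n => enorm (z.1 - z.2))
    (fun t : R => `|t| `^ s) _ (nbhs (enorm (x - y)))).
    exact: cvg_enormB.
  exact: continuous_normr_powR.
have lim3 : `|v x - v y| - a * `|enorm (x - y)| `^ s = 3 * eta.
  by rewrite (ger0_norm (enorm_ge0 _)) /eta; field.
rewrite lim3 in cd.
have : \forall z \near (x, y), 2 * eta < `|v z.1 - v z.2| - a * `|enorm (z.1 - z.2)| `^ s.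
  have := @cvgr_gt _ _ (nbhs (x, y)) _ _ _ cd (2 * eta); apply; lra.
move=> [[A B] /= [Ax By] AB].
have [A' [mA A'O _ A'0 A'A]] := near_ball_sub Ox Ax.
have [B' [mB B'O _ B'0 B'B]] := near_ball_sub Oy By.
have vA := vol_gt0 mA A'O A'0; have vB := vol_gt0 mB B'O B'0.
pose D := diam Omega.
have eD z z' : Omega z -> Omega z' -> enorm (z - z') <= D.
  by move=> Oz Oz'; apply: enorm_le_diam => //; exact: subset_closure.
have D0 : 0 < D by exact: lt_le_trans (eD _ _ Ox Oy).
have mm : 0 < D `^ (- n%:R) * (fine (mu A') * fine (mu B')) by rewrite !mulr_gt0// powR_gt0.
have dom := near_seq (near_powR_dominated 1 M0 Ma mm).
have p1 : \forall j \near \oo, 1 < p_ j.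
  by apply: (@near_seq (fun p => 1 < p)); apply: nbhs_pinfty_gt; exact: num_real.
have : \forall j \near \oo, False; last by move=> /filter_ex[].
near=> j.
have pj1 : 1 < p_ j by near: j.
have pj0 : 0 < p_ j by exact: lt_trans pj1.
have wvj : forall x, Omega x -> `|w j x - v x| <= eta by near: j; exact: wv.
have en : (\int[mu]_(x in Omega) \int[mu]_(y in Omega)
  (dquot s (p_ j) (w j) (x, y))%:E <= (M `^ p_ j)%:E)%E by near: j.
have domj : 1 * M `^ p_ j < D `^ (- n%:R) * (fine (mu A') * fine (mu B')) * a `^ p_ j.
  by near: j.
have := @iterated_integral_ge_rect R n Omega mO (dquot s (p_ j) (w j)) A' B'
    (a `^ p_ j * D `^ (- n%:R)).
rewrite (volE mA)// (volE mB)// -!EFinM => /(_ _ _ _ mA mB A'O B'O) low.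
have : ((a `^ p_ j * D `^ (- n%:R) * (fine (mu A') * fine (mu B')))%:E <= (M `^ p_ j)%:E)%E.
  apply: le_trans en; apply: low.
  - by apply: measurable_dquot; exact: continuous_measurable_rV.
  - by move=> z; exact: dquot_ge0.
  - by rewrite mulr_ge0 ?powR_ge0.
  move=> x' y' A'x B'y; rewrite /dquot/=.
  have := AB (x', y') (conj (A'A _ A'x) (B'B _ B'y)) => /=.
  rewrite (ger0_norm (enorm_ge0 _)) => gap.
  have wgap : a * enorm (x' - y') `^ s <= `|w j x' - w j y'|.
    apply: le_trans (normB_perturb (wvj _ (A'O _ A'x)) (wvj _ (B'O _ B'y))).
    by rewrite lerBrDr -lerBrDl ltW.
  have e'0 : 0 < enorm (x' - y').
    rewrite enorm_gt0; apply/eqP => xy'; move: gap; rewrite xy' enorm0 powR0 ?gt_eqF// mulr0.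
    move/eqP: xy'; rewrite subr_eq0 => /eqP ->; rewrite subrr normr0.
    by move=> /(lt_trans (mulr_gt0 (ltr0n R 2) eta0)); rewrite subr0 ltxx.
  rewrite powRD; last by apply/implyP => _; rewrite gt_eqF.
  have -> : `|w j x' - w j y'| `^ p_ j / (enorm (x' - y') `^ n%:R * enorm (x' - y') `^ (s * p_ j)) =
      (`|w j x' - w j y'| / enorm (x' - y') `^ s) `^ p_ j * enorm (x' - y') `^ (- n%:R).
    rewrite powRM ?invr_ge0 ?powR_ge0// -[in RHS](powRN _ s) -(powRrM _ (- s)) mulNr !powRN invfM.
    by rewrite mulrA mulrAC.
  apply: ler_pM; rewrite ?powR_ge0//.
    apply: ge0_ler_powR; [exact: ltW|exact: ltW| |].
      by rewrite nnegrE divr_ge0 ?powR_ge0.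
    by rewrite ler_pdivlMr ?powR_gt0.
  rewrite !powRN lef_pV2 ?posrE ?powR_gt0//.
  by apply: ge0_ler_powR; [exact: ler0n|exact: ltW|exact: ltW|apply: eD; [exact: A'O|exact: B'O]].
rewrite lee_fin => h; move: domj; rewrite mul1r ltNge => /negP; apply.
by move: h; rewrite mulrC (mulrC (a `^ _)) mulrA (mulrC (_ * _) (D `^ _)).
Unshelve. all: by end_near. Qed.
End holder_bound.

Lemma near_seq_gt1 : \forall j \near \oo, 1 < p_ j.
Proof. by apply: (@near_seq (fun p => 1 < p)); apply: nbhs_pinfty_gt; exact: num_real. Qed.

Let wmeas j : measurable_fun Omega (w j).
Proof. by apply: measurable_funTS; exact: continuous_measurable_rV. Qed.

Let mpow j : measurable_fun Omega (fun x => `|w j x| `^ p_ j).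
Proof.
by apply: (measurableT_comp (measurable_powR _)); exact: measurableT_comp.
Qed.

Section normalization.
Hypothesis wn : \forall j \near \oo, (\int[mu]_(x in Omega) (`|w j x| `^ p_ j)%:E = 1)%E.

Let Omega_gt0 : (0 < mu Omega)%E. Proof. exact: lebesgue_rV_open_gt0. Qed.

Lemma limit_norm_le1 x : Omega x -> `|v x| <= 1.
Proof.
move=> Ox; rewrite leNgt; apply/negP => vx.
pose a := (1 + `|v x|) / 2; have a1 : 1 < a by rewrite /a; lra.
have ax : a < `|v x| by rewrite /a; lra.
have : \forall y \near x, a < `|v y|.
  have cvx : `|v y| @[y --> x] --> `|v x|.
    apply: (@cvg_comp _ _ _ v (fun t : R => `|t|) _ (nbhs (v x))); first exact: cv.
    exact: (@norm_continuous R R^o).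
  exact: (@cvgr_gt _ _ (nbhs x) _ _ _ cvx a).
move=> /(near_ball_sub Ox)[A [mA AO _ A0 Av]].
pose eta := (a - 1) / 2; have eta0 : 0 < eta by rewrite /eta; lra.
have a'1 : 1 < a - eta by rewrite /eta; lra.
have dom := near_seq (near_powR_dominated 1 ler01 a'1 (vol_gt0 mA AO A0)).
have : \forall j \near \oo, False; last by move=> /filter_ex[].
near=> j.
have pj1 : 1 < p_ j by near: j; exact: near_seq_gt1.
have wvj : forall x, Omega x -> `|w j x - v x| <= eta by near: j; exact: wv.
have wnj : (\int[mu]_(x in Omega) (`|w j x| `^ p_ j)%:E = 1)%E by near: j.
have domj : 1 * 1 `^ p_ j < fine (mu A) * (a - eta) `^ p_ j by near: j.
have := @integral_ge_sub R n Omega A (fun y => `|w j y| `^ p_ j) ((a - eta) `^ p_ j) mO mA AO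
  (mpow j) (fun y _ => powR_ge0 _ _) (powR_ge0 _ _).
rewrite wnj (volE mA AO) -EFinM lee_fin => low; move: domj.
rewrite powR1 mul1r mulrC ltNge => /negP; apply; apply: low => y Ay.
apply: ge0_ler_powR; rewrite ?nnegrE; [lra|lra|by []|].
have h1 := Av y Ay; have h2 := wvj _ (AO _ Ay); have h3 := ler_dist_dist (w j y) (v y).
have := le_trans h3 h2; rewrite ler_norml => /andP[h4 _].
rewrite lerBlDr (le_trans (ltW h1))//; move: h4; rewrite lerNl opprB lerBlDr; lra.
Unshelve. all: by end_near. Qed.

(** Otherwise |w j| <= b + eta < 1 throughout Omega, and the integral of its p-th power tends to 0
    instead of being 1. *)
Lemma limit_norm_gt b : 0 <= b -> b < 1 -> exists2 x, Omega x & b < `|v x|.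
Proof.
move=> b0 b1; apply: contrapT => no.
have vb x : Omega x -> `|v x| <= b.
  by move=> Ox; rewrite leNgt; apply/negP => bx; apply: no; exists x.
pose eta := (1 - b) / 2; have eta0 : 0 < eta by rewrite /eta; lra.
have b'1 : b + eta < 1 by rewrite /eta; lra.
have b'0 : 0 <= b + eta by rewrite /eta; lra.
have dom := near_seq (near_powR_dominated (fine (mu Omega)) b'0 b'1 ltr01).
have : \forall j \near \oo, False; last by move=> /filter_ex[].
near=> j.
have pj1 : 1 < p_ j by near: j; exact: near_seq_gt1.
have wvj : forall x, Omega x -> `|w j x - v x| <= eta by near: j; exact: wv.
have wnj : (\int[mu]_(x in Omega) (`|w j x| `^ p_ j)%:E = 1)%E by near: j.
have domj : fine (mu Omega) * (b + eta) `^ p_ j < 1 * 1 `^ p_ j by near: j.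
have := @integral_le_cst R n Omega (fun y => `|w j y| `^ p_ j) ((b + eta) `^ p_ j) mO
  (mpow j) (fun y _ => powR_ge0 _ _).
rewrite wnj (volE mO (@subset_refl _ _)) -EFinM lee_fin => up; move: domj.
rewrite powR1 mul1r mulrC ltNge => /negP; apply; apply: up => y Oy.
apply: ge0_ler_powR; rewrite ?nnegrE//; first lra.
have h1 := vb y Oy; have h2 := wvj _ Oy; have h3 := ler_distD (v y) (w j y) 0.
by move: h3; rewrite !subr0 => /le_trans; apply; rewrite addrC lerD.
Unshelve. all: by end_near. Qed.

Hypothesis wm : \forall j \near \oo, (\int[mu]_(x in Omega) (spow (p_ j) (w j x))%:E = 0)%E.

(** The normalization alone gives points with |v| near 1, possibly all with v negative. If v <= b
    everywhere, such a point has v < - c with c > b, and the negative part of the (p-1)-mean, of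
    rate c - eta, outgrows the positive part, of rate at most b + eta. *)
Lemma limit_sup_gt b : 0 <= b -> b < 1 -> exists2 x, Omega x & b < v x.
Proof.
move=> b0 b1; apply: contrapT => no.
have vb x : Omega x -> v x <= b.
  by move=> Ox; rewrite leNgt; apply/negP => bx; apply: no; exists x.
pose c := (1 + b) / 2; pose eta := (1 - b) / 8.
have c0 : 0 <= c by rewrite /c; lra.
have c1 : c < 1 by rewrite /c; lra.
have eta0 : 0 < eta by rewrite /eta; lra.
have cc : b + eta < c - eta by rewrite /c /eta; lra.
have be0 : 0 <= b + eta by rewrite /eta; lra.
have ce0 : 0 <= c - eta by apply: le_trans (ltW cc).
have [x Ox cx] := limit_norm_gt c0 c1.
have vx : v x < - c.
  have := vb x Ox; have bc : b < c by rewrite /c; lra.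
  by move: cx; rewrite ltr_normr => /orP[]; lra.
have : \forall y \near x, v y < - c.
  have cvx : v y @[y --> x] --> v x by exact: cv.
  exact: (@cvgr_lt _ _ (nbhs x) _ _ _ cvx (- c)).
move=> /(near_ball_sub Ox)[A [mA AO _ A0 Av]].
have dom : \forall p \near +oo, fine (mu Omega) * (b + eta) `^ (p - 1) <
    fine (mu A) * (c - eta) `^ (p - 1).
  have [K [Kr KP]] := near_powR_dominated (fine (mu Omega)) be0 cc (vol_gt0 mA AO A0).
  by exists (K + 1); split => [|p Kp]; [exact: num_real|apply: KP; lra].
have {}dom := near_seq dom.
have : \forall j \near \oo, False; last by move=> /filter_ex[].
near=> j.
have pj1 : 1 < p_ j by near: j; exact: near_seq_gt1.
have wvj : forall x, Omega x -> `|w j x - v x| <= eta by near: j; exact: wv.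
have wmj : (\int[mu]_(x in Omega) (spow (p_ j) (w j x))%:E = 0)%E by near: j.
have domj : fine (mu Omega) * (b + eta) `^ (p_ j - 1) <
  fine (mu A) * (c - eta) `^ (p_ j - 1) by near: j.
have [B B0 wB] := @continuous_bounded (w j) (@cw j).
have := @integral_zero_compare R n Omega mO Ofin (fun y => spow (p_ j) (w j y)) A
  (B `^ (p_ j - 1)) ((b + eta) `^ (p_ j - 1)) ((c - eta) `^ (p_ j - 1)).
rewrite (volE mA AO) (volE mO (@subset_refl _ _)) -!EFinM lee_fin.
move: domj; rewrite ltNge (mulrC (fine _)) (mulrC (fine _)) => /negP dj H; apply: dj.
have pos : 0 <= p_ j - 1 by lra.
apply: H => //.
- exact: measurable_spow.
- move=> y Oy; rewrite normr_spow//; apply: ge0_ler_powR; rewrite ?nnegrE//.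
  by apply: wB; exact: subset_closure.
- exact: powR_ge0.
- exact: powR_ge0.
- move=> y Oy; rewrite -(spow_ge0E pj1 be0); apply: spow_le => //.
  have := le_trans (ler_norm _) (wvj _ Oy); have := vb y Oy; lra.
- move=> y Ay; rewrite -(spow_ge0E pj1 ce0) -spowN; apply: spow_le => //.
  have := le_trans (ler_norm _) (wvj _ (AO _ Ay)); have := Av y Ay; lra.
Unshelve. all: by end_near. Qed.

End normalization.

End limit_function.

(** * Homogeneity of norm, energy and mean *)

Section scaling.
Context (R : realType) (n : nat) (Omega : set 'rV[R]_n).
Local Notation mu := (@lebesgue_rV R n).
Hypothesis mO : measurable Omega.
Implicit Types (s p c : R) (u : 'rV[R]_n -> R).
Local Open Scope ereal_scope.

Lemma Lp_normE (p : R) u : p != 0%R ->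
  Lp_norm Omega p%:E u = (\int[mu]_(x in Omega) (`|u x| `^ p)%:E) `^ (GRing.inv p).
Proof. by move=> p0; rewrite -Lp_norm_powE// -poweRrM divff// poweRe1// Lnorm_ge0. Qed.

Lemma measurable_pow_norm (p : R) (u : 'rV[R]_n -> R) : measurable_fun Omega u ->
  measurable_fun Omega (fun x => (`|u x| `^ p)%R).
Proof.
move=> mu_; apply: (measurableT_comp (measurable_powR p)).
exact: measurableT_comp.
Qed.

Lemma Lp_norm_pow_scale (p c : R) u : (1 < p)%R -> measurable_fun Omega u ->
  \int[mu]_(x in Omega) (`|c * u x| `^ p)%:E =
  (`|c| `^ p)%:E * \int[mu]_(x in Omega) (`|u x| `^ p)%:E.
Proof.
move=> p1 mu_; rewrite -ge0_integralZl//.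
  by apply: eq_integral => x _; rewrite normrM powRM.
by apply/measurable_EFinP; exact: measurable_pow_norm.
Qed.

Lemma dquot_scale s p c (u : 'rV[R]_n -> R) z :
  dquot s p (fun x => c * u x)%R z = (`|c| `^ p * dquot s p u z)%R.
Proof. by rewrite /dquot -mulrBr normrM powRM// mulrA. Qed.

Lemma gagliardo_pow_scale s p c u : p != 0%R -> measurable_fun Omega u ->
  gagliardo Omega s p (fun x => c * u x)%R `^ p = (`|c| `^ p)%:E * gagliardo Omega s p u `^ p.
Proof.
move=> p0 mu_.
have mu' := measurable_fun_patch mO mu_; set u' := u \_ Omega in mu'.
have uE x : Omega x -> u x = u' x by move=> Ox; rewrite /u' patchE mem_set.
pose v := fun x => (c * u' x)%R.
have E x : Omega x -> (c * u x)%R = v x by move=> Ox; rewrite /v -uE.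
have -> : gagliardo Omega s p u = gagliardo Omega s p u' by exact: eq_gagliardo.
have -> : gagliardo Omega s p (fun x => c * u x)%R = gagliardo Omega s p v by exact: eq_gagliardo.
rewrite [LHS](gagliardo_powE Omega s v p0) (gagliardo_powE Omega s u' p0).
have cp : 0 <= (`|c| `^ p)%:E by rewrite lee_fin powR_ge0.
have mi : measurable_fun Omega (fun x => \int[mu]_(y in Omega) (dquot s p u' (x, y))%:E).
  apply: measurable_funTS; apply: measurable_inner_integral => //; first exact: measurable_dquot.
  by move=> z; rewrite dquot_ge0.
have i0 x : 0 <= \int[mu]_(y in Omega) (dquot s p u' (x, y))%:E.
  by apply: integral_ge0 => y _; rewrite lee_fin dquot_ge0.
rewrite -(ge0_integralZl mu mO mi (fun x _ => i0 x) cp).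
apply: eq_integral => x _; rewrite -ge0_integralZl//.
- by apply: eq_integral => y _; rewrite dquot_scale EFinM.
- apply: measurable_funTS; apply/measurable_EFinP; apply: measurable_section.
  exact: measurable_dquot.
- by move=> y _; rewrite lee_fin dquot_ge0.
Qed.

Lemma spow_scale (p c t : R) : (1 < p)%R -> (0 < c)%R ->
  spow p (c * t)%R = (c `^ (p - 1) * spow p t)%R.
Proof.
move=> p1 c0; rewrite /spow normrM (gtr0_norm c0) powRM ?(ltW c0)//.
rewrite mulrACA; congr (_ * _)%R.
by rewrite -(spow_ge0E p1 (ltW c0)) /spow gtr0_norm.
Qed.

(** Finite volume and |t|^(p-1) <= 1 + |t|^p. *)
Lemma integrable_spow (p : R) u : (1 < p)%R -> mu Omega < +oo -> measurable_fun Omega u ->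
  \int[mu]_(x in Omega) (`|u x| `^ p)%:E < +oo ->
  mu.-integrable Omega (fun x => (spow p (u x))%:E).
Proof.
move=> p1 Ofin mu_ up.
have mp : measurable_fun Omega (fun x => (1 + `|u x| `^ p)%R).
  by apply: measurable_funD => //; exact: measurable_pow_norm.
apply: (@le_integrable _ _ _ mu _ _ _ (fun x => (1 + `|u x| `^ p)%:E)) => //.
- by apply/measurable_EFinP; exact: measurable_spow.
- move=> x _; rewrite !abse_EFin lee_fin normr_spow// ger0_norm ?addr_ge0 ?powR_ge0//.
  have [u1|u1] := leP `|u x|%R 1%R.
    apply: (@le_trans _ _ 1%R); last by rewrite lerDl powR_ge0.
    have q0 : (0 <= p - 1)%R by rewrite subr_ge0 ltW.
    have := ge0_ler_powR q0 (normr_ge0 (u x)) ler01 u1.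
    by rewrite powR1.
  apply: (@le_trans _ _ (`|u x| `^ p)%R); last by rewrite lerDr.
  by apply: ler_powR; [exact: ltW|rewrite gerBl].
apply/integrableP; split; first exact/measurable_EFinP.
under eq_integral do rewrite gee0_abs ?lee_fin ?addr_ge0 ?powR_ge0// EFinD.
rewrite ge0_integralD//.
  by rewrite integral_cst// mul1e lte_add_pinfty.
by apply/measurable_EFinP; exact: measurable_pow_norm.
Qed.

Lemma mean_p_scale (p c : R) u : (1 < p)%R -> (0 < c)%R -> mu Omega < +oo ->
  measurable_fun Omega u -> \int[mu]_(x in Omega) (`|u x| `^ p)%:E < +oo ->
  mean_p Omega p (fun x => c * u x)%R = (c `^ (p - 1))%:E * mean_p Omega p u.
Proof.
move=> p1 c0 Ofin mu_ up; rewrite !mean_pE -integralZl//; last exact: integrable_spow.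
by apply: eq_integral => x _; rewrite -EFinM -spow_scale.
Qed.

End scaling.

(** * Compactness for sequences of bounded energy *)

Section compactness.
Context (R : realType) (n : nat) (Omega : set 'rV[R]_n) (s : R).
Local Notation mu := (@lebesgue_rV R n).
Hypotheses (dom : smooth_bounded_domain Omega) (s0 : 0 < s) (s1 : s < 1).

Let oO : open Omega. Proof. by case: dom. Qed.
Let bO : bounded_set Omega. Proof. by case: dom. Qed.
Let neO : Omega !=set0. Proof. by case: dom. Qed.

Lemma domain_measurable : measurable Omega. Proof. exact: measurable_open_rV. Qed.
Let mO := domain_measurable.

Lemma domain_finite : (mu Omega < +oo)%E. Proof. exact: lebesgue_rV_bounded_lty. Qed.

Lemma domain_gt0 : (0 < mu Omega)%E. Proof. exact: lebesgue_rV_open_gt0. Qed.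

Lemma domain_morrey : exists2 K, 0 <= K & forall (p M : R) (u : 'rV[R]_n -> R),
  1 < p -> n%:R <= s / 2 * p -> 0 < M -> measurable_fun Omega u ->
  (gagliardo Omega s p u `^ p <= (M `^ p)%:E)%E ->
  exists w, (forall x y, `|w x - w y| <= K * M * `|x - y| `^ (s / 2)) /\
    {ae mu, forall x, Omega x -> u x = w x}.
Proof.
have D0 : 0 <= diam Omega.
  have [x Ox] := neO; apply: le_trans (enorm_ge0 (x - x)) _.
  by apply: enorm_le_diam => //; exact: subset_closure.
have r1 : 1 <= 1 + diam Omega by rewrite lerDl.
have [c c0 cs] := smooth_domain_corkscrew dom (lt_le_trans ltr01 r1).
exists (fractional_morrey_const n c (1 + diam Omega) s).
  exact: fractional_morrey_const_ge0.
move=> p M u p1 pn M0 mu_ gM.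
apply: (fractional_morrey mO domain_gt0 c0 r1 cs _ s0 s1 p1 pn M0 mu_ gM) => x y Ox Oy.
apply: le_trans (norm_le_enorm _) _; apply: le_trans (_ : diam Omega <= _).
  by apply: enorm_le_diam => //; exact: subset_closure.
by rewrite lerDr.
Qed.

Lemma closure_le2 (F : 'rV[R]_n * 'rV[R]_n -> R) (c : R) :
  (forall x y, F z @[z --> (x, y)] --> F (x, y)) ->
  (forall x y, Omega x -> Omega y -> F (x, y) <= c) ->
  forall x y, closure Omega x -> closure Omega y -> F (x, y) <= c.
Proof.
move=> cF Fc x y cx cy; rewrite leNgt; apply/negP => big.
have := @cvgr_gt _ _ (nbhs (x, y)) _ _ _ (cF x y) c big.
move=> [[A B] /= [Ax By] AB].
have [x' [Ox' Ax']] := cx _ Ax; have [y' [Oy' By']] := cy _ By.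
by have := AB (x', y') (conj Ax' By'); rewrite ltNge Fc.
Qed.

(** Equicontinuity has to be complemented by one point where the values are bounded independently of
    p. With V the volume and B = 1 + 2 / V, |w| >= B on Omega would make the integral at least B^p V
    >= B V = V + 2 > 1. *)
Lemma exists_norm_lt (p : R) (w : 'rV[R]_n -> R) : 1 < p -> continuous w ->
  (\int[mu]_(x in Omega) (`|w x| `^ p)%:E = 1)%E ->
  exists2 y, Omega y & `|w y| < 1 + 2 / fine (mu Omega).
Proof.
move=> p1 cw w1; apply: contrapT => no.
have V0 : 0 < fine (mu Omega).
  exact: (vol_gt0 oO bO mO (@subset_refl _ _) domain_gt0).
set B := 1 + _ in no.
have B1 : 1 <= B by rewrite /B lerDl divr_ge0// ltW.
have wB y : Omega y -> B <= `|w y|.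
  by move=> Oy; rewrite leNgt; apply/negP => h; apply: no; exists y.
have := @integral_ge_sub R n Omega Omega (fun y => `|w y| `^ p) (B `^ p) mO mO
  (@subset_refl _ _) _ (fun y _ => powR_ge0 _ _) (powR_ge0 _ _).
rewrite w1 (volE oO bO mO (@subset_refl _ _)) -EFinM lee_fin => low.
have : B `^ p * fine (mu Omega) <= 1.
  apply: low.
    by apply: measurable_pow_norm; apply: measurable_funTS; exact: continuous_measurable_rV.
  by move=> y Oy; apply: ge0_ler_powR; rewrite ?nnegrE ?(le_trans ler01 B1)//;
    [lra|exact: wB].
apply/negP; rewrite -ltNge; apply: (@lt_le_trans _ _ (B * fine (mu Omega))).
  by rewrite /B mulrDl mul1r divfK ?gt_eqF//; lra.
by rewrite ler_wpM2r ?(ltW V0)// le1r_powR// ltW.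
Qed.

Lemma near_oo_sub (k : nat -> nat) (P : nat -> Prop) : {homo k : i j / (i < j)%N} ->
  (\forall j \near \oo, P j) -> \forall j \near \oo, P (k j).
Proof.
move=> hk [N _ NP]; exists N => // j /= Nj; apply: NP => /=.
apply: leq_trans Nj _; elim: j => [//|j IH].
exact: leq_ltn_trans IH (hk _ _ (ltnSn j)).
Qed.

(** The bound with M = L0 + 1 gives equicontinuity, with the weak exponent s / 2 and a poor
    constant. Once a limit exists, M decreasing to L0 gives it the sharp constant L0 and the
    exponent s. *)
Theorem fractional_compactness (L0 : R) (p_ : nat -> R) (u : nat -> 'rV[R]_n -> R) :
  0 <= L0 -> p_ @ \oo --> +oo ->
  (forall j, measurable_fun Omega (u j)) ->
  (forall j, Lp_norm Omega (p_ j)%:E (u j) = 1%E) ->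
  (forall j, mean_p Omega (p_ j) (u j) = 0%E) ->
  (forall M, L0 < M -> \forall j \near \oo,
    (gagliardo Omega s (p_ j) (u j) `^ p_ j <= (M `^ p_ j)%:E)%E) ->
  exists k : nat -> nat, {homo k : i j / (i < j)%N} /\ exists w v,
    [/\ (forall j, continuous (w j)) /\ continuous v,
        (forall j, {ae mu, forall x, Omega x -> u (k j) x = w j x}),
        (forall e, 0 < e -> \forall j \near \oo, forall x, closure Omega x -> `|w j x - v x| <= e),
        (forall x y, closure Omega x -> closure Omega y -> `|v x - v y| <= L0 * enorm (x - y) `^ s) &
        [/\ forall x, closure Omega x -> `|v x| <= 1,
           forall b, b < 1 -> exists2 x, Omega x & b < v x &
           forall b, b < 1 -> exists2 x, Omega x & v x < - b]].
Proof.
move=> L00 pj mu_ un um gM; have [K K0 morrey] := domain_morrey.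
have M0 : 0 < L0 + 1 by rewrite ltr_wpDl.
have M1 : L0 < L0 + 1 by rewrite ltrDl.
have p1 : \forall j \near \oo, 1 < p_ j by apply: (@near_seq_gt1 _ _ pj).
have pn : \forall j \near \oo, n%:R <= s / 2 * p_ j.
  have : \forall p \near +oo, n%:R <= s / 2 * p.
    exists (n%:R / (s / 2)); split; first exact: num_real.
    by move=> p /ltW; rewrite ler_pdivrMr ?divr_gt0// mulrC.
  exact: pj.
(* The bounds hold only from some index J on, so the functions are renumbered by j + J before the
   extraction. *)
have [J _ JP] : \forall j \near \oo, [/\ 1 < p_ j, n%:R <= s / 2 * p_ j &
    (gagliardo Omega s (p_ j) (u j) `^ p_ j <= ((L0 + 1) `^ p_ j)%:E)%E].
  by near=> j; split; near: j => //; exact: gM.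
have ex j : exists w, (forall x y, `|w x - w y| <= K * (L0 + 1) * `|x - y| `^ (s / 2)) /\
    {ae mu, forall x, Omega x -> u (j + J)%N x = w x}.
  have [a1 a2 a3] := JP (j + J)%N (leq_addl _ _).
  exact: morrey a1 a2 M0 (mu_ _) a3.
pose f j := projT1 (cid (ex j)).
have fH j x y : `|f j x - f j y| <= K * (L0 + 1) * `|x - y| `^ (s / 2).
  by rewrite /f; case: cid => ? [].
have fu j : {ae mu, forall x, Omega x -> u (j + J)%N x = f j x}.
  by rewrite /f; case: cid => ? [].
have KM0 : 0 <= K * (L0 + 1) by rewrite mulr_ge0 ?(ltW M0).
have s20 : 0 < s / 2 by rewrite divr_gt0.
have cf j : continuous (f j) by exact: holder_continuous s20 KM0 (fH j).
have mf j : measurable_fun Omega (f j).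
  by apply: measurable_funTS; exact: continuous_measurable_rV.
have fn j : (\int[mu]_(x in Omega) (`|f j x| `^ p_ (j + J))%:E = 1)%E.
  have [a1 _ _] := JP (j + J)%N (leq_addl _ _).
  have pne : p_ (j + J)%N != 0 by rewrite gt_eqF// (lt_trans _ a1).
  by rewrite -Lp_norm_powE// -(ae_eq_Lp_norm mO (mu_ _) (mf j) (fu j) pne) un poweR1r.
have [C C0 OC] := bounded_closure bO.
have fB j x : `|f j x| <= 1 + 2 / fine (mu Omega) + K * (L0 + 1) * (`|x| + C) `^ (s / 2).
  have [a1 _ _] := JP (j + J)%N (leq_addl _ _).
  have [y Oy yB] := exists_norm_lt a1 (cf j) (fn j).
  have -> : f j x = f j y + (f j x - f j y) by rewrite addrC subrK.
  apply: le_trans (ler_normD _ _) _; apply: lerD (ltW yB) _.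
  apply: le_trans (fH j x y) _; rewrite ler_wpM2l//.
  apply: ge0_ler_powR; rewrite ?nnegrE ?addr_ge0 ?(ltW C0) ?(ltW s20)//.
  apply: le_trans (ler_normB _ _) _; rewrite lerD2l; apply: OC.
  exact: subset_closure.
have [k [hk [v [vH kv]]]] := holder_extraction (compact_closure_bounded bO) s20 KM0 fB fH.
have cv : continuous v by exact: holder_continuous s20 KM0 vH.
have hkJ : {homo (fun j => k j + J)%N : i j / (i < j)%N}.
  by move=> i j ij; rewrite ltn_add2r hk.
pose w j := f (k j); pose q j := p_ (k j + J)%N.
have wv e : 0 < e -> \forall j \near \oo, forall x, closure Omega x -> `|w j x - v x| <= e.
  by move=> e0; have [N NP] := kv e e0; exists N => // j /= Nj; exact: NP.
have wvO e : 0 < e -> \forall j \near \oo, forall x, Omega x -> `|w j x - v x| <= e.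
  by move=> /wv; apply: filterS => j + x Ox => /(_ x); apply; exact: subset_closure.
have qj : q @ \oo --> +oo by move=> P /pj PP; exact: near_oo_sub hkJ PP.
have cw j : continuous (w j) by exact: cf.
have wn : \forall j \near \oo, (\int[mu]_(x in Omega) (`|w j x| `^ q j)%:E = 1)%E.
  by apply: nearW => j; exact: fn.
have wm : \forall j \near \oo, (\int[mu]_(x in Omega) (spow (q j) (w j x))%:E = 0)%E.
  apply: nearW => j.
  by rewrite -(um (k j + J)%N) (ae_eq_mean_p mO (mu_ _) (mf (k j)) (fu (k j))) mean_pE.
exists (fun j => k j + J)%N; split => //; exists w, v; split; [by split|by move=> j; exact: (fu (k j))|exact: wv| |].
- move=> x y cx cy.
  have := @closure_le2 (fun z => `|v z.1 - v z.2| - L0 * `|enorm (z.1 - z.2)| `^ s) 0.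
  rewrite /= => /(_ _ _ x y cx cy); rewrite (ger0_norm (enorm_ge0 _)) subr_le0; apply.
  + move=> a b; apply: cvgB.
      apply: (@cvg_comp _ _ _ (fun z : 'rV[R]_n * 'rV[R]_n => v z.1 - v z.2)
        (fun t : R => `|t|) _ (nbhs (v a - v b))); last exact: (@norm_continuous R R^o).
      apply: (@cvgB _ R^o).
        apply: (@cvg_comp _ _ _ (fun z : 'rV[R]_n * 'rV[R]_n => z.1) v _ (nbhs a)).
          exact: cvg_fst.
        exact: cv.
      apply: (@cvg_comp _ _ _ (fun z : 'rV[R]_n * 'rV[R]_n => z.2) v _ (nbhs b)).
        exact: cvg_snd.
      exact: cv.
    apply: cvgMr; apply: (@cvg_comp _ _ _ (fun z : 'rV[R]_n * 'rV[R]_n => enorm (z.1 - z.2))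
      (fun t : R => `|t| `^ s) _ (nbhs (enorm (a - b)))).
      exact: cvg_enormB.
    exact: continuous_normr_powR.
  + move=> a b Oa Ob; rewrite (ger0_norm (enorm_ge0 _)) subr_le0.
    apply/ler_addgt0Pr => e e0; have es0 : 0 <= enorm (a - b) `^ s by exact: powR_ge0.
    (* The excess d over L0 is chosen so that d times the s-th power of the distance is at most e;
       the + 1 avoids a division by zero. *)
    have d0 : 0 < e / (enorm (a - b) `^ s + 1) by rewrite divr_gt0// ltr_wpDl.
    set d := e / _ in d0.
    have Ld : L0 < L0 + d by rewrite ltrDl.
    have L0d : 0 <= L0 + d by rewrite addr_ge0 ?(ltW d0).
    have en : \forall j \near \oo, (\int[mu]_(x in Omega) \int[mu]_(y in Omega)
        (dquot s (q j) (w j) (x, y))%:E <= ((L0 + d) `^ q j)%:E)%E.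
      have := near_oo_sub hkJ (gM _ Ld); apply: filterS => j; apply: le_trans.
      have [a1 _ _] := JP (k j + J)%N (leq_addl _ _).
      have pne : p_ (k j + J)%N != 0 by rewrite gt_eqF// (lt_trans _ a1).
      rewrite (ae_eq_gagliardo mO (mu_ _) (mf (k j)) (fu (k j))).
      by rewrite gagliardo_powE.
    have := limit_holder oO bO s0 L0d qj cw cv wvO en Oa Ob.
    move=> /le_trans; apply; rewrite mulrDl lerD2l /d mulrAC ler_pdivrMr ?ltr_wpDl//.
    by rewrite ler_wpM2l ?(ltW e0)// lerDl.
have vle x : Omega x -> `|v x| <= 1.
  exact: (limit_norm_le1 oO bO qj cw cv wvO wn).
split.
- move=> x cx; have := @closure_le2 (fun z => `|v z.1|) 1.
  apply; [move=> a b| |exact: cx|exact: cx]; last by move=> a b Oa _; exact: vle.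
  apply: (@cvg_comp _ _ _ (fun z : 'rV[R]_n * 'rV[R]_n => v z.1)
        (fun t : R => `|t|) _ (nbhs (v a))); last exact: (@norm_continuous R R^o).
  apply: (@cvg_comp _ _ _ (fun z : 'rV[R]_n * 'rV[R]_n => z.1) v _ (nbhs a)).
    exact: cvg_fst.
  exact: cv.
- move=> b b1; have b0 : 0 <= Num.max b 0 by rewrite le_max lexx orbT.
  have b2 : Num.max b 0 < 1 by rewrite gt_max b1 ltr01.
  have [x Ox xb] := limit_sup_gt oO bO neO qj cw cv wvO wn wm b0 b2.
  by exists x => //; apply: le_lt_trans xb; rewrite le_max lexx.
- move=> b b1; have b0 : 0 <= Num.max b 0 by rewrite le_max lexx orbT.
  have b2 : Num.max b 0 < 1 by rewrite gt_max b1 ltr01.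
  have cNw j : continuous (fun x => - w j x) by move=> x; apply: (@continuousN R R^o); exact: cw.
  have cNv : continuous (fun x => - v x) by move=> x; apply: (@continuousN R R^o); exact: cv.
  (* Values near - 1 are values of - v near 1. The change of sign preserves the normalization and,
     [spow] being odd, the vanishing mean. *)
  have [|||x Ox xb] := limit_sup_gt oO bO neO qj cNw cNv _ _ _ b0 b2.
  + move=> e /wvO; apply: filterS => j + x Ox => /(_ x Ox).
    by rewrite -opprD normrN.
  + apply: filterS wn => j <-; apply: eq_integral => x _; by rewrite normrN.
  + have q1 : \forall j \near \oo, 1 < q j by exact: (@near_seq_gt1 _ _ qj).
    near=> j; have q1j : 1 < q j by near: j.
    have wnj : (\int[mu]_(x in Omega) (`|w j x| `^ q j)%:E = 1)%E by near: j.
    have wmj : (\int[mu]_(x in Omega) (spow (q j) (w j x))%:E = 0)%E by near: j.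
    have I := integrable_spow mO q1j domain_finite (mf (k j)).
    transitivity (\int[mu]_(x in Omega) ((-1)%:E * (spow (q j) (w j x))%:E))%E.
      by apply: eq_integral => x _; rewrite spowN EFinN EFinN mulN1e.
    by rewrite integralZl ?wmj ?mule0//; apply: I; rewrite wnj ltry.
  exists x => //; rewrite ltrNr; apply: le_lt_trans xb; by rewrite le_max lexx.
Unshelve. all: by end_near. Qed.

End compactness.

(** * Asymptotics of the eigenvalues *)

Section mean_zero_shift.
Context (R : realType) (n : nat) (Omega : set 'rV[R]_n).
Local Notation mu := (@lebesgue_rV R n).
Hypotheses (mO : measurable Omega) (Ofin : (mu Omega < +oo)%E).

Lemma normr_spow_le (p B t : R) : 1 < p -> `|t| <= B -> `|spow p t| <= B `^ (p - 1).
Proof.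
move=> p1 tB; rewrite normr_spow//; apply: ge0_ler_powR; rewrite ?nnegrE//.
  by rewrite subr_ge0 ltW.
exact: le_trans tB.
Qed.

(** Intermediate values for the integral of [spow p (u x - c)] as a function of c: it is nonnegative
    at - B and nonpositive at B. Continuity is obtained by domination on a slightly larger open
    interval. *)
Lemma mean_zero_shift (p B : R) (u : 'rV[R]_n -> R) : 2 < p -> 0 <= B ->
  measurable_fun Omega u -> (forall x, Omega x -> `|u x| <= B) ->
  exists2 c, `|c| <= B & mean_p Omega p (fun x => u x - c) = 0%E.
Proof.
move=> p2 B0 mu_ uB; have p1 : 1 < p by lra.
pose F c := \int[mu]_(x in Omega) spow p (u x - c).
have mm c : measurable_fun Omega (fun x => spow p (u x - c)).
  by apply: measurable_spow; exact: measurable_funB.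
have bd c x : `](- B - 1), (B + 1)[%classic c -> Omega x ->
    `|spow p (u x - c)| <= (2 * B + 1) `^ (p - 1).
  rewrite /= in_itv/= => /andP[c1 c2] Ox; apply: normr_spow_le => //.
  by have := uB x Ox; rewrite !ler_norml => /andP[u1 u2]; apply/andP; split; lra.
have int c : `](- B - 1), (B + 1)[%classic c -> mu.-integrable Omega (EFin \o (fun x => spow p (u x - c))).
  by move=> cI; apply: bounded_integrable => // x Ox; exact: bd cI Ox.
have cF : {in `](- B - 1), (B + 1)[%classic, continuous F}.
  apply: (@continuity_under_integral R _ _ mu (fun c x => spow p (u x - c)) Omega mO _ _
    int _ (fun=> (2 * B + 1) `^ (p - 1))).
  - apply: aeW => y _ c _; apply: (@continuous_comp _ _ _ (fun c => u y - c) (spow p)).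
      by apply: cvgB; [exact: cvg_cst|exact: cvg_id].
    exact: continuous_spow.
  - by apply: (@bounded_integrable _ _ _ _ _ _ ((2 * B + 1) `^ (p - 1))) => // x _; rewrite ger0_norm ?powR_ge0.
  - by move=> c cI; apply: aeW => y Oy; exact: bd cI Oy.
have NB : - B <= B by lra.
have cF' : {within `[(- B), B], continuous F}.
  apply: continuous_in_subspaceT => c cI; apply: cF; move: cI.
  by rewrite !inE/= !in_itv/= => /andP[c1 c2]; apply/andP; split; lra.
have [|c cI Fc] := @IVT R F (- B) B 0 NB cF'.
- have FN : 0 <= F (- B).
    apply: Rintegral_ge0 => x Ox; apply: spow_ge0.
    by have := uB x Ox; rewrite ler_norml => /andP[u1 u2]; lra.
  have FP : F B <= 0.
    have : 0 <= \int[mu]_(x in Omega) (- spow p (u x - B)).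
      apply: Rintegral_ge0 => x Ox; rewrite -spowN; apply: spow_ge0.
      by have := uB x Ox; rewrite ler_norml => /andP[u1 u2]; lra.
    have BI : `](- B - 1), (B + 1)[%classic B by rewrite /= in_itv/=; apply/andP; split; lra.
    have -> : \int[mu]_(x in Omega) (- spow p (u x - B)) = - F B.
      rewrite -[RHS]mulN1r /F -RintegralZl//; last exact: int.
      by apply: eq_Rintegral => x _; rewrite mulN1r.
    by rewrite oppr_ge0.
  by rewrite ge_min le_max FN FP orbT.
move: cI; rewrite in_itv/= -ler_norml => cB; exists c => //.
have cI : `](- B - 1), (B + 1)[%classic c.
  by move: cB; rewrite ler_norml /= in_itv/= => /andP[? ?]; apply/andP; split; lra.
rewrite mean_pE -[LHS]fineK; first by rewrite -[fine _]/(F c) Fc.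
exact: integrable_fin_num (int c cI).
Qed.

End mean_zero_shift.

Section product_bound.
Context (R : realType) (n : nat) (Omega : set 'rV[R]_n).
Local Notation mu := (@lebesgue_rV R n).
Hypotheses (mO : measurable Omega).

Lemma iterated_integral_le_cst (F : 'rV[R]_n * 'rV[R]_n -> R) c :
  measurable_fun setT F -> (forall z, 0 <= F z) ->
  (forall x y, Omega x -> Omega y -> F (x, y) <= c) -> 0 <= c ->
  (\int[mu]_(x in Omega) \int[mu]_(y in Omega) (F (x, y))%:E <= c%:E * (mu Omega * mu Omega))%E.
Proof.
move=> mF F0 Fc c0; rewrite iterated_integralE//.
rewrite -product_measure1E// -integral_cst; last exact: measurableX.
apply: ge0_le_integral => //.
- exact: measurableX.
- by move=> z _; rewrite lee_fin.
- by apply: measurable_funTS; apply/measurable_EFinP.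
- by move=> [x y] [/= Ox Oy]; rewrite lee_fin Fc.
Qed.

End product_bound.

Section lambda1_limit.
Context (R : realType) (n : nat) (Omega : set 'rV[R]_n) (s : R).
Local Notation mu := (@lebesgue_rV R n).
Hypotheses (n_gt0 : (0 < n)%N) (dom : smooth_bounded_domain Omega) (s0 : 0 < s) (s1 : s < 1).

Let oO : open Omega. Proof. by case: dom. Qed.
Let bO : bounded_set Omega. Proof. by case: dom. Qed.
Let neO : Omega !=set0. Proof. by case: dom. Qed.
Let mO : measurable Omega. Proof. exact: domain_measurable dom. Qed.
Let Ofin : (mu Omega < +oo)%E. Proof. exact: domain_finite dom. Qed.
Let D := diam Omega.
Let D0 : 0 < D. Proof. exact: diam_gt0. Qed.
Let V := fine (mu Omega).
Let VE : mu Omega = V%:E. Proof. exact: (volE oO bO mO (@subset_refl _ _)). Qed.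

Let Lam := 2 / D `^ s.

Lemma Lam_gt0 : 0 < Lam. Proof. by rewrite divr_gt0// powR_gt0. Qed.

(** This is t / D <= (t / D)^s, times 2: on Omega a Lipschitz constant 2 / D gives the Hoelder
    constant Lam. *)
Lemma lipschitz_holder_D (t : R) : 0 <= t -> t <= D -> 2 / D * t <= Lam * t `^ s.
Proof.
move=> t0 tD; have [->|tn0] := eqVneq t 0.
  by rewrite mulr0 powR0 ?gt_eqF// mulr0.
have tp : 0 < t by rewrite lt_neqAle eq_sym tn0.
have splitE (x : R) : 0 < x -> x = x `^ s * x `^ (1 - s).
  move=> x0; rewrite -powRD ?subrKC ?powRr1 ?(ltW x0)//.
  by apply/implyP => _; rewrite gt_eqF.
have -> : Lam * t `^ s = 2 / D * (t `^ s * D `^ (1 - s)).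
  have gen (A B T : R) : A != 0 -> B != 0 -> 2 / A * T = 2 / (A * B) * (T * B).
    by move=> A0 B0; field; rewrite A0 B0.
  rewrite /Lam (gen _ (D `^ (1 - s))) -?splitE//; by rewrite gt_eqF// powR_gt0.
rewrite {1}(splitE _ tp) !ler_wpM2l ?divr_ge0 ?powR_ge0 ?(ltW D0)//.
by apply: ge0_ler_powR; rewrite ?nnegrE ?subr_ge0 ?(ltW tp) ?(ltW D0) ?(ltW s1).
Qed.

(* The affine rescaling of the distance to one end of a diameter. *)
Lemma exists_cone : exists u0 : 'rV[R]_n -> R, [/\ continuous u0,
    forall x, closure Omega x -> `|u0 x| <= 1,
    forall x y, `|u0 x - u0 y| <= 2 / D * enorm (x - y),
    exists2 x, closure Omega x & u0 x = 1 &
    exists2 x, closure Omega x & u0 x = - 1].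
Proof.
have [x1 [x2 [c1 c2 e12]]] := diam_attained bO neO.
have lip x y : `|(2 / D * enorm (x - x1) - 1) - (2 / D * enorm (y - x1) - 1)| <=
    2 / D * enorm (x - y).
  rewrite opprB addrA subrK -mulrBr normrM ger0_norm ?divr_ge0 ?(ltW D0)//.
  rewrite ler_wpM2l ?divr_ge0 ?(ltW D0)//.
  have := enorm_dist (x - x1) (y - x1).
  by rewrite opprB addrA subrK.
exists (fun x => 2 / D * enorm (x - x1) - 1); split => //.
- move=> x; apply: (@cvgB R R^o _ (nbhs x) _ (fun z => 2 / D * enorm (z - x1)) (fun=> 1));
    last exact: cvg_cst.
  apply: cvgMr; exact: continuous_enorm_sub.
- move=> x cx; have := enorm_le_diam bO cx c1; rewrite -/D => eD.
  have e0 := enorm_ge0 (x - x1).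
  have h1 : 2 / D * enorm (x - x1) <= 2.
    by rewrite mulrAC ler_pdivrMr// ler_wpM2l.
  have h2 : 0 <= 2 / D * enorm (x - x1) by rewrite mulr_ge0// divr_ge0// ltW.
  by rewrite ler_norml; apply/andP; split; lra.
- exists x2 => //; rewrite enorm_subC e12 -/D divfK ?gt_eqF//; lra.
- by exists x1 => //; rewrite subrr enorm0 mulr0 sub0r.
Qed.

Lemma closure_near_sub (f : 'rV[R]_n -> R) x (a : R) : continuous f -> closure Omega x ->
  a < f x -> exists A, [/\ measurable A, A `<=` Omega, (0 < mu A)%E & forall y, A y -> a < f y].
Proof.
move=> cf cx ax.
have nx : \forall y \near x, a < f y by exact: (@cvgr_gt _ _ (nbhs x) _ _ _ (cf x) a).
have [x' [Ox' ax']] := cx _ nx.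
have nx' : \forall y \near x', a < f y by exact: (@cvgr_gt _ _ (nbhs x') _ _ _ (cf x') a).
by have [A [mA AO _ A0 Af]] := near_ball_sub oO Ox' nx'; exists A.
Qed.

(** The integrand is at most (2 / D)^p t^(p - n - s p) at distance t. The exponent is nonnegative,
    so the worst case is t = D, where the value is Lam^p D^(-n). *)
Lemma cone_energy (p : R) (u0 : 'rV[R]_n -> R) : 1 < p -> n%:R <= p * (1 - s) ->
  continuous u0 -> (forall x y, `|u0 x - u0 y| <= 2 / D * enorm (x - y)) ->
  (\int[mu]_(x in Omega) \int[mu]_(y in Omega) (dquot s p u0 (x, y))%:E <=
    (Lam `^ p * D `^ (- n%:R) * (V * V))%:E)%E.
Proof.
move=> p1 pn cu lip; have p0 : 0 < p by lra.
rewrite EFinM (EFinM V V) -!VE; apply: iterated_integral_le_cst => //.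
- by apply: measurable_dquot; exact: continuous_measurable_rV.
- by move=> z; exact: dquot_ge0.
- move=> x y Ox Oy; rewrite /dquot/=.
  have [->|xny] := eqVneq x y.
    by rewrite subrr normr0 powR0 ?gt_eqF// mul0r mulr_ge0 ?powR_ge0.
  have e0 : 0 < enorm (x - y) by rewrite enorm_gt0 subr_eq0.
  have eD : enorm (x - y) <= D by apply: enorm_le_diam => //; exact: subset_closure.
  rewrite ler_pdivrMr ?powR_gt0//.
  have D2 : 0 <= 2 / D by rewrite divr_ge0 ?(ltW D0).
  apply: (@le_trans _ _ ((2 / D * enorm (x - y)) `^ p)).
    by apply: ge0_ler_powR; rewrite ?nnegrE ?(ltW p0)// mulr_ge0// ltW.
  rewrite (powRM _ D2 (ltW e0)).
  have expE (t : R) : 0 < t -> t `^ p = t `^ (p - n%:R - s * p) * t `^ (n%:R + s * p).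
    move=> t0; rewrite -powRD; last by apply/implyP => _; rewrite gt_eqF.
    by congr powR; lra.
  rewrite (expE _ e0) mulrA ler_wpM2r ?powR_ge0//.
  have -> : Lam `^ p * D `^ (- n%:R) = (2 / D) `^ p * D `^ (p - n%:R - s * p).
    have Dn t : (D == 0) && t = false by rewrite gt_eqF.
    rewrite /Lam !powRM ?invr_ge0 ?powR_ge0 ?(ltW D0)// -!mulrA; congr (_ * _).
    rewrite -(powRN D s) -(powR_inv1 (ltW D0)) -!powRrM -!powRD;
      try by apply/implyP => _; rewrite gt_eqF.
    by congr powR; lra.
  rewrite ler_wpM2l ?powR_ge0//; apply: ge0_ler_powR; rewrite ?nnegrE ?(ltW e0) ?(ltW D0)//.
  by move: pn; lra.
- by rewrite mulr_ge0 ?powR_ge0.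
Qed.

Lemma gagliardo_shift p (u : 'rV[R]_n -> R) c :
  gagliardo Omega s p (fun x => u x - c) = gagliardo Omega s p u.
Proof.
rewrite /gagliardo; apply: (f_equal (fun t : \bar R => poweR t (GRing.inv p))).
apply: eq_integral => x _; apply: eq_integral => y _.
by rewrite opprB addrA subrK.
Qed.

Lemma lambda1_le (p : R) (x y : R) u : 1 < p -> Wsp Omega s p u ->
  mean_p Omega p u = 0%E -> 0 < y ->
  (gagliardo Omega s p u `^ p <= x%:E)%E -> (y%:E <= Lp_norm Omega p%:E u `^ p)%E ->
  (lambda1 Omega s p <= (x / y)%:E)%E.
Proof.
move=> p1 Wu mu0 y0 gx yL; have p0 : p != 0 by lra.
have Lfin : (Lp_norm Omega p%:E u `^ p)%E \is a fin_num.
  by rewrite ge0_fin_numE ?poweR_ge0//; case: Wu => _ /poweR_lty.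
have gfin : (gagliardo Omega s p u `^ p)%E \is a fin_num.
  by rewrite ge0_fin_numE ?poweR_ge0//; apply: le_lt_trans gx (ltry _).
apply: (@le_trans _ _ (gagliardo Omega s p u `^ p / Lp_norm Omega p%:E u `^ p)%E).
  apply: ereal_inf_lbound; exists u => //; split => // u0.
  have : (Lp_norm Omega p%:E u `^ p = 0)%E.
    rewrite Lp_norm_powE//; case: Wu => mu_ _ _.
    transitivity (\int[mu]_(x in Omega) (cst 0%E : _ -> \bar R) x)%E; last exact: integral0.
    apply: ge0_ae_eq_integral => //.
    - by apply/measurable_EFinP; exact: measurable_pow_norm.
    - by apply: filterS u0 => z + Oz => /(_ Oz) ->; rewrite normr0 powR0.
  by move=> L0; move: yL; rewrite L0 lee_fin leNgt y0.
rewrite -(fineK gfin) in gx *; rewrite -(fineK Lfin) in yL *.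
rewrite lee_fin in gx; rewrite lee_fin in yL.
rewrite inver gt_eqF ?(lt_le_trans y0 yL)// -EFinM lee_fin.
have fg0 : 0 <= fine (gagliardo Omega s p u `^ p)%E by rewrite fine_ge0// poweR_ge0.
apply: ler_pM => //; first by rewrite invr_ge0 (le_trans (ltW y0) yL).
by rewrite lef_pV2 ?posrE// (lt_le_trans y0 yL).
Qed.

(** The competitor is the cone shifted to vanishing mean. The shift is unknown, but whatever its
    sign it moves the values away from zero near one of the two ends of the diameter; there |u| >=
    d, with d < 1 prescribed, on a set whose measure is at least m for every p. *)
Lemma lambda1_upper b : Lam < b -> \forall p \near +oo, (lambda1 Omega s p <= (b `^ p)%:E)%E.
Proof.
move=> Lb; have L0 := Lam_gt0; have b0 : 0 < b by exact: lt_trans Lb.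
have [u0 [cu0 u01 lip [xp cxp upE] [xm cxm umE]]] := exists_cone.
(* Midway between Lam / b and 1, so that the rate Lam of the energy stays below the rate b d of b^p
   times the norm. *)
pose d := (Lam / b + 1) / 2.
have r1 : Lam / b < 1 by rewrite ltr_pdivrMr// mul1r.
have r0 : 0 < Lam / b by rewrite divr_gt0.
have d0 : 0 < d by rewrite /d; lra.
have d1 : d < 1 by rewrite /d; lra.
have Lbd : Lam < b * d by rewrite mulrC -ltr_pdivrMr// /d; lra.
have du0p : d < u0 xp by rewrite upE.
have du0m : d < - u0 xm by rewrite umE opprK.
have [A1 [mA1 A1O A10 A1u]] := @closure_near_sub u0 xp d cu0 cxp du0p.
have cNu : continuous (fun x => - u0 x) by move=> x; apply: (@continuousN R R^o); exact: cu0.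
have [A2 [mA2 A2O A20 A2u]] := @closure_near_sub (fun x => - u0 x) xm d cNu cxm du0m.
pose m := Num.min (fine (mu A1)) (fine (mu A2)).
have m0 : 0 < m by rewrite lt_min (vol_gt0 oO bO mA1)// (vol_gt0 oO bO mA2).
have dmn := near_powR_dominated (D `^ (- n%:R) * (V * V)) (ltW L0) Lbd m0.
near=> p.
have p2 : 2 < p by near: p; apply: nbhs_pinfty_gt; exact: num_real.
have p1 : 1 < p by apply: lt_trans p2; rewrite ltr1n.
have p0 : 0 < p by apply: lt_trans p1.
have pne : p != 0 by rewrite gt_eqF.
have pn : n%:R <= p * (1 - s).
  near: p; exists (n%:R / (1 - s)); split; first exact: num_real.
  by move=> p /ltW; rewrite ler_pdivrMr ?subr_gt0.
have dm : D `^ (- n%:R) * (V * V) * Lam `^ p < m * (b * d) `^ p by near: p.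
have mu0 : measurable_fun Omega u0 by apply: measurable_funTS; exact: continuous_measurable_rV.
have [c c1 mean0] := mean_zero_shift mO Ofin p2 ler01 mu0
  (fun x Ox => u01 x (subset_closure Ox)).
pose u x := u0 x - c.
have muu : measurable_fun Omega u by exact: measurable_funB.
have gu : (gagliardo Omega s p u `^ p <= (Lam `^ p * D `^ (- n%:R) * (V * V))%:E)%E.
  by rewrite gagliardo_shift gagliardo_powE//; exact: cone_energy.
have LpE := Lp_norm_powE Omega u pne.
have Lfin : (Lp_norm Omega p%:E u `^ p < +oo)%E.
  rewrite LpE; apply: (@le_lt_trans _ _ ((2 `^ p)%:E * mu Omega)%E).
    apply: integral_le_cst => //; first exact: measurable_pow_norm.
    move=> x Ox; apply: ge0_ler_powR; rewrite ?nnegrE ?(ltW p0)//.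
    apply: le_trans (ler_normB _ _) _; rewrite [leRHS](_ : _ = 1 + 1); last by ring.
    by apply: lerD => //; apply: u01; exact: subset_closure.
  by rewrite VE -EFinM ltry.
have low : ((d `^ p * m)%:E <= Lp_norm Omega p%:E u `^ p)%E.
  rewrite LpE.
  have half (A : set 'rV[R]_n) : measurable A -> A `<=` Omega -> m <= fine (mu A) ->
      (forall x, A x -> d <= `|u x|) ->
      ((d `^ p * m)%:E <= \int[mu]_(x in Omega) (`|u x| `^ p)%:E)%E.
    move=> mA AO mle dA; apply: (@le_trans _ _ ((d `^ p)%:E * mu A)%E).
      by rewrite (volE oO bO mA AO) -EFinM lee_fin ler_wpM2l ?powR_ge0.
    apply: integral_ge_sub => //; [exact: measurable_pow_norm|exact: powR_ge0|].
    by move=> x Ax; apply: ge0_ler_powR; rewrite ?nnegrE ?(ltW p0) ?(ltW d0)// dA.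
  have [c0|c0] := leP 0 c.
    apply: (half A2) => //; first by rewrite ge_min lexx orbT.
    move=> x Ax; rewrite -normrN; apply: le_trans (ler_norm _).
    by rewrite /u opprB; apply: le_trans (ltW (A2u x Ax)) _; rewrite lerDr.
  apply: (half A1) => //; first by rewrite ge_min lexx.
  move=> x Ax; apply: le_trans (ler_norm _); rewrite /u.
  by apply: le_trans (ltW (A1u x Ax)) _; rewrite lerBrDr gerDl ltW.
have y0 : 0 < d `^ p * m by rewrite mulr_gt0// powR_gt0.
have Wu : Wsp Omega s p u.
  split => //; first exact: lty_poweRy Lfin.
  by apply: (lty_poweRy pne); apply: le_lt_trans gu (ltry _).
apply: le_trans (lambda1_le p1 Wu mean0 y0 gu low) _.
rewrite lee_fin ler_pdivrMr//; move: dm; rewrite (powRM _ (ltW b0) (ltW d0)) => /ltW dm.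
rewrite [leLHS](_ : _ = D `^ (- n%:R) * (V * V) * Lam `^ p); last by ring.
by apply: le_trans dm _; rewrite mulrCA [m * _]mulrC.
Unshelve. all: by end_near. Qed.

Lemma normalize (p : R) u : 1 < p -> Wsp Omega s p u -> nonzero Omega u ->
  mean_p Omega p u = 0%E -> exists w, [/\ measurable_fun Omega w,
    Lp_norm Omega p%:E w = 1%E, mean_p Omega p w = 0%E &
    (gagliardo Omega s p w `^ p = gagliardo Omega s p u `^ p / Lp_norm Omega p%:E u `^ p)%E].
Proof.
move=> p1 [mu_ Lu gu] nz mean0; have p0 : 0 < p by lra.
have pne : p != 0 by rewrite gt_eqF.
have LpE := Lp_norm_powE Omega u pne.
have Lfin : (\int[mu]_(x in Omega) (`|u x| `^ p)%:E < +oo)%E.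
  by rewrite -LpE poweR_lty.
have I0 : (0 <= \int[mu]_(x in Omega) (`|u x| `^ p)%:E)%E.
  by apply: integral_ge0 => x _; rewrite lee_fin powR_ge0.
set I := (\int[mu]_(x in Omega) _)%E in LpE Lfin I0.
have If : I \is a fin_num by rewrite ge0_fin_numE.
have Ipos : 0 < fine I.
  rewrite lt_neqAle fine_ge0// andbT eq_sym; apply/eqP => I00; apply: nz.
  have Iz : I = 0%E by rewrite -(fineK If) I00.
  have mE : measurable_fun Omega (fun x => (`|u x| `^ p)%:E).
    by apply/measurable_EFinP; exact: measurable_pow_norm.
  have : (\int[mu]_(x in Omega) `|(`|u x| `^ p)%:E| = 0)%E.
    by rewrite -Iz; apply: eq_integral => x _; rewrite gee0_abs// lee_fin powR_ge0.
  move=> /(ae_eq_integral_abs mu mO mE); apply: filterS => x + Ox => /(_ Ox) [].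
  by move=> /powR_eq0_eq0/normr0_eq0.
pose c := (fine I) `^ (- p^-1).
have c0 : 0 < c by exact: powR_gt0.
have cp : c `^ p = (fine I)^-1 by rewrite /c -powRrM mulNr mulVf// powR_inv1 ?(ltW Ipos).
exists (fun x => c * u x); split.
- exact: measurable_funM.
- rewrite Lp_normE// Lp_norm_pow_scale// -/I (gtr0_norm c0) cp -(fineK If) -EFinM.
  by rewrite mulVf ?gt_eqF// poweR1r.
- by rewrite mean_p_scale// mean0 mule0.
- have -> : ((Lp_norm Omega p%:E u `^ p)^-1 = ((fine I)^-1)%:E)%E.
    by rewrite LpE -{1}(fineK If) inver gt_eqF.
  rewrite [LHS](gagliardo_pow_scale mO s c pne mu_) (gtr0_norm c0) cp.
  exact: muleC.
Qed.

(** Competitors of quotient below a^p along a sequence p -> oo would have a limit with Hoelder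
    constant a, hence oscillation at most a D^s < 2, although its values approach 1 and - 1. *)
Lemma lambda1_lower a : 0 <= a -> a < Lam ->
  \forall p \near +oo, ((a `^ p)%:E <= lambda1 Omega s p)%E.
Proof.
move=> a0 aL; apply: contrapT => no.
have seq j : exists p, j%:R < p /\ 1 < p /\ (lambda1 Omega s p < (a `^ p)%:E)%E.
  apply: contrapT => nop; apply: no; exists (Num.max j%:R 1); split; first exact: num_real.
  move=> p; rewrite gt_max => /andP[jp p1]; rewrite leNgt; apply/negP => h.
  by apply: nop; exists p.
pose p_ j := projT1 (cid (seq j)).
have pP j : j%:R < p_ j /\ 1 < p_ j /\ (lambda1 Omega s (p_ j) < (a `^ p_ j)%:E)%E.
  by rewrite /p_; case: cid.
have pj : p_ @ \oo --> +oo.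
  move=> P [M [_ MP]]; exists (Num.trunc `|M|).+1 => // j /= Mj; apply: MP.
  apply: le_lt_trans (ler_norm _) _; apply: lt_trans (pP j).1.
  apply: lt_le_trans (_ : (Num.trunc `|M|).+1%:R <= _); last by rewrite ler_nat.
  exact: truncnS_gt.
have ex j : exists w, [/\ measurable_fun Omega w, Lp_norm Omega (p_ j)%:E w = 1%E,
    mean_p Omega (p_ j) w = 0%E & (gagliardo Omega s (p_ j) w `^ p_ j <= (a `^ p_ j)%:E)%E].
  have [_ [p1 /ereal_inf_lt[_ [u [Wu nz m0] <-] lt]]] := pP j.
  have [w [mw w1 w0 wg]] := normalize p1 Wu nz m0.
  by exists w; split => //; rewrite wg ltW.
pose u j := projT1 (cid (ex j)).
have uP j : [/\ measurable_fun Omega (u j), Lp_norm Omega (p_ j)%:E (u j) = 1%E,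
    mean_p Omega (p_ j) (u j) = 0%E & (gagliardo Omega s (p_ j) (u j) `^ p_ j <= (a `^ p_ j)%:E)%E].
  by rewrite /u; case: cid.
have [||||k [_ [w [v [_ _ _ vH [_ vp vm]]]]]] :=
  @fractional_compactness R n Omega s dom s0 s1 a p_ u a0 pj.
- by move=> j; case: (uP j).
- by move=> j; case: (uP j).
- by move=> j; case: (uP j).
- move=> M aM; apply: nearW => j; have [_ _ _ /le_trans] := uP j; apply.
  rewrite lee_fin; apply: ge0_ler_powR; rewrite ?nnegrE ?(ltW aM) ?(le_trans a0 (ltW aM))//.
  by have [_ [p1 _]] := pP j; rewrite ltW// (lt_trans _ p1).
have aD : a * D `^ s < 2 by rewrite -ltr_pdivlMr ?powR_gt0.
(* Chosen so that b < 1 and yet 2 b > a D^s. *)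
pose b := (2 + a * D `^ s) / 4.
have b1 : b < 1 by rewrite /b; lra.
have [x Ox xb] := vp b b1; have [y Oy yb] := vm b b1.
have cx := subset_closure Ox; have cy := subset_closure Oy.
have := le_trans (ler_norm _) (vH x y cx cy).
have : a * enorm (x - y) `^ s <= a * D `^ s.
  rewrite ler_wpM2l//; apply: ge0_ler_powR; rewrite ?nnegrE ?enorm_ge0 ?(ltW s0) ?(ltW D0)//.
  exact: enorm_le_diam.
have b2 : a * D `^ s < b + b by rewrite /b; lra.
move=> h1 h2; have := le_trans h2 h1.
apply/negP; rewrite -ltNge; apply: lt_trans b2 _.
by apply: ltrD => //; rewrite ltrNr.
Qed.

Lemma lambda1_ge0 p : (0 <= lambda1 Omega s p)%E.
Proof.
apply: le_ereal_inf_tmp => _ [u [_ nz _] <-]; apply: mule_ge0; first exact: poweR_ge0.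
by rewrite inve_ge0 poweR_ge0.
Qed.

Lemma lambda1_root_cvg : (lambda1 Omega s p `^ p^-1)%E @[p --> +oo] --> Lam%:E.
Proof.
have L0 := Lam_gt0.
(* The lower bound is clipped at 0 because [lambda1_lower] asks for a nonnegative base. *)
have bounds e : 0 < e -> \forall p \near +oo,
    (((Num.max 0 (Lam - e))%:E <= lambda1 Omega s p `^ p^-1) &&
     (lambda1 Omega s p `^ p^-1 <= (Lam + e)%:E))%E.
  move=> e0; have Le : Lam < Lam + e by rewrite ltrDl.
  have m0 : 0 <= Num.max 0 (Lam - e) by rewrite le_max lexx.
  have mL : Num.max 0 (Lam - e) < Lam by rewrite gt_max L0 gtrBl.
  near=> p.
  have p0 : 0 < p by near: p; exact: nbhs_pinfty_gt.
  have root t : 0 <= t -> ((t `^ p)%:E `^ p^-1 = t%:E)%E.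
    by move=> t0; rewrite poweR_EFin -powRrM mulfV ?gt_eqF// powRr1.
  have ip0 : 0 <= p^-1 by rewrite invr_ge0 ltW.
  have mono (x y : \bar R) : (0 <= x -> x <= y -> x `^ p^-1 <= y `^ p^-1)%E.
    move=> x0 xy; apply: gt0_ler_poweR => //; rewrite in_itv/= leey andbT//.
    exact: le_trans xy.
  have lo : (((Num.max 0 (Lam - e)) `^ p)%:E <= lambda1 Omega s p)%E.
    by near: p; exact: lambda1_lower.
  have up : (lambda1 Omega s p <= ((Lam + e) `^ p)%:E)%E by near: p; exact: lambda1_upper.
  apply/andP; split.
    by rewrite -[leLHS]root// mono// lee_fin powR_ge0.
  by rewrite -[leRHS]root ?mono ?lambda1_ge0// addr_ge0 ?ltW.
apply/fine_cvgP; split.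
  apply: filterS (bounds 1 ltr01) => p /andP[_ h].
  by rewrite ge0_fin_numE ?poweR_ge0//; apply: le_lt_trans h (ltry _).
apply/cvgrPdist_le => e e0; apply: filterS (bounds e e0) => p /andP[h1 h2] /=.
have fp : (lambda1 Omega s p `^ p^-1)%E \is a fin_num.
  by rewrite ge0_fin_numE ?poweR_ge0//; apply: le_lt_trans h2 (ltry _).
rewrite -(fineK fp) lee_fin in h1; rewrite -(fineK fp) lee_fin in h2.
rewrite ler_distlC; apply/andP; split; last by [].
by apply: le_trans h1; rewrite le_max lexx orbT.
Unshelve. all: by end_near. Qed.

End lambda1_limit.

(** * The limiting eigenvalue *)

Section sup_norms.
Context (R : realType) (n : nat) (Omega : set 'rV[R]_n).
Local Notation mu := (@lebesgue_rV R n).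
Hypotheses (oO : open Omega) (bO : bounded_set Omega) (neO : Omega !=set0).

Let mO : measurable Omega. Proof. exact: measurable_open_rV. Qed.
Let Ogt0 : (0 < mu Omega)%E. Proof. exact: lebesgue_rV_open_gt0. Qed.

Lemma C0_closure_at (u : 'rV[R]_n -> R) x : C0_closure Omega u -> Omega x ->
  {for x, continuous u}.
Proof.
move=> cu Ox; have := continuous_subspaceW (@subset_closure _ Omega) cu.
by rewrite continuous_open_subspace// => /(_ x (mem_set Ox)).
Qed.

Lemma C0_closure_bounded (u : 'rV[R]_n -> R) : C0_closure Omega u ->
  exists2 B, 0 <= B & forall x, closure Omega x -> `|u x| <= B.
Proof.
move=> cu; have [x0 Ox0] := neO.
have cK := compact_closure_bounded bO.
have K0 : closure Omega !=set0 by exists x0; exact: subset_closure.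
have [x /set_mem cx xm] := @compact_EVT_max _ R u (closure Omega) K0 cK cu.
have cNu : {within closure Omega, continuous (fun x => - u x)}.
  by move=> y; apply: (@continuousN R R^o); exact: cu.
have [y /set_mem cy ym] := @compact_EVT_max _ R (fun x => - u x) (closure Omega) K0 cK cNu.
exists (Num.max `|u x| `|u y|); first by rewrite le_max normr_ge0.
move=> z cz; rewrite ler_norml; apply/andP; split.
  rewrite lerNl; apply: le_trans (ym z (mem_set cz)) _.
  by rewrite le_max; apply/orP; right; rewrite -normrN ler_norm.
apply: le_trans (xm z (mem_set cz)) _.
by rewrite le_max; apply/orP; left; rewrite ler_norm.
Qed.

(** Neighbourhoods have positive product measure; hence, for continuous functions, essential bounds
    over pairs of points of Omega hold at every pair. *)
Lemma near_pair_contra (P : set ('rV[R]_n * 'rV[R]_n)) x y : Omega x -> Omega y ->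
  {ae (mu \x mu)%E, forall z, (Omega `*` Omega) z -> ~ P z} ->
  (\forall z \near (x, y), P z) -> False.
Proof.
move=> Ox Oy [N [mN N0 NP]] [[A B] /= [Ax By] AB].
have [A' [mA A'O _ A'0 A'A]] := near_ball_sub oO Ox Ax.
have [B' [mB B'O _ B'0 B'B]] := near_ball_sub oO Oy By.
have AN : A' `*` B' `<=` N.
  move=> [a b] [/= A'a B'b]; apply: NP => /= h.
  apply: (h (conj (A'O _ A'a) (B'O _ B'b))); apply: AB; split => /=; [exact: A'A|exact: B'B].
have : ((mu \x mu) (A' `*` B') <= (mu \x mu) N)%E.
  by apply: le_measure => //; rewrite inE//; exact: measurableX.
rewrite N0 product_measure1E// leNgt => /negP; apply.
exact: mule_gt0.
Qed.

Lemma near_contra (P : set 'rV[R]_n) x : Omega x ->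
  {ae mu, forall z, Omega z -> ~ P z} -> (\forall z \near x, P z) -> False.
Proof.
move=> Ox ae /(near_ball_sub oO Ox)[A [mA AO _ A0 AP]].
by have [a Aa /(_ (AP a Aa))] := ae_exists ae mA AO A0.
Qed.

Lemma holder_seminorm_le (s H : R) (u : 'rV[R]_n -> R) : 0 < s -> 0 <= H ->
  (forall x y, Omega x -> Omega y -> `|u x - u y| <= H * enorm (x - y) `^ s) ->
  (holder_seminorm Omega s u <= H%:E)%E.
Proof.
move=> s0 H0 uH; rewrite /holder_seminorm unlock /Lnorm; case: ifP => _; last by rewrite lee_fin.
apply/ess_supP; apply: aeW => -[x y] /=; rewrite patchE.
case: ifPn => [/set_mem[/= Ox Oy]|_]; last by rewrite abse0 lee_fin.
rewrite lee_fin normrM normfV (ger0_norm (powR_ge0 _ _)).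
have [->|xny] := eqVneq x y; first by rewrite subrr normr0 mul0r.
by rewrite ler_pdivrMr ?uH// powR_gt0// enorm_gt0 subr_eq0.
Qed.

Lemma holder_seminorm_ge (s H : R) (u : 'rV[R]_n -> R) : 0 < s -> 0 <= H ->
  (forall x, Omega x -> {for x, continuous u}) ->
  (holder_seminorm Omega s u <= H%:E)%E ->
  forall x y, Omega x -> Omega y -> `|u x - u y| <= H * enorm (x - y) `^ s.
Proof.
move=> s0 H0 cu; rewrite /holder_seminorm unlock /Lnorm.
have mT : (0 < (mu \x mu) [set: 'rV[R]_n * 'rV[R]_n])%E.
  apply: (@lt_le_trans _ _ ((mu \x mu) (Omega `*` Omega))%E).
    by rewrite product_measure1E//; exact: mule_gt0.
  by apply: le_measure => //; rewrite inE//; exact: measurableX.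
rewrite mT => /ess_supP ae x y Ox Oy; rewrite leNgt; apply/negP => big.
pose P (z : 'rV[R]_n * 'rV[R]_n) := H * `|enorm (z.1 - z.2)| `^ s < `|u z.1 - u z.2|.
apply: (@near_pair_contra P x y Ox Oy).
  apply: filterS ae => -[a b] /= + [Oa Ob]; rewrite patchE mem_set//= lee_fin.
  rewrite normrM normfV (ger0_norm (powR_ge0 _ _)) /P/= (ger0_norm (enorm_ge0 _)).
  have [->|anb] := eqVneq a b.
    by rewrite !subrr enorm0 normr0 powR0 ?gt_eqF// mulr0 ltxx.
  rewrite ler_pdivrMr; last by rewrite powR_gt0// enorm_gt0 subr_eq0.
  by move=> le; apply/negP; rewrite -leNgt.
have cd : (fun z : 'rV[R]_n * 'rV[R]_n => `|u z.1 - u z.2| - H * `|enorm (z.1 - z.2)| `^ s) z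
    @[z --> (x, y)] --> `|u x - u y| - H * `|enorm (x - y)| `^ s.
  apply: cvgB.
    apply: (@cvg_comp _ _ _ (fun z : 'rV[R]_n * 'rV[R]_n => u z.1 - u z.2)
      (fun t : R => `|t|) _ (nbhs (u x - u y))); last exact: (@norm_continuous R R^o).
    apply: (@cvgB _ R^o).
      apply: (@cvg_comp _ _ _ (fun z : 'rV[R]_n * 'rV[R]_n => z.1) u _ (nbhs x)).
        exact: cvg_fst.
      exact: cu.
    apply: (@cvg_comp _ _ _ (fun z : 'rV[R]_n * 'rV[R]_n => z.2) u _ (nbhs y)).
      exact: cvg_snd.
    exact: cu.
  apply: cvgMr; apply: (@cvg_comp _ _ _ (fun z : 'rV[R]_n * 'rV[R]_n => enorm (z.1 - z.2))
    (fun t : R => `|t| `^ s) _ (nbhs (enorm (x - y)))).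
    exact: cvg_enormB.
  exact: continuous_normr_powR.
have pos : 0 < `|u x - u y| - H * `|enorm (x - y)| `^ s.
  by rewrite (ger0_norm (enorm_ge0 _)) subr_gt0.
have h := @cvgr_gt _ _ (nbhs (x, y)) _ _ _ cd 0 pos.
by near=> z; rewrite /P -subr_gt0; near: z; exact: h.
Unshelve. all: by end_near. Qed.

Lemma Loo_norm_le (B : R) (u : 'rV[R]_n -> R) : 0 <= B ->
  (forall x, Omega x -> `|u x| <= B) -> (Lp_norm Omega +oo u <= B%:E)%E.
Proof.
move=> B0 uB; rewrite /Lp_norm unlock /Lnorm; case: ifP => _; last by rewrite lee_fin.
apply/ess_supP; apply: aeW => x /=; rewrite patchE.
by case: ifPn => [/set_mem Ox|_] /=; rewrite ?normr0 lee_fin// uB.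
Qed.

Lemma Loo_norm_ge (B : R) (u : 'rV[R]_n -> R) :
  (forall x, Omega x -> {for x, continuous u}) ->
  (Lp_norm Omega +oo u <= B%:E)%E -> forall x, Omega x -> `|u x| <= B.
Proof.
move=> cu; rewrite /Lp_norm unlock /Lnorm.
have mT : (0 < mu [set: 'rV[R]_n])%E.
  by apply: lt_le_trans Ogt0 _; apply: le_measure; rewrite ?inE.
rewrite mT => /ess_supP ae x Ox; rewrite leNgt; apply/negP => big.
apply: (@near_contra (fun z => B < `|u z|) x Ox).
  apply: filterS ae => a /= + Oa; rewrite patchE mem_set//= lee_fin => le.
  by apply/negP; rewrite -leNgt.
have cd : `|u y| @[y --> x] --> `|u x|.
  apply: (@cvg_comp _ _ _ u (fun t : R => `|t|) _ (nbhs (u x))); first exact: cu.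
  exact: (@norm_continuous R R^o).
exact: (@cvgr_gt _ _ (nbhs x) _ _ _ cd B).
Qed.

End sup_norms.

Section lambda1_infty_value.
Context (R : realType) (n : nat) (Omega : set 'rV[R]_n) (s : R).
Hypotheses (n_gt0 : (0 < n)%N) (dom : smooth_bounded_domain Omega) (s0 : 0 < s) (s1 : s < 1).

Let oO : open Omega. Proof. by case: dom. Qed.
Let bO : bounded_set Omega. Proof. by case: dom. Qed.
Let neO : Omega !=set0. Proof. by case: dom. Qed.
Let mO : measurable Omega. Proof. exact: domain_measurable dom. Qed.
Let D := diam Omega.
Let D0 : 0 < D. Proof. exact: diam_gt0. Qed.
Let Lam := 2 / D `^ s.

Let L0 : 0 < Lam. Proof. exact: Lam_gt0. Qed.

(** For an admissible u the number S = sup u = - inf u is also the sup norm, and the oscillation 2 S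
    is at most the seminorm times D^s. *)
Lemma admissible_ratio_ge u : admissible Omega s u ->
  (Lam%:E <= holder_seminorm Omega s u / Lp_norm Omega +oo u)%E.
Proof.
move=> [[cu mu_ Lu hu] nz si].
have cx x : Omega x -> {for x, continuous u} by exact: C0_closure_at.
have [B B0 uB] := C0_closure_bounded bO neO cu.
have [x0 Ox0] := neO.
have hs : has_sup (u @` Omega).
  split; first by exists (u x0), x0.
  exists B => _ [x Ox <-]; apply: le_trans (ler_norm _) _; apply: uB; exact: subset_closure.
have hi : has_inf (u @` Omega).
  split; first by exists (u x0), x0.
  exists (- B) => _ [x Ox <-].
  have := uB x (subset_closure Ox); by rewrite ler_norml => /andP[].
set S := sup (u @` Omega) in si.
have iE : inf (u @` Omega) = - S by apply/eqP; rewrite -addr_eq0 addrC si.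
have uS x : Omega x -> `|u x| <= S.
  move=> Ox; rewrite ler_norml -iE; apply/andP; split.
    by apply: (ge_inf hi.2); exists x.
  by apply: (ub_le_sup hs.2); exists x.
have S0 : 0 < S.
  rewrite ltNge; apply/negP => Sle; apply: nz; apply: aeW => x Ox.
  by apply/eqP; rewrite -normr_le0 (le_trans (uS x Ox)).
have LE : (Lp_norm Omega +oo u = S%:E)%E.
  apply/eqP; rewrite eq_le; apply/andP; split; first exact: Loo_norm_le (ltW S0) uS.
  have fL : Lp_norm Omega +oo u \is a fin_num by rewrite ge0_fin_numE// Lnorm_ge0.
  rewrite -(fineK fL) lee_fin; apply: ge_sup; first exact: hs.1.
  move=> _ [x Ox <-]; apply: le_trans (ler_norm _) _.
  by apply: (Loo_norm_ge oO neO cx _ Ox); rewrite fineK.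
have fh : holder_seminorm Omega s u \is a fin_num by rewrite ge0_fin_numE// Lnorm_ge0.
set h := fine (holder_seminorm Omega s u).
have hE : holder_seminorm Omega s u = h%:E by rewrite fineK.
have h0 : 0 <= h by rewrite fine_ge0// Lnorm_ge0.
have uH : forall x y, Omega x -> Omega y -> `|u x - u y| <= h * enorm (x - y) `^ s.
  by apply: holder_seminorm_ge => //; rewrite hE.
have uD x y : Omega x -> Omega y -> u x - u y <= h * D `^ s.
  move=> Ox Oy; apply: le_trans (ler_norm _) _; apply: le_trans (uH x y Ox Oy) _.
  rewrite ler_wpM2l//; apply: ge0_ler_powR; rewrite ?nnegrE ?enorm_ge0 ?(ltW s0) ?(ltW D0)//.
  by apply: enorm_le_diam => //; exact: subset_closure.
have SD : 2 * S <= h * D `^ s.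
  have : S - h * D `^ s <= - S; last by lra.
  rewrite -iE; apply: lb_le_inf; first exact: hi.1.
  move=> _ [y Oy <-]; rewrite lerBlDr; apply: ge_sup; first exact: hs.1.
  by move=> _ [x Ox <-]; rewrite -lerBlDl; exact: uD.
rewrite hE LE inver gt_eqF// -EFinM lee_fin /Lam ler_pdivlMr// mulrAC.
by rewrite ler_pdivrMr ?powR_gt0.
Qed.

(** Shared by the cone, which attains Lam, and by the limits of minimizers. The values 1 and - 1 are
    only required to be approached in Omega, since they may be attained on the boundary alone. *)
Lemma extremal_admissible v : C0_closure Omega v -> measurable_fun Omega v ->
  (forall x y, Omega x -> Omega y -> `|v x - v y| <= Lam * enorm (x - y) `^ s) ->
  (forall x, Omega x -> `|v x| <= 1) ->
  (forall b, b < 1 -> exists2 x, Omega x & b < v x) ->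
  (forall b, b < 1 -> exists2 x, Omega x & v x < - b) ->
  [/\ admissible Omega s v, (Lp_norm Omega +oo v = 1)%E &
      (holder_seminorm Omega s v <= Lam%:E)%E].
Proof.
move=> cv mv vH v1 vp vm.
have cx x : Omega x -> {for x, continuous v} by exact: C0_closure_at.
have [x0 Ox0] := neO.
have hle : (holder_seminorm Omega s v <= Lam%:E)%E by exact: holder_seminorm_le (ltW L0) vH.
have Lle : (Lp_norm Omega +oo v <= 1)%E by exact: Loo_norm_le ler01 v1.
have LE : (Lp_norm Omega +oo v = 1)%E.
  apply/eqP; rewrite eq_le Lle/=.
  have fL : Lp_norm Omega +oo v \is a fin_num.
    by rewrite ge0_fin_numE ?Lnorm_ge0//; apply: le_lt_trans Lle (ltry _).
  rewrite -(fineK fL) lee_fin leNgt; apply/negP => lt1.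
  have [x Ox bx] := vp _ lt1; move: bx; apply/negP; rewrite -leNgt.
  by apply: le_trans (ler_norm _) _; apply: (Loo_norm_ge oO neO cx _ Ox); rewrite fineK.
have hs : has_ubound (v @` Omega).
  by exists 1 => _ [x Ox <-]; apply: le_trans (ler_norm _) _; exact: v1.
have hi : has_lbound (v @` Omega).
  by exists (- 1) => _ [x Ox <-]; have := v1 x Ox; rewrite ler_norml => /andP[].
have ne : v @` Omega !=set0 by exists (v x0), x0.
have supE : sup (v @` Omega) = 1.
  apply/eqP; rewrite eq_le; apply/andP; split.
    by apply: ge_sup => // _ [x Ox <-]; apply: le_trans (ler_norm _) _; exact: v1.
  rewrite leNgt; apply/negP => /vp[x Ox]; apply/negP; rewrite -leNgt.
  by apply: ub_le_sup => //; exists x.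
have infE : inf (v @` Omega) = - 1.
  apply/eqP; rewrite eq_le; apply/andP; split.
    rewrite lerNr leNgt; apply/negP => /vm[x Ox]; rewrite opprK; apply/negP; rewrite -leNgt.
    by apply: ge_inf => //; exists x.
  by apply: lb_le_inf => // _ [x Ox <-]; have := v1 x Ox; rewrite ler_norml => /andP[].
split => //; split.
- by split => //; [rewrite LE ltry|apply: le_lt_trans hle (ltry _)].
- move=> ae; have [x Ox x2] := vp (2^-1) (ltac:(by rewrite invf_lt1 ?ltr1n)).
  apply: (@near_contra _ _ Omega oO (fun z => 0 < v z) x Ox).
    by apply: filterS ae => z + Oz => /(_ Oz) ->; rewrite ltxx.
  apply: (@cvgr_gt _ _ (nbhs x) _ _ _ (cx x Ox) 0).
  by apply: lt_trans x2; rewrite invr_gt0.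
- by rewrite supE infE subrr.
Qed.

Lemma lambda1_inftyE : lambda1_infty Omega s = Lam%:E.
Proof.
apply/eqP; rewrite eq_le; apply/andP; split; last first.
  by apply: le_ereal_inf_tmp => _ [u au <-]; exact: admissible_ratio_ge.
have [u0 [cu0 u01 lip [xp cxp upE] [xm cxm umE]]] := exists_cone n_gt0 dom.
have cNu : continuous (fun x => - u0 x) by move=> x; apply: (@continuousN R R^o); exact: cu0.
have [||||||adm L1 hL] := @extremal_admissible u0.
- exact: continuous_subspaceT.
- by apply: measurable_funTS; exact: continuous_measurable_rV.
- move=> x y Ox Oy; apply: le_trans (lip x y) _.
  apply: lipschitz_holder_D => //; first exact: enorm_ge0.
  by apply: enorm_le_diam => //; exact: subset_closure.
- by move=> x Ox; apply: u01; exact: subset_closure.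
- move=> b b1; have bu : b < u0 xp by rewrite upE.
  have [x' [Ox' ax']] := cxp _ (@cvgr_gt _ _ (nbhs xp) _ _ _ (cu0 xp) b bu).
  by exists x'.
- move=> b b1; have bu : b < (fun x => - u0 x) xm by rewrite umE opprK.
  have [x' [Ox' ax']] := cxm _ (@cvgr_gt _ _ (nbhs xm) _ _ _ (cNu xm) b bu).
  by exists x' => //; rewrite ltrNr.
apply: (@le_trans _ _ (holder_seminorm Omega s u0 / Lp_norm Omega +oo u0)%E).
  by apply: ereal_inf_lbound; exists u0.
by rewrite L1 inve1 mule1.
Qed.

Lemma extremal_minimizer v : C0_closure Omega v -> measurable_fun Omega v ->
  (forall x y, Omega x -> Omega y -> `|v x - v y| <= Lam * enorm (x - y) `^ s) ->
  (forall x, Omega x -> `|v x| <= 1) ->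
  (forall b, b < 1 -> exists2 x, Omega x & b < v x) ->
  (forall b, b < 1 -> exists2 x, Omega x & v x < - b) ->
  minimizer_infty Omega s v.
Proof.
move=> cv mv vH v1 vp vm; have [adm L1 hL] := extremal_admissible cv mv vH v1 vp vm.
split => //; rewrite L1 mule1; apply/eqP; rewrite eq_le lambda1_inftyE hL/=.
rewrite -lambda1_inftyE; apply: ereal_inf_lbound; exists v => //.
by rewrite L1 inve1 mule1.
Qed.

End lambda1_infty_value.

(** * Touching from below *)

Section product_integrals.
Context (R : realType) (n : nat) (Omega : set 'rV[R]_n).
Local Notation T := 'rV[R]_n.
Local Notation mu := (@lebesgue_rV R n).
Local Notation mu2 := (mu \x mu)%E.
Hypothesis mO : measurable Omega.
Local Open Scope ereal_scope.

Let E2 (F : T * T -> R) := \int[mu2]_(z in Omega `*` Omega) (F z)%:E.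

Lemma product_integralD (F G : T * T -> R) :
  measurable_fun setT F -> measurable_fun setT G ->
  (forall z, (0 <= F z)%R) -> (forall z, (0 <= G z)%R) ->
  E2 (fun z => F z + G z)%R = E2 F + E2 G.
Proof.
move=> mF mG F0 G0; rewrite /E2 -ge0_integralD//.
- exact: measurableX.
- by move=> z _; rewrite lee_fin.
- by apply: measurable_funTS; apply/measurable_EFinP.
- by move=> z _; rewrite lee_fin.
- by apply: measurable_funTS; apply/measurable_EFinP.
Qed.

Lemma product_integralZ (c : R) (F : T * T -> R) : (0 <= c)%R ->
  measurable_fun setT F -> (forall z, (0 <= F z)%R) ->
  E2 (fun z => c * F z)%R = c%:E * E2 F.
Proof.
move=> c0 mF F0; rewrite /E2 -ge0_integralZl//.
- exact: measurableX.
- by apply: measurable_funTS; apply/measurable_EFinP.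
- by move=> z _; rewrite lee_fin.
Qed.

Lemma product_integral_tensor (f g : T -> R) :
  measurable_fun setT f -> measurable_fun setT g ->
  (forall x, (0 <= f x)%R) -> (forall x, (0 <= g x)%R) ->
  E2 (fun z => f z.1 * g z.2)%R =
  (\int[mu]_(x in Omega) (f x)%:E) * (\int[mu]_(x in Omega) (g x)%:E).
Proof.
move=> mf mg f0 g0; rewrite /E2 -iterated_integralE//; last 2 first.
- apply: measurable_funM; first by apply: measurableT_comp => //; exact: measurable_fst.
  by apply: measurableT_comp => //; exact: measurable_snd.
- by move=> z; exact: mulr_ge0.
have mE (h : T -> R) : measurable_fun setT h -> measurable_fun Omega (fun x => (h x)%:E).
  by move=> mh; apply/measurable_EFinP; exact: measurable_funTS.
rewrite muleC -ge0_integralZl//; last 3 first.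
- exact: mE.
- by move=> x _; rewrite lee_fin.
- by apply: integral_ge0 => x _; rewrite lee_fin.
apply: eq_integral => x _; rewrite muleC -ge0_integralZl//.
- exact: mE.
- by move=> y _; rewrite lee_fin.
- by rewrite lee_fin.
Qed.

End product_integrals.

(** * Comparing a minimizer with a perturbation from above *)

Section minimizer_inequalities.
Context (R : realType) (n : nat) (Omega : set 'rV[R]_n) (s : R).
Local Notation mu := (@lebesgue_rV R n).
Hypotheses (n_gt0 : (0 < n)%N) (dom : smooth_bounded_domain Omega) (s0 : 0 < s) (s1 : s < 1).

Let mO : measurable Omega. Proof. exact: domain_measurable dom. Qed.
Let Ofin : (mu Omega < +oo)%E. Proof. exact: domain_finite dom. Qed.
Let V := fine (mu Omega).
Let VE : mu Omega = V%:E.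
Proof. by rewrite /V fineK// ge0_fin_numE. Qed.

Lemma EFin_Rintegral (f : 'rV[R]_n -> R) : mu.-integrable Omega (EFin \o f) ->
  (\int[mu]_(x in Omega) (f x)%:E)%E = (\int[mu]_(x in Omega) f x)%:E.
Proof. by move=> If; rewrite /Rintegral fineK//; exact: integrable_fin_num If. Qed.

Variables (p l : R) (U psi : 'rV[R]_n -> R) (B j : R).
Hypotheses (p2 : 2 < p) (l0 : 0 <= l) (lE : lambda1 Omega s p = l%:E).
Hypotheses (mU : measurable_fun setT U) (mpsi : measurable_fun setT psi).
Hypotheses (UB : forall x, Omega x -> `|U x| <= B) (psiB : forall x, Omega x -> `|psi x| <= B).
Hypotheses (psi0 : forall x, 0 <= psi x).
Hypotheses (B0 : 0 <= B).
Hypotheses (U1 : (\int[mu]_(x in Omega) (`|U x| `^ p)%:E = 1)%E).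
Hypotheses (U0 : mean_p Omega p U = 0%E).
Hypotheses (jU : forall x, Omega x -> 0 < psi x -> j <= spow p (U x)).

Let w x := U x + psi x.
Let I := \int[mu]_(x in Omega) psi x.

Let p1 : 1 < p. Proof. by apply: lt_trans p2; rewrite ltr1n. Qed.
Let p0 : 0 < p. Proof. by apply: lt_trans p1. Qed.
Let pne : p != 0. Proof. by rewrite gt_eqF. Qed.
Let mw : measurable_fun setT w. Proof. exact: measurable_funD. Qed.

Let bi (f : 'rV[R]_n -> R) C : measurable_fun setT f ->
  (forall x, Omega x -> `|f x| <= C) -> mu.-integrable Omega (EFin \o f).
Proof. by move=> mf; apply: bounded_integrable => //; exact: measurable_funTS. Qed.

Let mpow (f : 'rV[R]_n -> R) : measurable_fun setT f -> measurable_fun setT (fun x => `|f x| `^ p).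
Proof.
by move=> mf; apply: (measurableT_comp (measurable_powR p)); exact: measurableT_comp.
Qed.

Let powle (t C : R) : `|t| <= C -> `| `|t| `^ p| <= C `^ p.
Proof.
move=> tC; rewrite ger0_norm ?powR_ge0//; apply: ge0_ler_powR; rewrite ?nnegrE ?(ltW p0)//.
exact: le_trans tC.
Qed.

(** A constant c restores the vanishing mean of w without changing its energy. Convexity at U gives
    |w - c|^p >= |U|^p + p (psi - c) [spow p U], where the term in c integrates to zero and [jU]
    bounds the term in psi. The bound j may be negative. *)
Lemma minimum_principle : (gagliardo Omega s p w < +oo)%E ->
  ((l * (1 + p * j * I))%:E <= gagliardo Omega s p w `^ p)%E.
Proof.
move=> gw.
have wB x : Omega x -> `|w x| <= B + B.
  by move=> Ox; apply: le_trans (ler_normD _ _) _; apply: lerD; [exact: UB|exact: psiB].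
have BB0 : 0 <= B + B by exact: addr_ge0.
have [c cB mean0] := mean_zero_shift mO Ofin p2 BB0 (measurable_funTS mw) wB.
pose u x := w x - c.
have mu_ : measurable_fun setT u by exact: measurable_funB.
have uB x : Omega x -> `|u x| <= (B + B) + (B + B).
  by move=> Ox; apply: le_trans (ler_normB _ _) _; apply: lerD => //; exact: wB.
have mJ : measurable_fun setT (fun x => spow p (U x)) by exact: measurable_spow.
have JB x : Omega x -> `|spow p (U x)| <= B `^ (p - 1).
  by move=> Ox; apply: normr_spow_le => //; exact: UB.
have iu : mu.-integrable Omega (EFin \o (fun x => `|u x| `^ p)).
  by apply: bi (mpow mu_) _ => x Ox; exact: powle (uB x Ox).
have iU : mu.-integrable Omega (EFin \o (fun x => `|U x| `^ p)).
  by apply: bi (mpow mU) _ => x Ox; exact: powle (UB Ox).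
have iJ : mu.-integrable Omega (EFin \o (fun x => spow p (U x))) by exact: bi mJ JB.
have ipsi : mu.-integrable Omega (EFin \o psi) by exact: bi mpsi psiB.
have scaleI (k : R) (f : 'rV[R]_n -> R) : mu.-integrable Omega (EFin \o f) ->
    mu.-integrable Omega (EFin \o (fun x => k * f x)).
  by move=> If; exact: (@integrableZl _ _ _ mu _ mO k _ If).
pose N := \int[mu]_(x in Omega) (`|u x| `^ p).
have low : 1 + p * j * I <= N.
  have -> : 1 + p * j * I = \int[mu]_(x in Omega)
      (`|U x| `^ p + (p * j * psi x - p * c * spow p (U x))).
    rewrite RintegralD//; last first.
      by apply: (@integrableB _ _ _ mu _ mO (fun x => (p * j * psi x)%:E)
        (fun x => (p * c * spow p (U x))%:E)); exact: scaleI.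
    rewrite RintegralB//; [|exact: scaleI|exact: scaleI].
    rewrite !RintegralZl// /I.
    have -> : \int[mu]_(x in Omega) (`|U x| `^ p) = 1 by rewrite /Rintegral U1.
    have -> : \int[mu]_(x in Omega) spow p (U x) = 0 by rewrite /Rintegral -mean_pE U0.
    by rewrite mulr0 subr0.
  apply: le_Rintegral => //.
    apply: (@integrableD _ _ _ mu _ mO (fun x => (`|U x| `^ p)%:E)
      (fun x => (p * j * psi x - p * c * spow p (U x))%:E)) => //.
    by apply: (@integrableB _ _ _ mu _ mO (fun x => (p * j * psi x)%:E)
        (fun x => (p * c * spow p (U x))%:E)); exact: scaleI.
  move=> x Ox; apply: le_trans (powR_convex_tangent (U x) (u x) p1).
  rewrite lerD2l /u /w.
  have -> : p * spow p (U x) * (U x + psi x - c - U x) =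
    p * (spow p (U x) * psi x) - p * c * spow p (U x) by ring.
  rewrite lerD2r -mulrA ler_wpM2l ?(ltW p0)//.
  have [->|pn] := eqVneq (psi x) 0; first by rewrite !mulr0.
  by rewrite ler_wpM2r// jU// lt_neqAle eq_sym pn psi0.
have gfin : (gagliardo Omega s p w `^ p)%E \is a fin_num.
  by rewrite ge0_fin_numE ?poweR_ge0//; exact: poweR_lty.
(* If N <= 0, then 1 + p j I <= 0 as well and the claim is trivial. *)
have [N0|N0] := leP N 0.
  apply: le_trans (poweR_ge0 _ _); rewrite lee_fin.
  by apply: mulr_ge0_le0 => //; exact: le_trans low N0.
have Wu : Wsp Omega s p u.
  split.
  - exact: measurable_funTS.
  - apply: (lty_poweRy pne); rewrite Lp_norm_powE//.
    by rewrite (EFin_Rintegral iu) ltry.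
  - by rewrite gagliardo_shift.
have := @lambda1_le R n Omega s dom p (fine (gagliardo Omega s p w `^ p)%E) N u p1 Wu mean0 N0.
rewrite gagliardo_shift fineK// => /(_ (lexx _)).
rewrite Lp_norm_powE// (EFin_Rintegral iu) => /(_ (lexx _)).
rewrite lE lee_fin ler_pdivlMr// => lN.
rewrite -(fineK gfin) lee_fin; apply: le_trans lN.
by rewrite ler_wpM2l.
Qed.

Variables (N : set 'rV[R]_n) (ahat bhat : R).
Hypotheses (mN : measurable N) (NO : N `<=` Omega) (ahat0 : 0 <= ahat) (bhat0 : 0 <= bhat).
Hypothesis lU : (\int[mu]_(x in Omega) \int[mu]_(y in Omega) (dquot s p U (x, y))%:E = l%:E)%E.
Hypothesis kernel_le : forall x y, Omega x -> Omega y -> 0 < psi x ->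
  spow p (w x - w y) / enorm (x - y) `^ (n%:R + s * p) + ahat * \1_N y <= bhat.

(** Convexity at the difference of w bounds the growth of the energy density by p (psi x - psi y)
    times [spow] of that difference times the kernel. As [spow] is odd, the term in psi y is the
    term in psi x with the points exchanged, so [kernel_le] applies to both. *)
Lemma modified_energy_le x y : Omega x -> Omega y ->
  dquot s p w (x, y) + p * ahat * (psi x * \1_N y + \1_N x * psi y) <=
  dquot s p U (x, y) + p * bhat * (psi x * 1 + 1 * psi y).
Proof.
move=> Ox Oy.
set K := (enorm (x - y) `^ (n%:R + s * p))^-1.
have K0 : 0 <= K by rewrite invr_ge0 powR_ge0.
have half a b : Omega a -> Omega b ->
    spow p (w a - w b) * (enorm (a - b) `^ (n%:R + s * p))^-1 * psi a +
    ahat * \1_N b * psi a <= bhat * psi a.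
  move=> Oa Ob; have [->|pn] := eqVneq (psi a) 0; first by rewrite !mulr0 addr0.
  rewrite -mulrDl ler_wpM2r//; apply: kernel_le => //.
  by rewrite lt_neqAle eq_sym pn psi0.
have h1 := half x y Ox Oy; have h2 := half y x Oy Ox.
rewrite (enorm_subC y x) -(opprB (w x) (w y)) spowN -/K in h2; rewrite -/K in h1.
have h3 := powR_convex_tangent (w x - w y) (U x - U y) p1.
have h4 := ler_wpM2r K0 h3.
rewrite /dquot/= -/K.
have E : (U x - U y) - (w x - w y) = psi y - psi x by rewrite /w; ring.
rewrite E in h4; set J := spow p (w x - w y) in h1 h2 h4.
set A := `|w x - w y| `^ p in h4 *; set C := `|U x - U y| `^ p in h4 *.
have h5 : p * (J * K * psi x + ahat * \1_N y * psi x + (- J * K * psi y + ahat * \1_N x * psi y))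
   <= p * (bhat * psi x + bhat * psi y) by rewrite ler_wpM2l ?(ltW p0)// lerD.
apply: (@le_trans _ _ (C * K - p * J * (psi y - psi x) * K +
   p * ahat * (psi x * \1_N y + \1_N x * psi y))).
  by rewrite lerD2r lerBrDr -mulrDl.
rewrite -addrA lerD2l; apply: le_trans (_ : p * (bhat * psi x + bhat * psi y) <= _).
  by apply: le_trans h5; rewrite le_eqVlt; apply/orP; left; apply/eqP; ring.
by rewrite le_eqVlt; apply/orP; left; apply/eqP; ring.
Qed.

(** After integration every term other than l carries the factor p I; dividing by it removes all
    dependence on the size of psi. *)
Lemma minimizer_bound : 0 < I -> l * j + 2 * ahat * fine (mu N) <= 2 * bhat * V.
Proof.
move=> I0.
have muN : mu N = (fine (mu N))%:E.
  rewrite fineK// ge0_fin_numE//; apply: le_lt_trans Ofin.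
  by apply: le_measure; rewrite ?inE.
have ipsi : mu.-integrable Omega (EFin \o psi) by exact: bi mpsi psiB.
have IE : (\int[mu]_(x in Omega) (psi x)%:E = I%:E)%E by exact: EFin_Rintegral.
have m1N : measurable_fun setT (\1_N : 'rV[R]_n -> R) by exact: measurable_indic.
have N0 x : 0 <= (\1_N : 'rV[R]_n -> R) x by [].
have iN : (\int[mu]_(x in Omega) ((\1_N : 'rV[R]_n -> R) x)%:E = (fine (mu N))%:E)%E.
  by rewrite integral_indic// (setIidl NO) -muN.
have i1 : (\int[mu]_(x in Omega) ((cst 1 : 'rV[R]_n -> R) x)%:E = V%:E)%E.
  transitivity (\int[mu]_(x in Omega) cst 1%E x)%E; first by [].
  by rewrite integral_cst// mul1e; exact: VE.
have mc1 : measurable_fun setT (cst 1 : 'rV[R]_n -> R) by exact: measurable_cst.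
have c10 x : 0 <= (cst 1 : 'rV[R]_n -> R) x by rewrite /cst.
have mt (f g : 'rV[R]_n -> R) : measurable_fun setT f -> measurable_fun setT g ->
    measurable_fun setT (fun z : 'rV[R]_n * 'rV[R]_n => f z.1 * g z.2).
  move=> mf mg; apply: measurable_funM.
    by apply: measurableT_comp => //; exact: measurable_fst.
  by apply: measurableT_comp => //; exact: measurable_snd.
pose F1 (z : 'rV[R]_n * 'rV[R]_n) :=
  dquot s p w z + p * ahat * (psi z.1 * \1_N z.2 + \1_N z.1 * psi z.2).
pose F2 (z : 'rV[R]_n * 'rV[R]_n) :=
  dquot s p U z + p * bhat * (psi z.1 * cst 1 z.2 + cst 1 z.1 * psi z.2).
have total (f : 'rV[R]_n -> R) (k a : R) (u : 'rV[R]_n -> R) : measurable_fun setT f -> (forall x, 0 <= f x) ->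
    0 <= k -> measurable_fun setT u -> (\int[mu]_(x in Omega) (f x)%:E = a%:E)%E ->
    (\int[(mu \x mu)%E]_(z in Omega `*` Omega)
      (dquot s p u z + k * (psi z.1 * f z.2 + f z.1 * psi z.2))%:E =
     \int[mu]_(x in Omega) \int[mu]_(y in Omega) (dquot s p u (x, y))%:E + (k * (I * a + a * I))%:E)%E.
  move=> mf f0 k0 muu fa.
  have ms : measurable_fun setT (fun z : 'rV[R]_n * 'rV[R]_n => psi z.1 * f z.2 + f z.1 * psi z.2).
    by apply: measurable_funD; exact: mt.
  have sg (z : 'rV[R]_n * 'rV[R]_n) : 0 <= psi z.1 * f z.2 + f z.1 * psi z.2.
    by rewrite addr_ge0 ?mulr_ge0.
  rewrite (product_integralD mO (measurable_dquot s p muu) (measurable_funM (measurable_cst k) ms)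
    (dquot_ge0 s p u) (fun z => mulr_ge0 k0 (sg z))).
  rewrite (product_integralZ mO k0 ms sg).
  rewrite (product_integralD mO (mt _ _ mpsi mf) (mt _ _ mf mpsi)); last 2 first.
  - by move=> z; exact: mulr_ge0.
  - by move=> z; exact: mulr_ge0.
  rewrite (product_integral_tensor mO mpsi mf psi0 f0) (product_integral_tensor mO mf mpsi f0 psi0).
  rewrite IE fa -(iterated_integralE mO (measurable_dquot s p muu) (dquot_ge0 s p u)).
  by rewrite -!EFinM.
have pa0 : 0 <= p * ahat by rewrite mulr_ge0 ?(ltW p0).
have pb0 : 0 <= p * bhat by rewrite mulr_ge0 ?(ltW p0).
have t1 := total _ _ _ _ m1N N0 pa0 mw iN.
have t2 := total _ _ _ _ mc1 c10 pb0 mU i1.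
have le12 : (\int[(mu \x mu)%E]_(z in Omega `*` Omega) (F1 z)%:E <=
    \int[(mu \x mu)%E]_(z in Omega `*` Omega) (F2 z)%:E)%E.
  have mF (f : 'rV[R]_n -> R) (k : R) (u : 'rV[R]_n -> R) : measurable_fun setT f -> measurable_fun setT u ->
      measurable_fun (Omega `*` Omega) (fun z => (dquot s p u z + k * (psi z.1 * f z.2 + f z.1 * psi z.2))%:E).
    move=> mf muu; apply: measurable_funTS; apply/measurable_EFinP.
    apply: measurable_funD; first exact: measurable_dquot.
    by apply: measurable_funM => //; apply: measurable_funD; exact: mt.
  apply: ge0_le_integral.
  - exact: measurableX.
  - move=> z _; rewrite lee_fin addr_ge0 ?dquot_ge0// mulr_ge0// addr_ge0// mulr_ge0//.
  - exact: mF.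
  - exact: mF.
  - by move=> [x y] [/= Ox Oy]; rewrite lee_fin; exact: modified_energy_le.
move: le12; rewrite t1 t2 lU -EFinD => le12.
have gw : (gagliardo Omega s p w `^ p < +oo)%E.
  rewrite gagliardo_powE//; apply: le_lt_trans (ltry (l + p * bhat * (I * V + V * I))).
  apply: le_trans le12; rewrite leeDl// lee_fin mulr_ge0// addr_ge0// mulr_ge0// ?(ltW I0)//.
    by rewrite fine_ge0.
  by rewrite fine_ge0.
have := minimum_principle (lty_poweRy pne gw).
rewrite gagliardo_powE// => low.
have := leeD low (lexx (p * ahat * (I * fine (mu N) + fine (mu N) * I))%:E).
move=> /le_trans /(_ le12); rewrite -EFinD lee_fin => fin.
rewrite -(ler_pM2r (mulr_gt0 p0 I0)) -(lerD2l l).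
apply: le_trans (le_trans fin _).
  by rewrite le_eqVlt; apply/orP; left; apply/eqP; ring.
by rewrite le_eqVlt; apply/orP; left; apply/eqP; ring.
Qed.

End minimizer_inequalities.

(** * Estimates for the singular kernel *)

Section kernel_estimates.
Context (R : realType).
Implicit Types a b C d e g k m p s t x y : R.

Lemma near_powR_dominated_pred a b m C : 0 <= b -> b < a -> 0 < m ->
  \forall p \near +oo, C * b `^ (p - 1) < m * a `^ (p - 1).
Proof.
move=> b0 ba m0; have [K [Kr KP]] := near_powR_dominated C b0 ba m0.
by exists (K + 1); split => [|p Kp]; [exact: num_real|apply: KP; rewrite ltrBrDr].
Qed.

(** For increments of size a t^s the powers of t that depend on p cancel, leaving the fixed exponent
    - (k + s). *)
Lemma kernel_power a s p t k : 0 <= a -> 0 < t ->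
  (a * t `^ s) `^ (p - 1) / t `^ (k + s * p) = a `^ (p - 1) * t `^ (- (k + s)).
Proof.
move=> a0 t0; rewrite powRM ?powR_ge0// -powRrM -mulrA -powRN -powRD; last first.
  by apply/implyP => _; rewrite gt_eqF.
by congr (_ * _ `^ _); lra.
Qed.

Lemma kernel_far b s p t d k : 1 < p -> 0 <= b -> 0 < d -> d <= t -> 0 <= k + s ->
  (b * t `^ s) `^ (p - 1) / t `^ (k + s * p) <= b `^ (p - 1) * d `^ (- (k + s)).
Proof.
move=> p1 b0 d0 dt ks; have t0 : 0 < t by exact: lt_le_trans dt.
rewrite kernel_power// ler_wpM2l ?powR_ge0// !powRN lef_pV2 ?posrE ?powR_gt0//.
by apply: ge0_ler_powR; rewrite ?nnegrE ?(ltW d0) ?(ltW t0).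
Qed.

Lemma kernel_near b C s p t d k : 1 < p -> 0 <= C -> C * d `^ (1 - s) <= b ->
  0 < t -> t <= d -> 0 <= p * (1 - s) - 1 - k ->
  (C * t) `^ (p - 1) / t `^ (k + s * p) <= b `^ (p - 1) * d `^ (- (k + s)).
Proof.
move=> p1 C0 Cb t0 td th; have d0 : 0 < d by exact: lt_le_trans td.
have -> : C * t = (C * t `^ (1 - s)) * t `^ s.
  rewrite -mulrA -powRD ?subrK ?powRr1 ?(ltW t0)//.
  by apply/implyP => _; rewrite gt_eqF.
rewrite kernel_power// ?mulr_ge0 ?powR_ge0//.
have expE x : 0 < x -> (C * x `^ (1 - s)) `^ (p - 1) * x `^ (- (k + s)) =
    C `^ (p - 1) * x `^ (p * (1 - s) - 1 - k).
  move=> x0; rewrite powRM ?powR_ge0// -powRrM -mulrA -powRD; last first.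
    by apply/implyP => _; rewrite gt_eqF.
  by congr (_ * _ `^ _); lra.
apply: (@le_trans _ _ ((C * d `^ (1 - s)) `^ (p - 1) * d `^ (- (k + s)))).
  rewrite [leLHS](expE t t0) [leRHS](expE d d0); apply: ler_wpM2l; first exact: powR_ge0.
  by apply: ge0_ler_powR; rewrite ?nnegrE ?(ltW t0) ?(ltW d0).
rewrite ler_wpM2r ?powR_ge0//; apply: ge0_ler_powR; rewrite ?nnegrE ?subr_ge0 ?(ltW p1)//.
  by rewrite mulr_ge0 ?powR_ge0.
by apply: le_trans Cb; rewrite mulr_ge0 ?powR_ge0.
Qed.

Lemma sqr_diff_le x y t d : 0 <= x -> 0 <= y -> x <= d -> y <= d -> `|x - y| <= t ->
  `|x ^+ 2 - y ^+ 2| <= 2 * d * t.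
Proof.
move=> x0 y0 xd yd xyt; rewrite subr_sqr normrM mulrC (ger0_norm (addr_ge0 x0 y0)).
by apply: ler_pM; rewrite ?addr_ge0//; lra.
Qed.

(** Here t, ex and ey stand for s-th powers of distances. The slack r pays for three errors of r /
    3: the move of phi from x0 to x, the term b ex, and the quadratic correction. *)
Lemma arith_far phx phx0 phy b b' ex ey t eta d r : 0 <= b ->
  `|phx - phx0| <= r / 3 -> phx0 - phy <= b * ey -> ey <= t + ex -> b * ex <= r / 3 ->
  eta * d <= r / 3 -> r <= (b' - b) * t ->
  forall x2 y2, 0 <= x2 -> 0 <= eta -> y2 <= d ->
  (phx - eta * x2) - (phy - eta * y2) <= b' * t.
Proof.
move=> b0 /ler_normlW h1 h2 h3 h4 h5 h6 x2 y2 x20 eta0 y2d.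
have := ler_wpM2l b0 h3; have := ler_wpM2l eta0 y2d; have := mulr_ge0 eta0 x20.
by rewrite mulrBl in h6; rewrite mulrDr; lra.
Qed.

Lemma arith_shift (c d f W : R) : f + d <= W -> c + d - W <= c - f.
Proof. lra. Qed.

Lemma arith_gap phx phy a t g eta d x2 y2 : 0 <= x2 -> 0 <= eta -> y2 <= d ->
  a * t + g <= phy - phx -> eta * d <= g ->
  (phx - eta * x2) - (phy - eta * y2) <= - (a * t).
Proof.
move=> x20 eta0 y2d h1 h2.
by have := ler_wpM2l eta0 y2d; have := mulr_ge0 eta0 x20; lra.
Qed.

Lemma arith_outside phx vx Ux eta e2 r2 d : phx <= vx -> `|Ux - vx| <= d / 2 ->
  0 <= eta -> r2 <= e2 -> 2 * d <= eta * r2 -> 0 <= d -> phx - eta * e2 + d - Ux <= 0.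
Proof.
move=> h1; rewrite ler_norml => /andP[h2 h3] eta0 h4 h5 d0.
by have := ler_wpM2l eta0 h4; lra.
Qed.

Lemma arith_inside phx vx Ux eta e2 d : - (d / 4) <= phx - eta * e2 - vx ->
  `|Ux - vx| <= d / 2 -> d / 4 <= phx - eta * e2 + d - Ux.
Proof. by move=> h1; rewrite ler_norml => /andP[h2 h3]; lra. Qed.

Lemma arith_low phx phx0 vx Ux d e : phx <= vx -> `|Ux - vx| <= d / 2 -> d <= e ->
  `|phx - phx0| <= e / 2 -> phx0 - e <= Ux.
Proof.
by move=> h1; rewrite !ler_norml => /andP[h2 h3] h4 /andP[h5 h6]; lra.
Qed.

Lemma arith_near phx phy L t eta x2 y2 d : 0 <= t -> 0 <= eta -> eta <= 1 -> `|phx - phy| <= L * t ->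
  `|x2 - y2| <= 2 * d * t -> (phx - eta * x2) - (phy - eta * y2) <= (L + 2 * d + 1) * t.
Proof.
move=> t0 eta0 eta1 /ler_normlW h1 h2.
have h3 : eta * (y2 - x2) <= 2 * d * t.
  apply: le_trans h2; rewrite distrC; apply: le_trans (ler_norm _) _.
  by rewrite normrM (ger0_norm eta0) ler_piMl.
by rewrite mulrBr in h3; rewrite !mulrDl mul1r; lra.
Qed.

End kernel_estimates.

(** * The inequality produced by a test function touching from below *)

Section touching.
Context (R : realType) (n : nat) (Omega : set 'rV[R]_n) (s : R).
Local Notation mu := (@lebesgue_rV R n).
Hypotheses (n_gt0 : (0 < n)%N) (dom : smooth_bounded_domain Omega) (s0 : 0 < s) (s1 : s < 1).

Let oO : open Omega. Proof. by case: dom. Qed.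
Let bO : bounded_set Omega. Proof. by case: dom. Qed.
Let neO : Omega !=set0. Proof. by case: dom. Qed.
Let mO : measurable Omega. Proof. exact: domain_measurable dom. Qed.
Let D := diam Omega.
Let D0 : 0 < D. Proof. exact: diam_gt0. Qed.
Let V := fine (mu Omega).

Lemma enorm_powR_triangle (x y z : 'rV[R]_n) :
  enorm (x - z) `^ s <= enorm (x - y) `^ s + enorm (y - z) `^ s.
Proof.
apply: le_trans (powR_addl_le s0 (ltW s1) (enorm_ge0 _) (enorm_ge0 _)).
apply: ge0_ler_powR; rewrite ?nnegrE ?enorm_ge0 ?(ltW s0)// ?addr_ge0 ?enorm_ge0//.
by have := enorm_triangle (x - y) (y - z); rewrite addrA subrK.
Qed.

Lemma near_enorm_small (x0 : 'rV[R]_n) (c e : R) : 0 <= c -> 0 < e ->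
  \forall x \near x0, c * enorm (x - x0) `^ s <= e.
Proof.
move=> c0 e0.
have c1 : 0 < c + 1 by rewrite ltr_wpDl.
have d0 : 0 < (e / (c + 1)) `^ s^-1 by rewrite powR_gt0// divr_gt0.
have dist0 : enorm (x0 - x0) < (e / (c + 1)) `^ s^-1 by rewrite subrr enorm0.
have h := @cvgr_lt _ _ (nbhs x0) _ _ _ (continuous_enorm_sub (x0 := x0) (x := x0)) _ dist0.
near=> x; have xd : enorm (x - x0) < (e / (c + 1)) `^ s^-1 by near: x; exact: h.
apply: (@le_trans _ _ ((c + 1) * enorm (x - x0) `^ s)).
  by rewrite ler_wpM2r ?powR_ge0// lerDl.
rewrite mulrC -ler_pdivlMr//.
rewrite [leRHS](_ : _ = ((e / (c + 1)) `^ s^-1) `^ s); last first.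
  by rewrite -powRrM mulVf ?gt_eqF// powRr1// divr_ge0 ?ltW.
by apply: ge0_ler_powR; rewrite ?nnegrE ?enorm_ge0 ?powR_ge0 ?(ltW s0)// ltW.
Unshelve. all: by end_near. Qed.

Lemma C1_local_lipschitz (phi : 'rV[R]_n -> R) x0 : C1_closure Omega phi -> Omega x0 ->
  exists r L, [/\ 0 < r, 0 <= L, ball x0 r `<=` Omega &
    forall x y, ball x0 r x -> ball x0 r y -> `|phi y - phi x| <= L * `|y - x|].
Proof.
move=> [_ dphi] Ox0.
pose M := \sum_i `|'D_(delta_mx 0 i) phi x0| + 1.
have M0 : 0 <= M by rewrite addr_ge0// sumr_ge0.
have : \forall y \near x0, forall i, Omega y -> `|'D_(delta_mx 0 i) phi y| <= M.
  apply: (@filter_forall _ _ (fun i y => Omega y -> `|'D_(delta_mx 0 i) phi y| <= M) (nbhs x0)) => i.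
  have [_ [g cg gD]] := dphi i.
  near=> y => Oy; rewrite -gD//; have : `|g x0 - g y| < 1.
    by near: y; exact: (@cvgr_dist_lt _ R^o _ _ _ _ _ (C0_closure_at oO cg Ox0)).
  have : `|g x0| <= \sum_i `|'D_(delta_mx 0 i) phi x0|.
    by rewrite gD// (bigD1 i)//= lerDl sumr_ge0.
  rewrite distrC; have := ler_distD (g x0) (g y) 0.
  by rewrite !subr0 /M => h1 h2 h3; apply: le_trans h1 _; rewrite addrC lerD// ltW.
move=> near1; have : \forall y \near x0, (forall i, Omega y -> `|'D_(delta_mx 0 i) phi y| <= M) /\ Omega y.
  by apply: filterI => //; exact: open_nbhs_nbhs.
move=> /nbhs_ballP[r /= r0 rP].
exists r, (n%:R * M); split => //; first by rewrite mulr_ge0.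
  by move=> y /rP[].
move=> y z yr zr; apply: (@lipschitz_of_partials _ _ phi x0 r) => // i w xw.
have [h Ow] := rP _ xw; split; first exact: (dphi i).1.
exact: h.
Unshelve. all: by end_near. Qed.

Variables (p_ : nat -> R) (U_ : nat -> 'rV[R]_n -> R) (v : 'rV[R]_n -> R).
Hypotheses (pj : p_ @ \oo --> +oo).
Hypotheses (U_min : forall j, normalized_minimizer Omega s (p_ j) (U_ j)).
Hypothesis Uv : forall e, 0 < e -> \forall j \near \oo, forall x, closure Omega x -> `|U_ j x - v x| <= e.
Hypothesis cv : C0_closure Omega v.

Variables (phi : 'rV[R]_n -> R) (x0 : 'rV[R]_n).
Hypotheses (Cphi : C1_closure Omega phi) (Ox0 : Omega x0) (phiv0 : phi x0 = v x0).
Hypothesis phiv : forall y, closure Omega y -> phi y <= v y.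

Let cphi : C0_closure Omega phi. Proof. exact: Cphi.1. Qed.

(* The test function phi is lowered to q = phi - eta |x - x0|^2, which touches
   strictly, and the minimizers are replaced by max(U, q + delta). *)
Lemma touching_bound (b b' e a g r1 : R) (N : set 'rV[R]_n) :
  0 < b -> b < b' -> 0 < e -> 0 <= a -> 0 < g -> 0 < r1 ->
  (forall y, closure Omega y -> phi x0 - phi y <= b * enorm (y - x0) `^ s) ->
  measurable N -> N `<=` Omega ->
  (forall x y, Omega x -> `|x0 - x| < r1 -> N y ->
     a * enorm (x - y) `^ s + g <= phi y - phi x) ->
  exists C, \forall j \near \oo,
    fine (lambda1 Omega s (p_ j)) * spow (p_ j) (phi x0 - e) +
    2 * (a `^ (p_ j - 1) * D `^ (- (n%:R + s))) * fine (mu N) <= C * b' `^ (p_ j - 1).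
Proof.
move=> b0 bb' e0 a0 g0 r10 hB mN NO hN.
have b'0 : 0 < b' by exact: lt_trans bb'.
have [r [L [r_gt0 L0 rO lip]]] := C1_local_lipschitz Cphi Ox0.
(* A Lipschitz constant near x0 for the lowered test function, quadratic term included. Below the
   distance rho it gives C t <= b' t^s. *)
pose C := L + 2 * D + 1.
have C0 : 0 < C by rewrite ltr_wpDl// addr_ge0// mulr_ge0// ltW.
pose rho := Num.min (r / 2) ((b' / C) `^ (1 - s)^-1).
have s1' : 0 < 1 - s by rewrite subr_gt0.
have rho0 : 0 < rho by rewrite lt_min divr_gt0// powR_gt0// divr_gt0.
have rhor : rho <= r / 2 by rewrite ge_min lexx.
have rhoC : C * rho `^ (1 - s) <= b'.
  rewrite mulrC -ler_pdivlMr//.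
  apply: (@le_trans _ _ (((b' / C) `^ (1 - s)^-1) `^ (1 - s))).
    apply: ge0_ler_powR; rewrite ?nnegrE ?powR_ge0 ?(ltW rho0) ?(ltW s1')//.
    by rewrite ge_min lexx orbT.
  by rewrite -powRrM mulVf ?gt_eqF// powRr1// divr_ge0 ?(ltW b'0) ?(ltW C0).
(* At distances t >= rho the slack (b' - b) t^s is at least [gap], to be shared by the three errors
   of [arith_far]. *)
pose gap := (b' - b) * rho `^ s.
have gap0 : 0 < gap by rewrite mulr_gt0 ?subr_gt0// powR_gt0.
have gap3 : 0 < gap / 3 by rewrite divr_gt0.
have D20 : 0 < D ^+ 2 by rewrite exprn_gt0.
(* The bound by g keeps the increments towards N above a t^s after phi is lowered; the last one
   makes the quadratic term one of the three errors. *)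
pose eta := Num.min 1 (Num.min (g / D ^+ 2) (gap / 3 / D ^+ 2)).
have eta0 : 0 < eta by rewrite !lt_min ltr01 !divr_gt0.
have eta1 : eta <= 1 by rewrite ge_min lexx.
have etag : eta * D ^+ 2 <= g by rewrite -ler_pdivlMr// !ge_min lexx /= orbT.
have etagap : eta * D ^+ 2 <= gap / 3 by rewrite -ler_pdivlMr// !ge_min lexx /= !orbT.
have cphi0 : {for x0, continuous phi} by exact: (C0_closure_at oO cphi Ox0).
have cv0 : {for x0, continuous v} by exact: (C0_closure_at oO cv Ox0).
have e2 : 0 < e / 2 by rewrite divr_gt0.
have : \forall x \near x0, [/\ `|phi x - phi x0| <= e / 2, `|phi x - phi x0| <= gap / 3 &
    b * enorm (x - x0) `^ s <= gap / 3].
  have h1 := @cvgr_dist_lt _ R^o _ _ _ _ _ cphi0 _ e2.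
  have h2 := @cvgr_dist_lt _ R^o _ _ _ _ _ cphi0 _ gap3.
  near=> x; split.
  - by rewrite distrC ltW//; near: x; exact: h1.
  - by rewrite distrC ltW//; near: x; exact: h2.
  - by near: x; exact: near_enorm_small (ltW b0) gap3.
move=> /nbhs_ballP[r2 /= r20 r2P].
pose r' := Num.min (r / 2) (Num.min r1 r2).
have r'0 : 0 < r' by rewrite !lt_min divr_gt0// r10.
have r'r : r' <= r / 2 by rewrite ge_min lexx.
have r'1 : r' <= r1 by rewrite !ge_min lexx /= orbT.
have r'2 : r' <= r2 by rewrite !ge_min lexx /= !orbT.
(* [deltar] confines the set where psi is positive to the ball of radius r'; [deltae] keeps U above
   phi x0 - e on that set. *)
pose delta := Num.min e (eta * r' ^+ 2 / 2).
have etar : 0 < eta * r' ^+ 2 by rewrite mulr_gt0// exprn_gt0.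
have delta0 : 0 < delta by rewrite lt_min e0 divr_gt0.
have deltae : delta <= e by rewrite ge_min lexx.
have deltar : 2 * delta <= eta * r' ^+ 2.
  by rewrite mulrC -ler_pdivlMr// ge_min lexx orbT.
pose q x := phi x - eta * enorm (x - x0) ^+ 2.
(* Near x0 the function q almost reaches v, so psi >= delta / 4 on a set of positive measure, and
   its integral is positive. *)
have [A [mA AO _ A0 Aq]] : exists A, [/\ measurable A, A `<=` Omega, A x0, (0 < mu A)%E &
    forall y, A y -> - (delta / 4) <= q y - v y].
  apply: near_ball_sub => //.
  have cq : (phi x - eta * (enorm (x - x0) * enorm (x - x0))) - v x @[x --> x0] -->
      (phi x0 - eta * (enorm (x0 - x0) * enorm (x0 - x0))) - v x0.
    have ce : enorm (x - x0) @[x --> x0] --> enorm (x0 - x0).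
      exact: continuous_enorm_sub.
    apply: (@cvgB R R^o _ (nbhs x0) _ (fun x => phi x - eta * (enorm (x - x0) * enorm (x - x0))) v);
      last exact: cv0.
    apply: (@cvgB R R^o _ (nbhs x0) _ phi (fun x => eta * (enorm (x - x0) * enorm (x - x0))));
      first exact: cphi0.
    by apply: cvgMr; exact: cvgM.
  have lim : - (delta / 4) < (phi x0 - eta * (enorm (x0 - x0) * enorm (x0 - x0))) - v x0.
    by rewrite subrr enorm0 !mulr0 subr0 phiv0 subrr oppr_lt0 divr_gt0.
  have h := @cvgr_gt _ _ (nbhs x0) _ _ _ cq _ lim.
  by near=> x; rewrite /q expr2 ltW//; near: x; exact: h.
exists (2 * rho `^ (- (n%:R + s)) * V).
(* The three thresholds serve the mean-zero shift, the continuity of the minimizer and the kernel at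
   short distance. *)
have pbig : \forall p \near +oo, [/\ 2 < p, n%:R < s * p & 0 <= p * (1 - s) - 1 - n%:R].
  exists (Num.max 2 (Num.max (n%:R / s) ((1 + n%:R) / (1 - s)))); split; first exact: num_real.
  move=> p; rewrite !gt_max => /and3P[h1 h2 h3]; split => //.
    by rewrite mulrC -ltr_pdivrMr.
  by move: h3; rewrite ltr_pdivrMr// => /ltW; rewrite -addrA -opprD subr_ge0.
have {}pbig : \forall j \near \oo, [/\ 2 < p_ j, n%:R < s * p_ j & 0 <= p_ j * (1 - s) - 1 - n%:R].
  exact: (pj pbig).
near=> j.
have [p2 pn pth] : [/\ 2 < p_ j, n%:R < s * p_ j & 0 <= p_ j * (1 - s) - 1 - n%:R] by near: j.
have Uvj : forall x, closure Omega x -> `|U_ j x - v x| <= delta / 2.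
  by near: j; apply: Uv; rewrite divr_gt0.
have [[mU LU gU] U1 U0 Ulam /(_ pn) cU] := U_min j.
set p := p_ j in p2 pn pth LU gU U1 U0 Ulam *; set U := U_ j in mU LU gU U1 U0 Ulam cU Uvj.
have p1 : 1 < p by apply: lt_trans p2; rewrite ltr1n.
have p0 : 0 < p by apply: lt_trans p1.
have pne : p != 0 by rewrite gt_eqF.
pose U' := U \_ Omega.
pose psi := (fun x => Num.max 0 (q x + delta - U x)) \_ Omega.
have U'E x : Omega x -> U' x = U x by move=> Ox; rewrite /U' patchE mem_set.
have UU' x : Omega x -> U x = U' x by move=> Ox; rewrite U'E.
have psiE x : Omega x -> psi x = Num.max 0 (q x + delta - U x).
  by move=> Ox; rewrite /psi patchE mem_set.
have psi0 x : 0 <= psi x.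
  by rewrite /psi patchE; case: ifP => // _; rewrite le_max lexx.
have mphi : measurable_fun Omega phi.
  apply: open_within_continuous_measurable => //.
  exact: continuous_subspaceW (@subset_closure _ Omega) cphi.
have mq : measurable_fun Omega q.
  apply: measurable_funB => //; apply: measurable_funTS; apply: continuous_measurable_rV.
  under eq_fun do rewrite expr2.
  move=> x; have ce : enorm (y - x0) @[y --> x] --> enorm (x - x0).
    exact: continuous_enorm_sub.
  have cc : (eta * (enorm (y - x0) * enorm (y - x0))) @[y --> x] -->
    eta * (enorm (x - x0) * enorm (x - x0)).
    exact: (cvgM (cvg_cst eta) (cvgM ce ce)).
  exact: cc.
have mpsi : measurable_fun setT psi.
  apply: measurable_fun_patch => //; apply: measurable_maxr => //.
  by apply: measurable_funB => //; exact: measurable_funD.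
have mU' : measurable_fun setT U' by exact: measurable_fun_patch.
have [BU BU0 UB] := C0_closure_bounded bO neO cU.
have [Bp Bp0 phiB] := C0_closure_bounded bO neO cphi.
have cl x : Omega x -> closure Omega x by exact: subset_closure.
have eD x y : Omega x -> closure Omega y -> enorm (x - y) <= D.
  by move=> Ox cy; apply: enorm_le_diam => //; exact: cl.
pose B := BU + (Bp + D ^+ 2 + delta).
have Bq0 : 0 <= Bp + D ^+ 2 + delta by rewrite !addr_ge0 ?(ltW D20) ?(ltW delta0).
have B0 : 0 <= B by rewrite addr_ge0.
have U'B x : Omega x -> `|U' x| <= B.
  by move=> Ox; rewrite U'E//; apply: le_trans (UB _ (cl _ Ox)) _; rewrite lerDl.
have qB x : Omega x -> `|q x| <= Bp + D ^+ 2.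
  move=> Ox; apply: le_trans (ler_normB _ _) _; apply: lerD; first exact: phiB (cl _ Ox).
  rewrite ger0_norm ?mulr_ge0 ?exprn_ge0 ?enorm_ge0 ?(ltW eta0)//.
  apply: (@le_trans _ _ (1 * enorm (x - x0) ^+ 2)); first by rewrite ler_wpM2r ?exprn_ge0 ?enorm_ge0.
  by rewrite mul1r ler_sqr ?nnegrE ?enorm_ge0 ?(ltW D0)// eD//; exact: cl.
have psiB : forall x, Omega x -> `|psi x| <= B.
  move=> x Ox; rewrite ger0_norm// psiE// ge_max B0/=.
  apply: le_trans (ler_norm _) _; apply: le_trans (ler_normB _ _) _.
  rewrite addrC; apply: lerD; first exact: UB (cl _ Ox).
  apply: le_trans (ler_normD _ _) _; apply: lerD; first exact: qB.
  by rewrite ger0_norm// ltW.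
have lfin : lambda1 Omega s p \is a fin_num.
  by rewrite -Ulam ge0_fin_numE ?poweR_ge0//; exact: poweR_lty.
have lE : lambda1 Omega s p = (fine (lambda1 Omega s p))%:E by rewrite fineK.
have l0 : 0 <= fine (lambda1 Omega s p) by rewrite fine_ge0// lambda1_ge0.
have U'1 : (\int[mu]_(x in Omega) (`|U' x| `^ p)%:E = 1)%E.
  by rewrite -Lp_norm_powE// -(eq_Lp_norm UU') U1 poweR1r.
have U'0 : mean_p Omega p U' = 0%E by rewrite -(eq_mean_p UU').
have U'l : (\int[mu]_(x in Omega) \int[mu]_(y in Omega) (dquot s p U' (x, y))%:E =
    (fine (lambda1 Omega s p))%:E)%E.
  have E := eq_gagliardo UU' s p.
  by rewrite -(gagliardo_powE Omega s U' pne) -E Ulam -lE.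
have inside x : Omega x -> 0 < psi x -> `|x0 - x| < r'.
  move=> Ox; rewrite psiE// lt_max ltxx/= ltNge => /negP h; rewrite ltNge; apply/negP => far.
  apply: h; apply: (@arith_outside _ _ (v x) _ _ _ (r' ^+ 2)) => //.
  - exact: phiv (cl _ Ox).
  - exact: Uvj (cl _ Ox).
  - exact: ltW.
  - rewrite ler_sqr ?nnegrE ?enorm_ge0 ?(ltW r'0)//.
    by apply: le_trans (norm_le_enorm _); rewrite distrC.
  - exact: ltW.
have jU x : Omega x -> 0 < psi x -> spow p (phi x0 - e) <= spow p (U' x).
  move=> Ox px; rewrite U'E//; apply: spow_le => //.
  have xr := inside x Ox px.
  have [|h1 _ _] := r2P x; first by rewrite ball_rVE; exact: lt_le_trans r'2.
  exact: arith_low (phiv (cl _ Ox)) (Uvj _ (cl _ Ox)) deltae h1.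
have wx x : Omega x -> 0 < psi x -> U' x + psi x = q x + delta.
  move=> Ox; rewrite psiE// U'E// lt_max ltxx/= => h; rewrite max_r ?(ltW h)//.
  by rewrite addrC subrK.
have wy y : Omega y -> q y + delta <= U' y + psi y.
  by move=> Oy; rewrite psiE// U'E// -lerBlDl le_max lexx orbT.
pose ahat := a `^ (p - 1) * D `^ (- (n%:R + s)).
pose bhat := b' `^ (p - 1) * rho `^ (- (n%:R + s)).
have ahat0 : 0 <= ahat by rewrite mulr_ge0 ?powR_ge0.
have bhat0 : 0 <= bhat by rewrite mulr_ge0 ?powR_ge0.
have ns0 : 0 <= n%:R + s by rewrite addr_ge0// ltW.
have kernel x y : Omega x -> Omega y -> 0 < psi x ->
    spow p ((U' x + psi x) - (U' y + psi y)) / enorm (x - y) `^ (n%:R + s * p) + ahat * \1_N y <= bhat.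
  move=> Ox Oy px; have xr := inside x Ox px.
  have [h1 h2 h3] : [/\ `|phi x - phi x0| <= e / 2, `|phi x - phi x0| <= gap / 3 &
      b * enorm (x - x0) `^ s <= gap / 3].
    by apply: r2P; rewrite ball_rVE; exact: lt_le_trans r'2.
  have K0 : 0 <= (enorm (x - y) `^ (n%:R + s * p))^-1 by rewrite invr_ge0 powR_ge0.
  have dw : (U' x + psi x) - (U' y + psi y) <= q x - q y.
    by rewrite wx//; apply: arith_shift; exact: wy.
  have Sq := ler_wpM2r K0 (spow_le p1 dw).
  have x2 : 0 <= enorm (x - x0) ^+ 2 by exact: sqr_ge0.
  have y2 : enorm (y - x0) ^+ 2 <= D ^+ 2.
    by rewrite ler_sqr ?nnegrE ?enorm_ge0 ?(ltW D0)// eD//; exact: cl.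
  (* Towards N the increment is at most - a t^s, and t <= D makes its contribution at most -
     [ahat]. *)
  have [yN|yN] := pselect (N y).
    have G := hN x y Ox (lt_le_trans xr r'1) yN.
    have xny : x != y.
      apply/eqP => xy; move: G; rewrite xy !subrr enorm0 powR0 ?gt_eqF// mulr0 add0r.
      by rewrite leNgt g0.
    have t0 : 0 < enorm (x - y) by rewrite enorm_gt0 subr_eq0.
    have qq := arith_gap x2 (ltW eta0) y2 G etag.
    have at0 : 0 <= a * enorm (x - y) `^ s by rewrite mulr_ge0 ?powR_ge0.
    have := ler_wpM2r K0 (spow_le p1 qq); rewrite spowN (spow_ge0E p1 at0) mulNr.
    rewrite kernel_power// => Sn.
    rewrite indicE mem_set//= mulr1; apply: le_trans bhat0.
    rewrite -lerBrDr sub0r; apply: le_trans Sq _; apply: le_trans Sn _.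
    rewrite lerN2 ler_wpM2l ?powR_ge0// !powRN lef_pV2 ?posrE ?powR_gt0//.
    by apply: ge0_ler_powR; rewrite ?nnegrE ?(ltW t0) ?(ltW D0)// eD//; exact: cl.
  rewrite indicE memNset//= mulr0 addr0; apply: le_trans Sq _.
  have [xy|xny] := eqVneq x y.
    by rewrite xy !subrr spow0 mul0r.
  have t0 : 0 < enorm (x - y) by rewrite enorm_gt0 subr_eq0.
  have [far|near_] := leP rho (enorm (x - y)).
    have bt0 : 0 <= b' * enorm (x - y) `^ s by rewrite mulr_ge0 ?powR_ge0 ?(ltW b'0).
    have qq : q x - q y <= b' * enorm (x - y) `^ s.
      apply: (arith_far (ltW b0) h2 (hB y (cl _ Oy)) _ h3 etagap _ x2 (ltW eta0) y2).
        have := enorm_powR_triangle y x x0; by rewrite (enorm_subC y x).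
      rewrite ler_wpM2l ?subr_ge0 ?(ltW bb')//.
      by apply: ge0_ler_powR; rewrite ?nnegrE ?(ltW s0) ?(ltW rho0) ?(ltW t0).
    apply: le_trans (ler_wpM2r K0 (spow_le p1 qq)) _; rewrite spow_ge0E//.
    by apply: kernel_far => //; exact: ltW.
  have Ct0 : 0 <= C * enorm (x - y) by rewrite mulr_ge0 ?(ltW C0) ?(ltW t0).
  have xb : ball x0 r x.
    rewrite ball_rVE; apply: lt_le_trans xr _; apply: le_trans r'r _.
    by rewrite ler_pdivrMr// ler_peMr ?(ltW r_gt0)// ler1n.
  have yb : ball x0 r y.
    rewrite ball_rVE; apply: le_lt_trans (ler_distD x _ _) _.
    rewrite [ltRHS]splitr; apply: ltrD; first exact: lt_le_trans r'r.
    apply: le_lt_trans (norm_le_enorm _) _; exact: lt_le_trans rhor.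
  have qq : q x - q y <= C * enorm (x - y).
    apply: arith_near => //; [exact: ltW|exact: ltW| |].
      apply: le_trans (lip _ _ yb xb) _; rewrite ler_wpM2l//; exact: norm_le_enorm.
    apply: sqr_diff_le; rewrite ?enorm_ge0 ?eD//; try exact: cl.
    have := enorm_dist (x - x0) (y - x0); by rewrite opprB addrA subrK.
  apply: le_trans (ler_wpM2r K0 (spow_le p1 qq)) _; rewrite spow_ge0E//.
  by apply: kernel_near => //; exact: ltW.
have I0 : 0 < \int[mu]_(x in Omega) psi x.
  have ipsi : mu.-integrable Omega (EFin \o psi).
    by apply: bounded_integrable psiB => //; [exact: domain_finite dom|exact: measurable_funTS].
  rewrite -lte_fin -EFin_Rintegral//.
  have low : ((delta / 4)%:E * mu A <= \int[mu]_(x in Omega) (psi x)%:E)%E.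
    apply: integral_ge_sub => //; first exact: measurable_funTS.
      by rewrite divr_ge0// ltW.
    move=> x Ax; rewrite psiE ?le_max; last exact: AO.
    apply/orP; right; apply: arith_inside (Aq x Ax) _; apply: Uvj; apply: cl; exact: AO.
  by apply: lt_le_trans low; rewrite mule_gt0// lte_fin divr_gt0.
have := @minimizer_bound R n Omega s dom p (fine (lambda1 Omega s p)) U' psi B
  (spow p (phi x0 - e)) p2 l0 lE mU' mpsi U'B psiB psi0 B0 U'1 U'0 jU N ahat bhat
  mN NO ahat0 bhat0 U'l kernel I0.
move=> h; apply: le_trans h _; rewrite /bhat -/V.
by rewrite le_eqVlt; apply/orP; left; apply/eqP; ring.
Unshelve. all: by end_near. Qed.

End touching.

(** * Consequences of the touching inequality *)

Section viscosity_arith.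
Context (R : realType).
Implicit Types (L f b d : R).

(** Prepares a lower bound for the eigenvalue term when f - e may be negative: as (L + t) m <= b',
    its negative part (L + t)^p m^(p-1) is at most (L + t) b'^(p-1). *)
Lemma arith_low_slack L f b b' : 0 < L -> 0 < b -> b < b' -> - (L * f) <= b ->
  exists e t m, [/\ 0 < e, 0 < t, 0 <= m, - m <= f - e & (L + t) * m <= b'].
Proof.
move=> L0 b0 bb' Lf; have d0 : 0 < (b' - b) / 2 by rewrite divr_gt0// subr_gt0.
have M0 : 0 < `|f| + 1 by rewrite ltr_wpDl.
pose t := (b' - b) / 2 / (`|f| + 1).
have t0 : 0 < t by rewrite divr_gt0.
have tE : t * (`|f| + 1) = (b' - b) / 2 by rewrite /t divfK// gt_eqF.
pose e := Num.min 1 ((b' - b) / 2 / L).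
have e0 : 0 < e by rewrite lt_min ltr01 divr_gt0.
have e1 : e <= 1 by rewrite ge_min lexx.
have eL : L * e <= (b' - b) / 2 by rewrite mulrC -ler_pdivlMr// ge_min lexx orbT.
exists e, t, (Num.max 0 (e - f)); split => //.
- by rewrite le_max lexx.
- by rewrite lerNl opprB le_max lexx orbT.
- case: (leP 0 (e - f)) => h; last first.
    by rewrite mulr0 ltW// (lt_trans b0).
  have h1 : e - f <= `|f| + 1.
    by rewrite addrC lerD// -normrN ler_norm.
  have := ler_wpM2l (ltW t0) h1; rewrite tE mulrDl mulrBr; lra.
Qed.

(** The factor 1 - k occurs twice because both the eigenvalue and the value of phi are lowered. The
    loss is less than a third of L f - b, so b', a third of the way from b to L f, stays below. *)
Lemma arith_high_slack L f b : 0 < b -> b < L * f ->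
  exists k b', [/\ 0 < k, k < 1, b < b' & b' < L * (1 - k) * ((1 - k) * f)].
Proof.
move=> b0 bLf; have Lf0 : 0 < L * f by exact: lt_trans bLf.
pose k := (L * f - b) / (6 * (L * f)).
have kE : k * (L * f) = (L * f - b) / 6.
  by rewrite /k invfM -!mulrA mulVf ?mulr1// gt_eqF.
have k0 : 0 < k by rewrite divr_gt0 ?subr_gt0// mulr_gt0.
have k1 : k < 1 by rewrite -(ltr_pM2r Lf0) kE mul1r; lra.
exists k, ((L * f + 2 * b) / 3); split => //; first by lra.
have -> : L * (1 - k) * ((1 - k) * f) = L * f - 2 * (k * (L * f)) + k ^+ 2 * (L * f) by ring.
have h : 0 <= k ^+ 2 * (L * f) by rewrite mulr_ge0 ?sqr_ge0 ?ltW.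
by rewrite kE; lra.
Qed.

Lemma arith_separation (a t h t1 t2 x x' y y' g : R) : 0 <= a -> h <= t1 + (t + t2) ->
  a * t1 <= g / 8 -> a * t2 <= g / 8 -> `|x - x'| <= g / 4 -> `|y - y'| <= g / 4 ->
  y - x = a * t + g -> a * h + g / 4 <= y' - x'.
Proof.
move=> a0 /(ler_wpM2l a0); rewrite !mulrDr => h1 h2 h3.
by rewrite !ler_norml => /andP[h4 h5] /andP[h6 h7] h8; lra.
Qed.

Lemma powR_predE (p a : R) : 0 < a -> a `^ p = a * a `^ (p - 1).
Proof.
move=> a0; have ane : (1 + (p - 1) == 0) ==> (a != 0) by rewrite (gt_eqF a0) implybT.
by have := powRD ane; rewrite powRr1 ?ltW// [1 + _]addrC subrK.
Qed.

Lemma arith_contra C l A B E (w : R) :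
  - (l * B) + 2 * (A * E) * w <= C * B -> (C + l) * B < 2 * E * w * A -> False.
Proof.
have -> : 2 * E * w * A = 2 * (A * E) * w by ring.
by rewrite mulrDl; lra.
Qed.

End viscosity_arith.

Section viscosity_core.
Context (R : realType) (n : nat) (Omega : set 'rV[R]_n) (s : R).
Local Notation mu := (@lebesgue_rV R n).
Hypotheses (n_gt0 : (0 < n)%N) (dom : smooth_bounded_domain Omega) (s0 : 0 < s) (s1 : s < 1).

Let oO : open Omega. Proof. by case: dom. Qed.
Let bO : bounded_set Omega. Proof. by case: dom. Qed.
Let neO : Omega !=set0. Proof. by case: dom. Qed.

Local Notation D := (diam Omega).
Local Notation Lam := (2 / D `^ s).

Let D0 : 0 < D. Proof. exact: diam_gt0. Qed.
Let Lam0 : 0 < Lam. Proof. exact: Lam_gt0. Qed.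

Lemma C0_closure_near (u : 'rV[R]_n -> R) y e : C0_closure Omega u -> closure Omega y ->
  0 < e -> \forall z \near y, closure Omega z -> `|u y - u z| < e.
Proof.
move=> cu cy e0; have h := @cvgr_dist_lt _ R^o _ _ _ _ _ (cu y) _ e0.
have : within (closure Omega) (nbhs y) (fun z => `|u y - u z| < e).
  by rewrite nbhs_subspace_in//; exact: h.
exact.
Qed.

Lemma lambda1_fin p b : (lambda1 Omega s p <= b%:E)%E ->
  lambda1 Omega s p = (fine (lambda1 Omega s p))%:E.
Proof.
move=> lb; rewrite fineK// ge0_fin_numE ?lambda1_ge0//.
by apply: le_lt_trans lb _; rewrite ltry.
Qed.

Variables (p_ : nat -> R) (U_ : nat -> 'rV[R]_n -> R) (v : 'rV[R]_n -> R).
Hypotheses (pj : p_ @ \oo --> +oo).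
Hypotheses (U_min : forall j, normalized_minimizer Omega s (p_ j) (U_ j)).
Hypothesis Uv : forall e, 0 < e -> \forall j \near \oo, forall x, closure Omega x -> `|U_ j x - v x| <= e.
Hypothesis cv : C0_closure Omega v.

Variables (phi : 'rV[R]_n -> R) (x0 : 'rV[R]_n).
Hypotheses (Cphi : C1_closure Omega phi) (Ox0 : Omega x0) (phiv0 : phi x0 = v x0).
Hypothesis phiv : forall y, closure Omega y -> phi y <= v y.

Let cphi : C0_closure Omega phi. Proof. exact: Cphi.1. Qed.

(** If a forward quotient exceeded b, those towards a small set N around y0 would exceed some a >
    b'. The gain of rate a would then beat the loss of rate b' and also the eigenvalue term, whose
    negative part has rate at most b' because - Lam phi(x0) <= b. *)
Lemma touching_forward_quotient b : 0 < b ->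
  (forall y, closure Omega y -> phi x0 - phi y <= b * enorm (y - x0) `^ s) ->
  - (Lam * phi x0) <= b ->
  forall y, closure Omega y -> phi y - phi x0 <= b * enorm (y - x0) `^ s.
Proof.
move=> b0 hB Lb y0 cy0; rewrite leNgt; apply/negP => bad.
have y0x0 : y0 != x0.
  by apply/eqP => yx; move: bad; rewrite yx !subrr enorm0 powR0 ?gt_eqF// mulr0 ltxx.
pose t0 := enorm (y0 - x0) `^ s.
have t0_gt0 : 0 < t0 by rewrite powR_gt0// enorm_gt0 subr_eq0.
pose d := phi y0 - phi x0 - b * t0.
have d_gt0 : 0 < d by rewrite subr_gt0.
(* The excess d is cut in three: b' = b + q, a = b + 2 q, and the last third is the margin, of which
   d / 12 survives when x and y move. *)
pose q := d / 3 / t0.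
have q0 : 0 < q by rewrite !divr_gt0.
have qE : q * t0 = d / 3 by rewrite divfK// gt_eqF.
have bb' : b < b + q by rewrite ltrDl.
have ba : b + q < b + q + q by rewrite ltrDl.
have a0 : 0 < b + q + q by rewrite !addr_gt0.
have g8 : 0 < d / 3 / 8 by rewrite !divr_gt0.
have g4 : 0 < d / 3 / 4 by rewrite !divr_gt0.
have [e [t [m [e0 t_gt0 m0 me Lm]]]] := arith_low_slack Lam0 b0 bb' Lb.
have : \forall y \near y0, (closure Omega y -> `|phi y0 - phi y| < d / 3 / 4) /\
    (b + q + q) * enorm (y - y0) `^ s <= d / 3 / 8.
  by apply: filterI; [exact: C0_closure_near|exact: near_enorm_small (ltW a0) g8].
move=> /nbhs_ballP[r /= r0 rP].
have : \forall x \near x0, (closure Omega x -> `|phi x0 - phi x| < d / 3 / 4) /\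
    (b + q + q) * enorm (x - x0) `^ s <= d / 3 / 8.
  apply: filterI; last exact: near_enorm_small (ltW a0) g8.
  by apply: C0_closure_near => //; exact: subset_closure.
move=> /nbhs_ballP[r1 /= r10 r1P].
pose N := ball y0 r `&` Omega.
have oN : open N by apply: openI => //; exact: ball_open.
have N0 : (0 < mu N)%E.
  apply: lebesgue_rV_open_gt0 => //; have [z [Oz yz]] := cy0 _ (nbhsx_ballx y0 r r0).
  by exists z.
have mN : measurable N by exact: measurable_open_rV.
have NO : N `<=` Omega by move=> ? [].
have muN : 0 < fine (mu N).
  apply: fine_gt0; rewrite N0/=; apply: le_lt_trans (domain_finite dom).
  by apply: le_measure; rewrite ?inE//; exact: domain_measurable dom.
have hN x y : Omega x -> `|x0 - x| < r1 -> N y ->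
    (b + q + q) * enorm (x - y) `^ s + d / 3 / 4 <= phi y - phi x.
  move=> Ox xr [yr Oy].
  have [|h1 h2] := r1P x; first by rewrite ball_rVE.
  have [h3 h4] := rP y yr.
  refine (@arith_separation _ _ t0 _ (enorm (x - x0) `^ s) (enorm (y - y0) `^ s)
    (phi x0) _ (phi y0) _ _ (ltW a0) _ h2 h4 _ _ _).
  - apply: le_trans (enorm_powR_triangle s0 s1 x x0 y) _; rewrite lerD2l.
    rewrite /t0 (enorm_subC y0) (enorm_subC y); exact: enorm_powR_triangle.
  - by apply/ltW/h1; exact: subset_closure.
  - by apply/ltW/h3; exact: subset_closure.
  - by rewrite -addrA mulrDl mulrDl qE /d; field.
have [C hC] := touching_bound n_gt0 dom s0 s1 pj U_min Uv cv Cphi Ox0 phiv0 phiv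
  b0 bb' e0 (ltW a0) g4 r10 hB mN NO hN.
pose c := 2 * D `^ (- (n%:R + s)) * fine (mu N).
have c0 : 0 < c by rewrite !mulr_gt0// powR_gt0.
have b'0 : 0 <= b + q by rewrite addr_ge0 ?ltW.
have dominated := pj (near_powR_dominated_pred (C + (Lam + t)) b'0 ba c0).
have Lt : Lam < Lam + t by rewrite ltrDl.
have Lt0 : 0 < Lam + t by exact: lt_trans Lt.
have up := pj (lambda1_upper n_gt0 dom s1 Lt).
have gt1 : \forall j \near \oo, 1 < p_ j by exact: near_seq_gt1.
have : \forall j \near \oo, False.
  near=> j.
  have p1 : 1 < p_ j by near: j.
  have up_j : (lambda1 Omega s (p_ j) <= ((Lam + t) `^ p_ j)%:E)%E by near: j.
  have h1 : fine (lambda1 Omega s (p_ j)) * spow (p_ j) (phi x0 - e) +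
      2 * ((b + q + q) `^ (p_ j - 1) * D `^ (- (n%:R + s))) * fine (mu N) <= C * (b + q) `^ (p_ j - 1).
    by near: j.
  have h2 : (C + (Lam + t)) * (b + q) `^ (p_ j - 1) < c * (b + q + q) `^ (p_ j - 1) by near: j.
  have lE := lambda1_fin up_j.
  have lo : - ((Lam + t) * (b + q) `^ (p_ j - 1)) <=
      fine (lambda1 Omega s (p_ j)) * spow (p_ j) (phi x0 - e).
    have l0 : 0 <= fine (lambda1 Omega s (p_ j)) by rewrite fine_ge0// lambda1_ge0.
    apply: le_trans (ler_wpM2l l0 (spow_le p1 me)); rewrite spowN (spow_ge0E p1 m0) mulrN lerN2.
    have lt_ : fine (lambda1 Omega s (p_ j)) <= (Lam + t) `^ (p_ j).
      by rewrite -lee_fin -lE.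
    apply: le_trans (ler_wpM2r (powR_ge0 _ _) lt_) _.
    rewrite (powR_predE _ Lt0) -mulrA -powRM ?(ltW Lt0)// ler_wpM2l ?(ltW Lt0)//.
    by apply: ge0_ler_powR; rewrite ?nnegrE ?subr_ge0 ?(ltW p1)// mulr_ge0// ltW.
  move: (le_trans (lerD lo (lexx _)) h1) h2; rewrite /c.
  exact: arith_contra.
by case/filter_ex.
Unshelve. all: by end_near. Qed.

End viscosity_core.

(** * One-sided quotients and the supersolution inequalities *)

Section touching_operator.
Context (R : realType) (n : nat) (Omega : set 'rV[R]_n) (s : R).
Hypotheses (n_gt0 : (0 < n)%N) (dom : smooth_bounded_domain Omega) (s0 : 0 < s) (s1 : s < 1).

Let oO : open Omega. Proof. by case: dom. Qed.
Let bO : bounded_set Omega. Proof. by case: dom. Qed.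
Let neO : Omega !=set0. Proof. by case: dom. Qed.

Local Notation D := (diam Omega).
Local Notation Lam := (2 / D `^ s).

Let D0 : 0 < D. Proof. exact: diam_gt0. Qed.
Let Lam0 : 0 < Lam. Proof. exact: Lam_gt0. Qed.

(** The first term of the constant comes from the Lipschitz bound near x0, the second from
    boundedness at distance at least r. *)
Lemma C1_pointwise_holder (phi : 'rV[R]_n -> R) x0 : C1_closure Omega phi -> Omega x0 ->
  exists2 K, 0 <= K & forall y, closure Omega y -> `|phi y - phi x0| <= K * enorm (y - x0) `^ s.
Proof.
move=> Cphi Ox0; have [r [L [r0 L0 rO lip]]] := C1_local_lipschitz dom Cphi Ox0.
have [B B0 phiB] := C0_closure_bounded bO neO Cphi.1.
have K1 : 0 <= L * D `^ (1 - s) by rewrite mulr_ge0 ?powR_ge0.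
have K2 : 0 <= (B + B) / r `^ s by rewrite divr_ge0 ?addr_ge0 ?powR_ge0.
exists (L * D `^ (1 - s) + (B + B) / r `^ s) => [|y cy]; first by rewrite addr_ge0.
have yD : enorm (y - x0) <= D by apply: enorm_le_diam => //; exact: subset_closure.
have [yr|ry] := ltP `|x0 - y| r.
  apply: (@le_trans _ _ (L * D `^ (1 - s) * enorm (y - x0) `^ s)); last first.
    by rewrite ler_wpM2r ?powR_ge0// lerDl.
  apply: le_trans (lip _ _ (ballxx x0 r0) _) _; first by rewrite ball_rVE.
  rewrite -mulrA ler_wpM2l//; apply: le_trans (norm_le_enorm _) _.
  have [->|e0] := eqVneq (enorm (y - x0)) 0; first by rewrite mulr_ge0 ?powR_ge0.
  rewrite [leLHS](_ : _ = enorm (y - x0) `^ (1 - s) * enorm (y - x0) `^ s); last first.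
    by rewrite -powRD ?subrK ?powRr1 ?enorm_ge0// oner_eq0.
  rewrite ler_wpM2r ?powR_ge0//; apply: ge0_ler_powR; rewrite ?nnegrE ?enorm_ge0 ?(ltW D0)//.
  - by rewrite subr_ge0 ltW.
apply: (@le_trans _ _ ((B + B) / r `^ s * enorm (y - x0) `^ s)); last first.
  by rewrite ler_wpM2r ?powR_ge0// lerDr.
apply: (@le_trans _ _ (B + B)).
  apply: le_trans (ler_normB _ _) _; apply: lerD; apply: phiB => //; exact: subset_closure.
rewrite -mulrA ler_peMr ?addr_ge0// mulrC ler_pdivlMr ?powR_gt0// mul1r.
apply: ge0_ler_powR; rewrite ?nnegrE ?enorm_ge0 ?(ltW s0) ?(ltW r0)//.
by apply: le_trans ry _; rewrite distrC; exact: norm_le_enorm.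
Qed.

(** Finiteness follows from the pointwise Hoelder bound. The supremum is nonnegative because s < 1
    makes the quotients of a C^1 function tend to 0 as y tends to x0. *)
Lemma Lplus_real (phi : 'rV[R]_n -> R) x0 : C1_closure Omega phi -> Omega x0 ->
  exists A, [/\ 0 <= A, Lplus Omega s phi x0 = A%:E,
    forall y, closure Omega y -> phi y - phi x0 <= A * enorm (y - x0) `^ s &
    forall b, (forall y, closure Omega y -> phi y - phi x0 <= b * enorm (y - x0) `^ s) -> A <= b].
Proof.
move=> Cphi Ox0; have [K K0 hK] := C1_pointwise_holder Cphi Ox0.
have quot b y : y != x0 -> ((phi y - phi x0) / enorm (y - x0) `^ s <= b) =
    (phi y - phi x0 <= b * enorm (y - x0) `^ s).
  by move=> yx; rewrite ler_pdivrMr// powR_gt0// enorm_gt0 subr_eq0.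
have ub b : (forall y, closure Omega y -> phi y - phi x0 <= b * enorm (y - x0) `^ s) ->
    (Lplus Omega s phi x0 <= b%:E)%E.
  move=> hb; apply: ge_ereal_sup => _ [y [cy /eqP yx] <-].
  by rewrite lee_fin quot//; exact: hb.
have A_ge0 : (0 <= Lplus Omega s phi x0)%E.
  apply/lee_addgt0Pr => e e0; rewrite -leeBlDr// sub0e.
  have [r [L [r0 L0 rO lip]]] := C1_local_lipschitz dom Cphi Ox0.
  have s1' : 0 < 1 - s by rewrite subr_gt0.
  have : \forall y \near x0, ball x0 r y /\ L * enorm (y - x0) `^ (1 - s) <= e.
    by apply: filterI; [exact: nbhsx_ballx|exact: near_enorm_small].
  move=> /nbhs_ballP[d /= d0 dP]; pose y := x0 + const_mx (d / 2).
  have yx : y != x0.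
    apply/eqP => /rowP/(_ (Ordinal n_gt0)); rewrite !mxE => /eqP.
    by rewrite -subr_eq0 addrAC subrr add0r mulf_eq0 invr_eq0 pnatr_eq0 (gt_eqF d0).
  have yd : ball x0 d y.
    rewrite ball_rVE; apply: normr_rV_lt => // i.
    by rewrite !mxE opprD addNKr normrN ger0_norm ?divr_ge0 ?(ltW d0)// ltr_pdivrMr// ltr_pMr// ltr1n.
  have [yr ye] := dP y yd.
  have e_gt0 : 0 < enorm (y - x0) by rewrite enorm_gt0 subr_eq0.
  apply: (@le_trans _ _ ((phi y - phi x0) / enorm (y - x0) `^ s)%:E); last first.
    by apply: ereal_sup_ubound; exists y => //; split; [exact/subset_closure/rO|exact/eqP].
  rewrite lee_fin ler_pdivlMr ?powR_gt0// mulNr lerNl.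
  apply: (@le_trans _ _ `|phi y - phi x0|); first by rewrite -normrN ler_norm.
  apply: le_trans (lip _ _ (ballxx x0 r0) yr) _.
  apply: le_trans (ler_wpM2r (powR_ge0 (enorm (y - x0)) s) ye).
  rewrite -mulrA -powRD ?subrK ?powRr1 ?(ltW e_gt0) ?oner_eq0//.
  by rewrite ler_wpM2l// norm_le_enorm.
have Afin : Lplus Omega s phi x0 = (fine (Lplus Omega s phi x0))%:E.
  rewrite fineK// ge0_fin_numE//; apply: le_lt_trans (ub K _) (ltry _) => y cy.
  by apply: le_trans (ler_norm _) _; exact: hK.
exists (fine (Lplus Omega s phi x0)); split => //.
- by rewrite fine_ge0.
- move=> y cy; have [->|yx] := eqVneq y x0.
    by rewrite subrr mulr_ge0 ?powR_ge0// fine_ge0.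
  rewrite -quot// -lee_fin -Afin; apply: ereal_sup_ubound; exists y => //.
  by split => //; exact/eqP.
- by move=> b hb; rewrite -lee_fin -Afin; exact: ub.
Qed.

Lemma LminusN (phi : 'rV[R]_n -> R) x0 :
  Lminus Omega s phi x0 = (- Lplus Omega s (fun x => - phi x)%R x0)%E.
Proof.
rewrite /Lminus /ereal_inf /Lplus; congr (- ereal_sup _)%E.
apply/seteqP; split => [_ [_ [y cy <-] <-]|_ [y cy <-]].
  by exists y => //; rewrite -EFinN -mulNr opprB opprK addrC.
exists ((phi y - phi x0) / enorm (y - x0) `^ s)%:E; first by exists y.
by rewrite -EFinN -mulNr opprB opprK addrC.
Qed.

Section touching.
Variables (p_ : nat -> R) (U_ : nat -> 'rV[R]_n -> R) (v : 'rV[R]_n -> R).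
Hypotheses (pj : p_ @ \oo --> +oo).
Hypotheses (U_min : forall j, normalized_minimizer Omega s (p_ j) (U_ j)).
Hypothesis Uv : forall e, 0 < e -> \forall j \near \oo, forall x, closure Omega x -> `|U_ j x - v x| <= e.
Hypothesis cv : C0_closure Omega v.

Variables (phi : 'rV[R]_n -> R) (x0 : 'rV[R]_n).
Hypotheses (Cphi : C1_closure Omega phi) (Ox0 : Omega x0) (phiv0 : phi x0 = v x0).
Hypothesis phiv : forall y, closure Omega y -> phi y <= v y.

Lemma touching_eigenvalue b : 0 < b ->
  (forall y, closure Omega y -> phi x0 - phi y <= b * enorm (y - x0) `^ s) ->
  Lam * phi x0 <= b.
Proof.
move=> b0 hB; rewrite leNgt; apply/negP => bad.
have f0 : 0 < phi x0 by rewrite -(pmulr_rgt0 _ Lam0) (lt_trans b0).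
have [k [b' [k0 k1 bb' b'a]]] := arith_high_slack b0 bad.
have k1' : 0 < 1 - k by rewrite subr_gt0.
have e0 : 0 < k * phi x0 by rewrite mulr_gt0.
have none x y : Omega x -> `|x0 - x| < 1 -> set0 y ->
    0 * enorm (x - y) `^ s + 1 <= phi y - phi x by [].
have [C hC] := touching_bound n_gt0 dom s0 s1 pj U_min Uv cv Cphi Ox0 phiv0 phiv
  b0 bb' e0 (lexx 0) ltr01 ltr01 hB measurable0 (@sub0set _ _) none.
have b'0 : 0 <= b' by rewrite ltW// (lt_trans b0).
have Lk0 : 0 < Lam * (1 - k) by rewrite mulr_gt0.
have Lk : Lam * (1 - k) < Lam by rewrite gtr_pMr// gtrBl.
have dominated := pj (near_powR_dominated_pred C b'0 b'a Lk0).
have low := pj (lambda1_lower n_gt0 dom s0 s1 (ltW Lk0) Lk).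
have up := pj (lambda1_upper n_gt0 dom s1 (_ : Lam < Lam + 1)).
have gt1 : \forall j \near \oo, 1 < p_ j by exact: near_seq_gt1.
have : \forall j \near \oo, False.
  near=> j.
  have p1 : 1 < p_ j by near: j.
  have up_j : (lambda1 Omega s (p_ j) <= ((Lam + 1) `^ p_ j)%:E)%E.
    by near: j; apply: up; rewrite ltrDl.
  have lE := lambda1_fin up_j.
  have low_j : (((Lam * (1 - k)) `^ p_ j)%:E <= lambda1 Omega s (p_ j))%E by near: j.
  have h1 : fine (lambda1 Omega s (p_ j)) * spow (p_ j) (phi x0 - k * phi x0) +
      2 * (0 `^ (p_ j - 1) * D `^ (- (n%:R + s))) * fine (lebesgue_rV R n set0) <= C * b' `^ (p_ j - 1).
    by near: j.
  have h2 : C * b' `^ (p_ j - 1) < Lam * (1 - k) *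
      (Lam * (1 - k) * ((1 - k) * phi x0)) `^ (p_ j - 1) by near: j.
  have kf0 : 0 <= (1 - k) * phi x0 by rewrite mulr_ge0 ?ltW.
  move: low_j h1; rewrite lE lee_fin measure0 /= mulr0 addr0.
  rewrite -[X in X - k * _]mul1r -mulrBl (spow_ge0E p1 kf0) (powR_predE _ Lk0) => l1 h1.
  have := le_lt_trans (le_trans (ler_wpM2r (powR_ge0 _ _) l1) h1) h2.
  by rewrite (powRM (p_ j - 1) (ltW Lk0) kf0) [ltRHS]mulrA ltxx.
by case/filter_ex.
Unshelve. all: by end_near. Qed.

(** The two preceding results ask for a strictly positive b; they are applied with an arbitrarily
    small excess e. *)
Lemma touching_operator_le A B : 0 <= B ->
  (forall y, closure Omega y -> phi x0 - phi y <= B * enorm (y - x0) `^ s) ->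
  (forall b, (forall y, closure Omega y -> phi y - phi x0 <= b * enorm (y - x0) `^ s) -> A <= b) ->
  A <= Num.max B (- (Lam * phi x0)) /\ Lam * phi x0 <= B.
Proof.
move=> B0 hB hA.
have hBb b y : B <= b -> closure Omega y -> phi x0 - phi y <= b * enorm (y - x0) `^ s.
  by move=> Bb cy; apply: le_trans (hB y cy) _; rewrite ler_wpM2r ?powR_ge0.
split; apply/ler_addgt0Pr => e e0.
  have Bm : B <= Num.max B (- (Lam * phi x0)) + e.
    by rewrite (@le_trans _ _ (Num.max B (- (Lam * phi x0))))// ?lerDl ?(ltW e0)// le_max lexx.
  apply: hA; apply: (touching_forward_quotient n_gt0 dom s0 s1 pj U_min Uv cv Cphi Ox0 phiv0 phiv) => //.
  - by rewrite ltr_wpDl// le_max B0.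
  - by move=> y; exact: hBb.
  - by rewrite (@le_trans _ _ (Num.max B (- (Lam * phi x0))))// ?lerDl ?(ltW e0)// le_max lexx orbT.
apply: touching_eigenvalue => [|y]; first by rewrite ltr_wpDl.
by apply: hBb; rewrite lerDl ltW.
Qed.

End touching.
End touching_operator.

(** * Change of sign *)

Section minimizer_opp.
Context (R : realType) (n : nat) (Omega : set 'rV[R]_n).
Local Notation mu := (@lebesgue_rV R n).
Hypotheses (mO : measurable Omega) (Ofin : (mu Omega < +oo)%E).
Implicit Types (s p : R) (u : 'rV[R]_n -> R).

Lemma gagliardoN s p u : gagliardo Omega s p (fun x => - u x) = gagliardo Omega s p u.
Proof.
rewrite /gagliardo; apply: (f_equal (fun t : \bar R => poweR t (GRing.inv p))).
by apply: eq_integral => x _; apply: eq_integral => y _; rewrite -opprD normrN.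
Qed.

Lemma normalized_minimizerN s p u : 1 < p -> normalized_minimizer Omega s p u ->
  normalized_minimizer Omega s p (fun x => - u x).
Proof.
move=> p1 [[mu_ up ug] u1 u0 ul cu].
have pne : p != 0 by rewrite gt_eqF// (lt_trans _ p1).
have LN : Lp_norm Omega p%:E (fun x => - u x) = Lp_norm Omega p%:E u.
  rewrite (Lp_normE Omega (fun x => - u x) pne) (Lp_normE Omega u pne); apply: (f_equal (fun t : \bar R => poweR t (GRing.inv p))).
  by apply: eq_integral => x _; rewrite normrN.
have gN := gagliardoN s p u.
split.
- by split; [exact: measurableT_comp|rewrite LN|rewrite gN].
- by rewrite LN.
- have fin : (\int[mu]_(x in Omega) (`|u x| `^ p)%:E < +oo)%E.
    by clear up ug; rewrite -(Lp_norm_powE Omega u pne) u1 poweR1r ltry.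
  have int := integrable_spow mO p1 Ofin mu_ fin.
  move: u0; rewrite !mean_pE => u0.
  under eq_integral do rewrite spowN -mulN1r EFinM.
  by rewrite (integralZl mO int) u0 mule0.
- by rewrite gN.
- move=> /cu cu' x; apply: (@continuousN R R^o); exact: cu'.
Qed.

End minimizer_opp.

Section eigen_arith.
Context (R : realType).
Implicit Types (L f A B : R).

(** A and - B stand for [Lplus] and [Lminus] of the test function. For f >= 0 the maximum is B; for
    f < 0 either alternative makes one of the two terms of the minimum nonpositive. *)
Lemma arith_super L f A B : 0 < L -> 0 <= B -> A <= Num.max B (- (L * f)) -> L * f <= B ->
  (if 0 < f then Num.max (A - B) (- B + L * f)
   else if f == 0 then A - B else Num.min (A - B) (A + L * f)) <= 0.
Proof.
move=> L0 B0 h1 h2; case: ifP => [f0|].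
  have Lf0 : 0 < L * f by exact: mulr_gt0.
  rewrite ge_max; move: h1; rewrite max_l; last by lra.
  by move=> h1; apply/andP; split; lra.
move=> f0; case: ifP => [/eqP fz|fz].
  by move: h1; rewrite fz mulr0 oppr0 max_l// subr_le0.
by rewrite ge_min; move: h1; rewrite le_max => /orP[h|h]; apply/orP; [left|right]; lra.
Qed.

(** Mirror image of [arith_super]: A and B exchange roles and f becomes - f, as for the test
    function - phi. *)
Lemma arith_sub L f A B : 0 < L -> 0 <= A -> B <= Num.max A (- (L * - f)) -> L * - f <= A ->
  0 <= (if 0 < f then Num.max (A - B) (- B + L * f)
   else if f == 0 then A - B else Num.min (A - B) (A + L * f)).
Proof.
rewrite mulrN opprK => L0 A0 h1 h2; case: ifP => [f0|].
  by rewrite le_max; move: h1; rewrite le_max => /orP[h|h]; apply/orP; [left|right]; lra.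
move=> /negbT; rewrite -leNgt => f0; case: ifP => [/eqP fz|fz].
  by move: h1; rewrite fz mulr0 max_l// subr_ge0.
have Lf0 : L * f <= 0 by rewrite pmulr_rle0.
rewrite le_min; move: h1; rewrite max_l; last by lra.
by move=> h1; apply/andP; split; lra.
Qed.

End eigen_arith.

(** * The limit is a viscosity solution *)

Section viscosity.
Context (R : realType) (n : nat) (Omega : set 'rV[R]_n) (s : R).
Local Notation mu := (@lebesgue_rV R n).
Hypotheses (n_gt0 : (0 < n)%N) (dom : smooth_bounded_domain Omega) (s0 : 0 < s) (s1 : s < 1).

Let oO : open Omega. Proof. by case: dom. Qed.

Local Notation D := (diam Omega).
Local Notation Lam := (2 / D `^ s).

Let Lam0 : 0 < Lam. Proof. exact: Lam_gt0. Qed.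

Lemma C1_closureN (phi : 'rV[R]_n -> R) : C1_closure Omega phi ->
  C1_closure Omega (fun x => - phi x).
Proof.
move=> [cphi dphi]; split=> [x|i]; first by apply: (@continuousN R R^o); exact: cphi.
have [dx [g cg gE]] := dphi i; split => [x Ox|]; first exact/derivableN/dx.
exists (fun x => - g x) => [x|x Ox]; first by apply: (@continuousN R R^o); exact: cg.
by rewrite (deriveN (dx x Ox)) gE.
Qed.

Lemma eigen_opE (phi : 'rV[R]_n -> R) x A B :
  Lplus Omega s phi x = A%:E -> Lminus Omega s phi x = (- B)%:E ->
  eigen_op Omega s phi x =
  (if 0 < phi x then Num.max (A - B) (- B + Lam * phi x)
   else if phi x == 0 then A - B else Num.min (A - B) (A + Lam * phi x))%:E.
Proof.
move=> EA EB; rewrite /eigen_op /Linfty EA EB (lambda1_inftyE n_gt0 dom s0 s1).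
by case: ifP => _; [|case: ifP => _]; rewrite ?EFin_max ?EFin_min.
Qed.

(** Every neighbourhood of a point of the closure meets Omega in a set of positive measure, so the
    equality reaches boundary points as well. *)
Lemma C0_closure_ae_eq (u w : 'rV[R]_n -> R) : C0_closure Omega u -> C0_closure Omega w ->
  {ae mu, forall x, Omega x -> u x = w x} -> forall x, closure Omega x -> u x = w x.
Proof.
move=> cu cw uw z cz; apply/eqP; rewrite -subr_eq0 -normr_eq0; apply/negPn/negP => ne.
have d0 : 0 < `|u z - w z| / 2 by rewrite divr_gt0// lt_def ne normr_ge0.
have : \forall y \near z, (closure Omega y -> `|u z - u y| < `|u z - w z| / 2) /\
    (closure Omega y -> `|w z - w y| < `|u z - w z| / 2).
  by apply: filterI; exact: C0_closure_near.
move=> /nbhs_ballP[r /= r0 rP]; pose N := ball z r `&` Omega.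
have oN : open N by apply: openI => //; exact: ball_open.
have [|||y [yr Oy] E] := ae_exists (A := N) uw.
- exact: measurable_open_rV.
- by move=> ? [].
- apply: lebesgue_rV_open_gt0 => //; have [y [Oy yz]] := cz _ (nbhsx_ballx z r r0).
  by exists y.
have [h1 h2] := rP y yr.
have cy : closure Omega y by exact: subset_closure.
have := ltrD (h1 cy) (h2 cy); rewrite -splitr ltNge => /negP; apply.
by rewrite (distrC (w z)) -E; exact: ler_distD.
Qed.

Variables (p_ : nat -> R) (U_ : nat -> 'rV[R]_n -> R) (v : 'rV[R]_n -> R).
Hypotheses (pj : p_ @ \oo --> +oo) (p_gt1 : forall j, 1 < p_ j).
Hypotheses (U_min : forall j, normalized_minimizer Omega s (p_ j) (U_ j)).
Hypothesis Uv : forall e, 0 < e -> \forall j \near \oo, forall x, closure Omega x -> `|U_ j x - v x| <= e.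
Hypothesis cv : C0_closure Omega v.

(** A test function above v becomes one below - v, which is the limit of the normalized minimizers
    [- U_ j]; the largest forward and backward quotients exchange roles. *)
Lemma limit_viscosity_solution : viscosity_solution Omega s v.
Proof.
split; split => // x0 phi Ox0 Cphi phiv0 phiv.
  have [A [A0 EA hA minA]] := Lplus_real n_gt0 dom s0 s1 Cphi Ox0.
  have [B [B0 EB hB minB]] := Lplus_real n_gt0 dom s0 s1 (C1_closureN Cphi) Ox0.
  have hB' y : closure Omega y -> phi x0 - phi y <= B * enorm (y - x0) `^ s.
    by move=> cy; have := hB y cy; rewrite opprK addrC.
  have [h1 h2] := touching_operator_le n_gt0 dom s0 s1 pj U_min Uv cv Cphi Ox0 phiv0 phiv B0 hB' minA.
  have EB' : Lminus Omega s phi x0 = (- B)%:E by rewrite LminusN EB.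
  rewrite (eigen_opE EA EB') lee_fin; exact: arith_super Lam0 B0 h1 h2.
have [A [A0 EA hA minA]] := Lplus_real n_gt0 dom s0 s1 Cphi Ox0.
have [B [B0 EB hB minB]] := Lplus_real n_gt0 dom s0 s1 (C1_closureN Cphi) Ox0.
have EB' : Lminus Omega s phi x0 = (- B)%:E by rewrite LminusN EB.
have hA' y : closure Omega y -> - phi x0 - - phi y <= A * enorm (y - x0) `^ s.
  by move=> cy; have := hA y cy; rewrite opprK addrC.
have NU j : normalized_minimizer Omega s (p_ j) (fun x => - U_ j x).
  exact: (normalized_minimizerN (domain_measurable dom) (domain_finite dom)).
have NUv e : 0 < e -> \forall j \near \oo, forall x, closure Omega x -> `|- U_ j x - - v x| <= e.
  move=> e0; apply: filterS (Uv e0) => j h x cx.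
  by rewrite -opprD normrN; exact: h.
have Ncv : C0_closure Omega (fun x => - v x).
  by move=> x; apply: (@continuousN R R^o); exact: cv.
have Nphiv0 : - phi x0 = - v x0 by rewrite phiv0.
have Nphiv y : closure Omega y -> - phi y <= - v y by move=> cy; rewrite lerN2; exact: phiv.
have [h1 h2] := touching_operator_le n_gt0 dom s0 s1 pj NU NUv Ncv (C1_closureN Cphi) Ox0
  Nphiv0 Nphiv A0 hA' minB.
by rewrite (eigen_opE EA EB') lee_fin; exact: arith_sub Lam0 A0 h1 h2.
Qed.

End viscosity.

Lemma uniform_cvg_dist (R : realType) (T : choiceType) (A : set T) (f : nat -> T -> R) (g : T -> R) :
  (forall e, 0 < e -> \forall j \near \oo, forall x, A x -> `|f j x - g x| <= e) ->
  {uniform A, f @ \oo --> g}.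
Proof.
move=> h P /uniform_nbhs[E [entE EP]].
move: entE; rewrite -entourage_ballE => -[e /= e0 eE].
have e2 : 0 < e / 2 by rewrite divr_gt0.
apply: filterS (h _ e2) => j fj; apply: EP => x Ax; apply: eE => /=.
rewrite /ball /= distrC; apply: le_lt_trans (fj x Ax) _.
by rewrite ltr_pdivrMr// ltr_pMr// ltr1n.
Qed.

(** * Subsequences of minimizers *)

Section compactness_of_minimizers.
Context (R : realType) (n : nat) (Omega : set 'rV[R]_n) (s : R).
Hypotheses (n_gt0 : (0 < n)%N) (dom : smooth_bounded_domain Omega) (s0 : 0 < s) (s1 : s < 1).
Local Notation Lam := (2 / diam Omega `^ s).

Lemma minimizers_cluster (p_ : nat -> R) (U_ : nat -> 'rV[R]_n -> R) :
  p_ @ \oo --> +oo -> (forall j, 1 < p_ j) ->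
  (forall j, normalized_minimizer Omega s (p_ j) (U_ j)) ->
  exists k : nat -> nat, {homo k : i j / (i < j)%N} /\
  exists v : 'rV[R]_n -> R,
    [/\ {uniform closure Omega, (fun j => U_ (k j)) @ \oo --> v},
        minimizer_infty Omega s v & viscosity_solution Omega s v].
Proof.
move=> pj p1 Umin; have oO : open Omega by case: dom.
have Lam0 : 0 < Lam by exact: Lam_gt0.
have [|j|j|j|M LM|k [hk [w [v [[cw cv] aew wv vH [v1 vp vm]]]]]] :=
  fractional_compactness dom s0 s1 (L0 := Lam) (u := U_) _ pj.
- exact: ltW.
- by have [[]] := Umin j.
- by have [] := Umin j.
- by have [] := Umin j.
- have up := pj _ (lambda1_upper n_gt0 dom s1 LM).
  by near=> j; have [_ _ _ -> _] := Umin j; near: j; exact: up.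
have big : \forall j \near \oo, n%:R < s * p_ j.
  have : \forall p \near +oo, n%:R < s * p.
    exists (n%:R / s); split; first exact: num_real.
    by move=> p; rewrite ltr_pdivrMr// mulrC.
  exact: pj.
have c_v : C0_closure Omega v by exact: continuous_subspaceT.
(* Minimizers are known to be continuous only for s p > n, so they are identified with their Hoelder
   representatives [w j] on the closure for large j only. *)
have Uv e : 0 < e -> \forall j \near \oo, forall x, closure Omega x -> `|U_ (k j) x - v x| <= e.
  move=> e0; near=> j => x cx.
  have bj : n%:R < s * p_ (k j) by near: j; exact: near_oo_sub hk big.
  have [_ _ _ _ /(_ bj) cU] := Umin (k j).
  have cwj : C0_closure Omega (w j) by exact: continuous_subspaceT.
  rewrite (C0_closure_ae_eq dom cU cwj (aew j) cx).
  by move: x cx; near: j; exact: wv.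
exists k; split => //; exists v; split.
- exact: uniform_cvg_dist.
- apply: (extremal_minimizer n_gt0 dom s0 s1) => //.
  + by apply: measurable_funTS; exact: continuous_measurable_rV.
  + by move=> x y Ox Oy; apply: vH; exact: subset_closure.
  + by move=> x Ox; apply: v1; exact: subset_closure.
- have pkj : p_ \o k @ \oo --> +oo.
    by move=> P /pj nP; exact: near_oo_sub hk nP.
  exact: (limit_viscosity_solution n_gt0 dom s0 s1 pkj (fun j => p1 (k j)) (fun j => Umin (k j)) Uv c_v).
Unshelve. all: by end_near. Qed.

End compactness_of_minimizers.

Unset Implicit Arguments.

Theorem theorem1p2 (R : realType) (n : nat) (Omega : set 'rV[R]_n) (s : R)
    (n_gt0 : (0 < n)%N) (Omega_dom : smooth_bounded_domain Omega)
    (s_gt0 : 0 < s) (s_lt1 : s < 1) :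
  [/\ (lambda1 Omega s p `^ p^-1)%E @[p --> +oo] --> (2 / diam Omega `^ s)%:E,
      (2 / diam Omega `^ s)%:E = lambda1_infty Omega s &
      forall u_ : R -> 'rV[R]_n -> R,
        (forall p, 1 < p -> normalized_minimizer Omega s p (u_ p)) ->
      forall p_ : nat -> R,
        (forall j, 1 < p_ j) -> p_ j @[j --> \oo] --> +oo ->
      exists k : nat -> nat, {homo k : i j / (i < j)%N} /\
      exists u_infty : 'rV[R]_n -> R,
        [/\ {uniform closure Omega, (fun j => u_ (p_ (k j))) @ \oo --> u_infty},
            minimizer_infty Omega s u_infty &
            viscosity_solution Omega s u_infty]].
Proof.
split.
- exact: (lambda1_root_cvg n_gt0 Omega_dom s_gt0 s_lt1).
- by rewrite (lambda1_inftyE n_gt0 Omega_dom s_gt0 s_lt1).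
- move=> u_ u_min p_ p_gt1 p_oo.
  exact: (minimizers_cluster n_gt0 Omega_dom s_gt0 s_lt1 p_oo p_gt1 (fun j => u_min _ (p_gt1 j))).
Qed.
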